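(* Let $\mathcal{H}$ be a complex Hilbert space. For $T\in\boldsymbol{B}(\mathcal{H})$, the following conditions are equivalent: (i) $T$ is CPD; (ii) there exists a semispectral measure $M\colon\mathfrak{B}(\mathbb{R}_+)\to\boldsymbol{B}(\mathcal{H})$ with compact support such that $((X-1)^2q)\langle T\rangle=\int_{\mathbb{R}_+}q(x)\,M(\mathrm{d}x)$ for all $q\in\mathbb{C}[X]$; (ii$'$) there exist a Hilbert space $\mathcal{K}$, $R\in\boldsymbol{B}(\mathcal{H},\mathcal{K})$ and $S\in\boldsymbol{B}(\mathcal{K})_+$ such that $((X-1)^2q)\langle T\rangle=R^*q(S)R$ for all $q\in\mathbb{C}[X]$; (iii) there exists a semispectral measure $M\colon\mathfrak{B}(\mathbb{R}_+)\to\boldsymbol{B}(\mathcal{H})$ with compact support such that $T^{*n}\mathcal{B}_2(T)T^n=\int_{\mathbb{R}_+}x^n\,M(\mathrm{d}x)$ for all $n\in\mathbb{Z}_+$; (iii$'$) there exist a Hilbert space $\mathcal{K}$, $R\in\boldsymbol{B}(\mathcal{H},\mathcal{K})$ and $S\in\boldsymbol{B}(\mathcal{K})_+$ such that $T^{*n}\mathcal{B}_2(T)T^n=R^*S^nR$ for all $n\in\mathbb{Z}_+$. Moreover, the measures in (ii) and (iii) are unique and coincide with the unique compactly supported semispectral measure $M\colon\mathfrak{B}(\mathbb{R}_+)\to\boldsymbol{B}(\mathcal{H})$ satisfying $$p\langle T\rangle=p(1)I-p'(1)\mathcal{B}_1(T)+\int_{\mathbb{R}_+}(\mathfrak{D}_1^2p)(x)\,M(\mathrm{d}x),\quad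 p\in\mathbb{C}[X];$$ the triplets $(\mathcal{K},R,S)$ in (ii$'$) and (iii$'$) can be chosen to satisfy $\mathcal{K}=\bigvee\{S^n\mathscr{R}(R)\colon n\in\mathbb{Z}_+\}$.
   Context: $\boldsymbol{B}(\mathcal{H},\mathcal{K})$ denotes bounded linear operators from $\mathcal{H}$ to $\mathcal{K}$, $\boldsymbol{B}(\mathcal{H})=\boldsymbol{B}(\mathcal{H},\mathcal{H})$, and $\boldsymbol{B}(\mathcal{K})_+$ the nonnegative operators on $\mathcal{K}$. All Hilbert spaces are complex. $\mathbb{Z}_+=\{0,1,2,\ldots\}$, $\mathbb{R}_+=[0,\infty)$; $\mathfrak{B}(\mathbb{R}_+)$ is the Borel $\sigma$-algebra. $\mathscr{R}(R)$ is the range of $R$; $\bigvee$ is closed linear span. A real sequence $\{\gamma_n\}_{n=0}^\infty$ is conditionally positive definite (CPD) if $\sum_{i,j=0}^k \gamma_{i+j}\lambda_i\bar\lambda_j\geq 0$ for all finite complex sequences $\lambda_0,\ldots,\lambda_k$ with $\sum_{i=0}^k\lambda_i=0$. $T\in\boldsymbol{B}(\mathcal{H})$ is CPD if $\{\|T^nh\|^2\}_{n=0}^\infty$ is CPD for every $h\in\mathcal{H}$. For $p=\sum_i\alpha_iX^i\in\mathbb{C}[X]$, $p\langle T\rangle:=\sum_i\alpha_iT^{*i}T^i$. $\mathcal{B}_1(T)=I-T^*T$, $\mathcal{B}_2(T)=I-2T^*T+T^{*2}T^2$. $\mathfrak{D}_1^2p:=\frac{p-p(1)-p'(1)(X-1)}{(X-1)^2}\in\mathbb{C}[X]$.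 A semispectral measure $M\colon\mathfrak{B}(\mathbb{R}_+)\to\boldsymbol{B}(\mathcal{H})$ is a map that is $\sigma$-additive in the weak operator topology with $M(\Delta)\geq0$ for all $\Delta$ (no normalization); $\int\zeta\,\mathrm{d}M$ is the unique bounded operator with $\langle(\int\zeta\,\mathrm{d}M)h,h\rangle=\int\zeta(x)\langle M(\mathrm{d}x)h,h\rangle$ for all $h$. *)

(* Defs.v *)
From HB Require Import structures.
From mathcomp Require Import all_boot all_order all_algebra.
From mathcomp Require Import all_classical all_reals all_analysis.
From mathcomp Require Import complex.

Set Implicit Arguments.
Unset Strict Implicit.
Unset Printing Implicit Defensive.

Import Order.TTheory GRing.Theory Num.Theory numFieldNormedType.Exports.

Local Open Scope classical_set_scope.
Local Open Scope ring_scope.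
Local Open Scope complex_scope.

(* A Hilbert space: a Banach space over [C] whose norm comes from an inner
   product, linear in its first argument; complex Hilbert spaces are the
   instances with [C := R[i]] for [R : realType]. *)
HB.mixin Record CompleteNormedModule_isHilbert (C : numClosedFieldType) H
    & CompleteNormedModule C H := {
  inner : {dot H for (@Num.conj C)};
  inner_norm : forall x : H, inner x x = `|x| ^+ 2 }.

#[short(type="hilbertType")]
HB.structure Definition Hilbert (C : numClosedFieldType) :=
  {H of CompleteNormedModule C H & CompleteNormedModule_isHilbert C H}.

Arguments inner {R s} : rename.
Notation "''[' x , y ]" := (inner x y) : ring_scope.

Section BoundedOperators.
Variable C : numClosedFieldType.

Definition bounded_linear (H K : hilbertType C) (f : H -> K) : Prop :=
  linear f /\ exists c : C, forall x, `|f x| <= c * `|x|.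

Definition bounded_linear_pred (H K : hilbertType C) : {pred H -> K} :=
  fun f => `[< bounded_linear f >].

Record bop (H K : hilbertType C) := Bop {
  bop_fun :> H -> K;
  bop_subproof : bop_fun \in @bounded_linear_pred H K }.

HB.instance Definition _ (H K : hilbertType C) := [isSub for @bop_fun H K].
HB.instance Definition _ (H K : hilbertType C) := [Choice of bop H K by <:].

Lemma bopP (H K : hilbertType C) (A : bop H K) : bounded_linear A.
Proof. exact/asboolP/bop_subproof. Qed.

Lemma bop_submod_closed (H K : hilbertType C) :
  submod_closed (@bounded_linear_pred H K).
Proof.
split=> [|a f g /asboolP[lf [c hc]] /asboolP[lg [d hd]]]; apply/asboolP; split.
- by move=> b x y; have : (0 : K) = b *: 0 + 0 by rewrite scaler0 addr0.
- by exists 0 => x; have -> : (0 : H -> K) x = 0 by []; rewrite normr0 mul0r.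
- move=> b x y; have E z : (a *: f + g) z = a *: f z + g z by [].
  by rewrite !E lf lg !scalerDr !scalerA [a * b]mulrC addrACA.
- exists (`|a| * c + d) => x; have -> : (a *: f + g) x = a *: f x + g x by [].
  rewrite mulrDl -mulrA.
  apply: le_trans (ler_normD _ _) _; apply: lerD; last exact: hd.
  by rewrite normrZ ler_wpM2l.
Qed.

HB.instance Definition _ (H K : hilbertType C) :=
  GRing.isSubmodClosed.Build C _ (@bounded_linear_pred H K)
    (bop_submod_closed H K).
HB.instance Definition _ (H K : hilbertType C) :=
  [SubChoice_isSubLmodule of bop H K by <:].

Lemma bcomp_subproof (H K L : hilbertType C) (A : bop K L) (B : bop H K) :
  (A \o B) \in @bounded_linear_pred H L.
Proof.
apply/asboolP; have [lA [c hc]] := bopP A; have [lB [d hd]] := bopP B.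
split=> [a x y /=|]; first by rewrite lB lA.
exists (`|c| * d) => x /=; rewrite -mulrA.
have [Bx0|Bx0] := eqVneq `|B x| 0.
  apply: le_trans (hc _) _; rewrite Bx0 mulr0 mulr_ge0//.
  exact: le_trans (hd x).
have c0 : 0 <= c.
  rewrite -(pmulr_lge0 _ (_ : 0 < `|B x|)); last by rewrite lt0r Bx0/=.
  exact: le_trans (hc _).
by apply: le_trans (hc _) _; rewrite (ger0_norm c0) ler_wpM2l.
Qed.

Definition bcomp (H K L : hilbertType C) (A : bop K L) (B : bop H K) : bop H L :=
  Bop (bcomp_subproof A B).

Lemma bid_subproof (H : hilbertType C) : @idfun H \in @bounded_linear_pred H H.
Proof. by apply/asboolP; split=> //; exists 1 => x; rewrite mul1r. Qed.

Definition bid (H : hilbertType C) : bop H H := Bop (bid_subproof H).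

Section Ring.
Variable H : hilbertType C.
Implicit Types A B D : bop H H.

Lemma bcompA : associative (@bcomp H H H).
Proof. by move=> A B D; apply: val_inj. Qed.

Lemma bcomp1l : left_id (bid H) (@bcomp H H H).
Proof. by move=> A; apply: val_inj. Qed.

Lemma bcomp1r : right_id (bid H) (@bcomp H H H).
Proof. by move=> A; apply: val_inj. Qed.

Lemma bcompDl : left_distributive (@bcomp H H H) +%R.
Proof. by move=> A B D; apply: val_inj. Qed.

Lemma bcompDr : right_distributive (@bcomp H H H) +%R.
Proof.
move=> A B D; apply: val_inj; apply/funext => x /=.
have := (bopP A).1 1 (B x) (D x); rewrite !scale1r; exact.
Qed.

HB.instance Definition _ := GRing.Zmodule_isPzRing.Build (bop H H)
  bcompA bcomp1l bcomp1r bcompDl bcompDr.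
End Ring.

(* The (unique) [B] with [<A x, y> = <x, B y>], selected by choice. *)
Definition adjoint (H K : hilbertType C) (A : bop H K) : bop K H :=
  xget 0 [set B : bop K H | forall x y, '[A x, y] = '[x, B y]].

(* In a [numClosedFieldType], [0 <= z] means that [z] is real and nonnegative. *)
Definition bop_ge0 (H : hilbertType C) (A : bop H H) : Prop :=
  forall h, 0 <= '[A h, h].

End BoundedOperators.

Notation "''B' ( H , K )" := (bop H K)
  (at level 8, format "''B' ( H ,  K )") : type_scope.
Notation "''B' ( H )" := (bop H H) (at level 8, format "''B' ( H )") : type_scope.
Notation "A ^adj" := (adjoint A) (at level 1, format "A ^adj") : ring_scope.

Section CPD.
Variable R : realType.
Local Notation C := R[i].
Implicit Types H K : hilbertType R[i].

Definition cpd_seq (g : nat -> R) : Prop :=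
  forall (k : nat) (l : 'I_k.+1 -> C), \sum_i l i = 0 ->
    0 <= \sum_(i < k.+1) \sum_(j < k.+1) (g (i + j)%N)%:C * l i * (l j)^*%R.

(* [complex.Re] reads the norm, which lives in [R[i]], as a real number. *)
Definition cpd_op H (T : 'B(H)) : Prop :=
  forall h, cpd_seq (fun n => complex.Re (`|(T ^+ n) h| ^+ 2)).

Definition poly_bracket H (p : {poly C}) (T : 'B(H)) : 'B(H) :=
  \sum_(i < size p) p`_i *: (T^adj ^+ i * T ^+ i).

(* [horner] and [horner_alg] need a nontrivial ring, whereas [H] may be 0. *)
Definition poly_op H (q : {poly C}) (S : 'B(H)) : 'B(H) :=
  \sum_(i < size q) q`_i *: S ^+ i.

Definition B1 H (T : 'B(H)) : 'B(H) := 1 - T^adj * T.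

Definition B2 H (T : 'B(H)) : 'B(H) :=
  1 - (T^adj * T) *+ 2 + T^adj ^+ 2 * T ^+ 2.

(* The division is exact. *)
Definition D12 (p : {poly C}) : {poly C} :=
  (p - p.[1]%:P - p^`().[1] *: ('X - 1)) %/ ('X - 1) ^+ 2.

Definition closed_span H (A : set H) : set H :=
  closure [set x | exists (n : nat) (c : 'I_n -> C) (v : 'I_n -> H),
    (forall i, A (v i)) /\ x = \sum_i c i *: v i].

End CPD.

Section Semispectral.
Variable R : realType.
Local Notation C := R[i].
Implicit Types H : hilbertType R[i].

Definition Rplus : set R := `[0, +oo[.

Definition borelRplus (D : set R) : Prop := measurable D /\ D `<=` Rplus.

(* Only the values on Borel subsets of the half-line are meaningful; see
   [semispectral_eq]. Weak sigma-additivity at the constant sequence [set0]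
   forces [M set0 = 0]. *)
Record semispectral H := Semispectral {
  spectral_val :> set R -> 'B(H);
  spectral_ge0 : forall D, borelRplus D -> bop_ge0 (spectral_val D);
  spectral_sigma_additive : forall F : nat -> set R,
    (forall n, borelRplus (F n)) -> trivIset setT F ->
    forall h k,
      (fun n => \sum_(0 <= i < n) '[spectral_val (F i) h, k] : C^o) @ \oo
        --> ('[spectral_val (\bigcup_n F n) h, k] : C^o) }.

Arguments spectral_ge0 {H} _ {D} _ _.
Arguments spectral_sigma_additive {H} _ {F} _ _ _ _.

Definition semispectral_eq H (M N : semispectral H) : Prop :=
  forall D, borelRplus D -> M D = N D.

(* The measure [D |-> <M(D)h, h>], extended by 0 outside the half-line; library
   measures must be defined (and nonnegative) on nonmeasurable sets as well. *)
Definition scalar_measure H (M : semispectral H) (h : H) (D : set R) : \bar R :=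
  if `[< measurable D >] then (complex.Re '[M (D `&` Rplus) h, h])%:E else 0%E.

Section ScalarMeasure.
Variables (H : hilbertType R[i]) (M : semispectral H) (h : H).
Local Notation mu := (scalar_measure M h).

Lemma borelRplusI (D : set R) : measurable D -> borelRplus (D `&` Rplus).
Proof.
move=> mD; split; last by move=> x [].
by apply: measurableI => //; exact: measurable_itv.
Qed.

Lemma borelRplus0 : borelRplus set0.
Proof. by split=> // ? []. Qed.

Lemma spectral_val0 : '[M set0 h, h] = 0.
Proof.
have := spectral_sigma_additive M (F := fun=> set0)
  (fun=> borelRplus0) (@trivIset_set0 _ _ setT) h h.
rewrite bigcup0//; set c := '[_, _] => cvc.
have cvc1 : (fun n => \sum_(0 <= i < n.+1) c : C^o) @ \oo --> (c : C^o).
  by have := cvc; rewrite -(cvg_shiftS _).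
have := cvgB cvc1 cvc; rewrite subrr.
rewrite (_ : _ - _ = fun=> c : C^o) => [c0|].
  exact: (@cvg_unique C^o (@norm_hausdorff _ C^o) _ _ _ _ (cvg_cst (c : C^o)) (c0 _)).
by apply/funext => n; rewrite !fctE big_nat_recr//= addrAC subrr add0r.
Qed.

Lemma cvg_Re (u : nat -> C) (l : C) :
  (u : nat -> C^o) @ \oo --> (l : C^o) ->
  (fun n => complex.Re (u n)) @ \oo --> complex.Re l.
Proof.
move=> /cvgrPdist_lt ul; apply/cvgrPdist_lt => e e0.
have /ul : 0 < e%:C by rewrite ltcR.
apply: filterS => n; rewrite -ltcR; apply: le_lt_trans.
rewrite -raddfB. exact: normc_ge_Re.
Qed.

Lemma scalar_measureE D : measurable D ->
  mu D = (complex.Re '[M (D `&` Rplus) h, h])%:E.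
Proof. by move=> mD; rewrite /scalar_measure asboolT. Qed.

Lemma scalar_measure0 : mu set0 = 0%E.
Proof. by rewrite scalar_measureE// set0I spectral_val0. Qed.

Lemma scalar_measure_ge0 D : (0 <= mu D)%E.
Proof.
rewrite /scalar_measure; case: asboolP => // mD; rewrite lee_fin.
by have := spectral_ge0 M (borelRplusI mD) h; rewrite lecE => /andP[].
Qed.

Lemma scalar_measure_sigma_additive : semi_sigma_additive mu.
Proof.
move=> F mF tF mUF; rewrite scalar_measureE// setI_bigcupl.
apply: cvg_EFin => [|/=].
  apply: nearW => n; apply/sum_fin_numP => i _ _.
  by rewrite scalar_measureE.
have := cvg_Re (spectral_sigma_additive M (F := fun n => F n `&` Rplus)
  (fun n => borelRplusI (mF n)) (trivIset_setIr tF) h h).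
apply: cvg_trans; apply: near_eq_cvg; apply: nearW => n /=.
under [in RHS]eq_bigr do rewrite scalar_measureE//.
by rewrite raddf_sum sumEFin.
Qed.

HB.instance Definition _ := isMeasure.Build _ _ R mu
  scalar_measure0 scalar_measure_ge0 scalar_measure_sigma_additive.

End ScalarMeasure.

Definition spectral_integrable H (M : semispectral H) (z : R -> C) : Prop :=
  forall h, (scalar_measure M h).-integrable Rplus (EFin \o (fun x => complex.Re (z x)))
    /\ (scalar_measure M h).-integrable Rplus (EFin \o (fun x => complex.Im (z x))).

(* [A] is the operator integral of [z] with respect to [M]. *)
Definition is_spectral_integral H (M : semispectral H) (z : R -> C) (A : 'B(H)) :
    Prop :=
  spectral_integrable M z /\
  forall h, '[A h, h] =
    (\int[scalar_measure M h]_(x in Rplus) complex.Re (z x))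
    +i* (\int[scalar_measure M h]_(x in Rplus) complex.Im (z x)).

(* The closed support, i.e. the least closed set of full measure. *)
Definition spectral_support H (M : semispectral H) : set R :=
  \bigcap_(F in [set F | closed F /\ F `<=` Rplus /\ M (Rplus `\` F) = 0]) F.

Definition compactly_supported H (M : semispectral H) : Prop :=
  compact (spectral_support M).

End Semispectral.

Section Conditions.
Variables (R : realType) (H : hilbertType R[i]) (T : 'B(H)).

Definition cond_ii (M : semispectral H) : Prop :=
  forall q : {poly R[i]},
    is_spectral_integral M (fun x => q.[x%:C])
      (poly_bracket (('X - 1) ^+ 2 * q) T).

Definition cond_iii (M : semispectral H) : Prop :=
  forall n : nat,
    is_spectral_integral M (fun x => (x ^+ n)%:C) (T^adj ^+ n * B2 T * T ^+ n).

Definition cond_repr (M : semispectral H) : Prop :=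
  forall p : {poly R[i]}, exists A : 'B(H),
    is_spectral_integral M (fun x => (D12 p).[x%:C]) A /\
    poly_bracket p T = p.[1] *: (1 : 'B(H)) - p^`().[1] *: B1 T + A.

Variables (K : hilbertType R[i]) (Q : 'B(H, K)) (S : 'B(K)).

Definition cond_ii' : Prop :=
  forall q : {poly R[i]},
    poly_bracket (('X - 1) ^+ 2 * q) T = bcomp Q^adj (bcomp (poly_op q S) Q).

Definition cond_iii' : Prop :=
  forall n : nat, T^adj ^+ n * B2 T * T ^+ n = bcomp Q^adj (bcomp (S ^+ n) Q).

Definition minimal_triplet : Prop :=
  closed_span [set x | exists (n : nat) (h : H), x = (S ^+ n) (Q h)] = setT.

End Conditions.

(* Main.v *)
Require Import Defs.
From HB Require Import structures.
From mathcomp Require Import all_boot all_order all_algebra.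
From mathcomp Require Import all_classical all_reals all_analysis.
From mathcomp Require Import measurable_realfun complex.
From mathcomp Require Import ring lra zify.

Set Implicit Arguments.
Unset Strict Implicit.
Unset Printing Implicit Defensive.

Import Order.TTheory GRing.Theory Num.Theory numFieldNormedType.Exports.

Local Open Scope classical_set_scope.
Local Open Scope ring_scope.
Local Open Scope complex_scope.

(** For [h] in [H] let [L_h q := <((X - 1)^2 q)<T> h, h>] for real polynomials
    [q].  Finite sequences with sum zero are the coefficients of multiples of
    [X - 1], so [T] is CPD iff [L_h (u^2) >= 0] for all [h] and [u].  Replacing
    [h] by [T h] gives [L_h (X u^2) >= 0] as well, and [L_h (X^n)] grows at most
    like [c^(2n)] with [c] a bound for [T].  The sequence [n |-> L_h (X^n r^2)] is
    logarithmically convex, hence cannot grow that slowly unless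
    [L_h ((a - X) r^2) >= 0] for [a > c^2]; by Bernstein approximation [L_h] is
    then nonnegative on every polynomial that is nonnegative on [[0, a]], so it is
    integration against a measure [mu_h] on [[0, a]].  For fixed [D], the map
    [h |-> mu_h D] is the quadratic form of an operator [M D]: this holds for
    half-lines by weak limits, and passes to all Borel sets by the pi-lambda
    theorem.  Conversely the growth of its moments confines a measure as in (iii)
    to [[0, a]], where moments determine it; this gives uniqueness.

    For (ii') one completes the space of finitely supported sequences in [H] for
    [<f, g> := sum_(i,j) <((X - 1)^2 X^(i+j))<T> f_i, g_j>]; [S] is the right
    shift and [R h] the sequence [(h, 0, 0, ...)]. *)

(** * Positive forms and Hilbert spaces *)

(** The CPD condition speaks of one vector at a time: [L_h (u^2) >= 0] says nothing directly about
    the double sums over different vectors [f_i] behind (ii'). Bernstein polynomials bridge this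
    gap. Their nodes are scalars, so an approximant of such a double sum regroups into values of
    nonnegative operators at single vectors, where positivity on the interval applies.

    The interval [[0, rad T]] and the constant [growthc T] depend on [T] alone. This uniformity in
    [h] turns the numbers [mu_h D] into the quadratic form of a bounded operator and confines all
    the scalar measures to one compact set. The radius exceeds the growth rate [opc T ^+ 2] of the
    moments by 1, and this strict gap is what excludes mass beyond it in the converse direction.

    The measure [mu_h] is built from its distribution function, a limit of values of [L_h] at
    polynomials that decrease to the indicator of a half-line on the interval. These polynomials do
    not depend on [h], and each value is a quadratic form in [h]; hence so is the limit. That this
    measure integrates polynomials to [L_h] then follows from determinacy: a positive functional is
    recovered from its distribution function by Riemann sums. *)

Section Complex.
Variable R : realType.
Local Notation C := R[i].

Lemma ge0_Re (z : C) : 0 <= z -> z = (complex.Re z)%:C.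
Proof. by move=> /ger0_Im; case: z => x y /= ->. Qed.

Lemma cplxP (z w : C) : complex.Re z = complex.Re w ->
  complex.Im z = complex.Im w -> z = w.
Proof. by case: z w => [x y] [x' y'] /= -> ->. Qed.

Lemma Re_conj (z : C) : complex.Re z^*%R = complex.Re z.
Proof. by case: z. Qed.
Lemma conjR (x : R) : (x%:C)^*%R = x%:C.
Proof. exact: conjc_real. Qed.
Lemma Im_conj (z : C) : complex.Im z^*%R = - complex.Im z.
Proof. by case: z. Qed.

Lemma ReM (z w : C) : complex.Re (z * w) =
  complex.Re z * complex.Re w - complex.Im z * complex.Im w.
Proof. by case: z w => [x y] [x' y']. Qed.
Lemma ImM (z w : C) : complex.Im (z * w) =
  complex.Re z * complex.Im w + complex.Im z * complex.Re w.
Proof. by case: z w => [x y] [x' y']. Qed.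
Lemma ReD (z w : C) : complex.Re (z + w) = complex.Re z + complex.Re w.
Proof. by case: z w => [x y] [x' y']. Qed.
Lemma ImD (z w : C) : complex.Im (z + w) = complex.Im z + complex.Im w.
Proof. by case: z w => [x y] [x' y']. Qed.
Lemma ReN (z : C) : complex.Re (- z) = - complex.Re z.
Proof. by case: z. Qed.

End Complex.

Section PsdForm.
Variable R : realType.
Local Notation C := R[i].

(** Only semidefinite, so that one notion covers inner products, the forms of nonnegative operators,
    and the pre-inner product that is completed later. *)
Record psd_form (V : lmodType C) (B : V -> V -> C) : Prop := PsdForm {
  psd_lin : forall a x y z, B (a *: x + y) z = a * B x z + B y z;
  psd_herm : forall x y, B y x = (B x y)^*%R;
  psd_ge0 : forall x, 0 <= B x x }.

Variables (V : lmodType C) (B : V -> V -> C) (hB : psd_form B).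

Definition fsq (x : V) : R := complex.Re (B x x).

Lemma psdE x : B x x = (fsq x)%:C.
Proof. exact/ge0_Re/(psd_ge0 hB). Qed.

Lemma fsq_ge0 x : 0 <= fsq x.
Proof. by have := psd_ge0 hB x; rewrite psdE ler0c. Qed.

Lemma psd0l x : B 0 x = 0.
Proof.
have := psd_lin hB 1 0 0 x; rewrite scaler0 addr0 mul1r => /eqP.
by rewrite addrC -subr_eq subrr eq_sym => /eqP.
Qed.
Lemma psdZl a x y : B (a *: x) y = a * B x y.
Proof. by rewrite -[a *: x]addr0 (psd_lin hB) psd0l addr0. Qed.
Lemma psdDl x y z : B (x + y) z = B x z + B y z.
Proof. by rewrite -[x]scale1r (psd_lin hB) mul1r scale1r. Qed.
Lemma psdNl x y : B (- x) y = - B x y.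
Proof. by rewrite -scaleN1r psdZl mulN1r. Qed.
Lemma psdBl x y z : B (x - y) z = B x z - B y z.
Proof. by rewrite psdDl psdNl. Qed.
Lemma psdDr x y z : B z (x + y) = B z x + B z y.
Proof. by rewrite (psd_herm hB) psdDl rmorphD /= -!(psd_herm hB). Qed.
Lemma psdZr a x y : B y (a *: x) = a^*%R * B y x.
Proof. by rewrite (psd_herm hB) psdZl rmorphM /= -(psd_herm hB). Qed.
Lemma psdNr x y : B y (- x) = - B y x.
Proof. by rewrite (psd_herm hB) psdNl rmorphN /= -(psd_herm hB). Qed.
Lemma psdBr x y z : B z (x - y) = B z x - B z y.
Proof. by rewrite psdDr psdNr. Qed.
Lemma psd0r x : B x 0 = 0.
Proof. by rewrite (psd_herm hB) psd0l rmorph0. Qed.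

Lemma fsqD x y : fsq (x + y) = fsq x + fsq y + 2 * complex.Re (B x y).
Proof.
rewrite /fsq psdDl !psdDr !ReD (psd_herm hB x y) Re_conj; ring.
Qed.
Lemma fsqZ a x : (fsq (a *: x))%:C = `|a| ^+ 2 * (fsq x)%:C.
Proof. by rewrite -!psdE psdZl psdZr mulrA normCK. Qed.
Lemma fsqZr (a : R) x : fsq (a%:C *: x) = a ^+ 2 * fsq x.
Proof.
apply: complexI; rewrite fsqZ rmorphM rmorphXn /=.
by rewrite normc_def /= expr0n /= addr0 sqrtr_sqr -rmorphXn /= real_normK ?num_real// rmorphXn.
Qed.
Lemma fsqN x : fsq (- x) = fsq x.
Proof. by rewrite /fsq psdNl psdNr opprK. Qed.
Lemma fsqB x y : fsq (x - y) = fsq x + fsq y - 2 * complex.Re (B x y).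
Proof. by rewrite fsqD fsqN psdNr ReN mulrN. Qed.
Lemma fsqDle x y : fsq (x + y) <= 2 * fsq x + 2 * fsq y.
Proof. have := fsq_ge0 (x - y); rewrite fsqB fsqD; lra. Qed.

Lemma psd_CS x y : `|B x y| ^+ 2 <= (fsq x * fsq y)%:C.
Proof.
set b := B x y.
have nb : `|b| ^+ 2 = (complex.Re (b * b^*%R))%:C.
  by rewrite normCK; apply: ge0_Re; rewrite -normCK exprn_ge0.
set n := complex.Re (b * _) in nb *.
have n0 : 0 <= n by rewrite -ler0c -nb exprn_ge0.
rewrite nb lecR.
(* Scaling [y] by [b] makes the cross term real, which leaves a real quadratic in [s] with
   nonnegative values. *)
have key (s : R) : 0 <= fsq x + s ^+ 2 * n * fsq y - 2 * s * n.
  have := fsq_ge0 (x - s%:C *: (b *: y)).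
  rewrite fsqB fsqZr.
  have -> : fsq (b *: y) = n * fsq y.
    by apply: complexI; rewrite fsqZ rmorphM nb.
  have -> : complex.Re (B x (s%:C *: (b *: y))) = s * n.
    rewrite !psdZr -/b (conjR s) ReM /= mul0r subr0.
    by rewrite mulrC [b^*%R * b]mulrC mulrC.
  by rewrite mulrA => h; rewrite mulrA in h *.
have [y0|y0] := eqVneq (fsq y) 0.
  have [->|nN0] := eqVneq n 0; first by rewrite mulr_ge0 ?fsq_ge0.
  (* For [fsq y = 0] the quadratic is affine in [s], and this [s] gives it the value -1. *)
  have := key ((fsq x + 1) / (2 * n)).
  rewrite y0 mulr0 addr0 => h.
  have : 2 * ((fsq x + 1) / (2 * n)) * n = fsq x + 1 by field.
  move=> e; rewrite e in h; lra.
have yp : 0 < fsq y by rewrite lt0r y0 fsq_ge0.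
have := key (fsq y)^-1.
have -> : (fsq y)^-1 ^+ 2 * n * fsq y = n / fsq y by field.
have -> : 2 * (fsq y)^-1 * n = 2 * (n / fsq y) by field.
move=> h.
have : n / fsq y <= fsq x by lra.
by rewrite ler_pdivrMr.
Qed.

Lemma psd_CS_le x y (a b : R) : 0 <= a -> 0 <= b -> fsq x <= a ^+ 2 ->
  fsq y <= b ^+ 2 -> `|B x y| <= (a * b)%:C.
Proof.
move=> a0 b0 xa yb; rewrite -(@ler_pXn2r _ 2)// ?nnegrE ?ler0c ?mulr_ge0//.
apply: le_trans (psd_CS x y) _; rewrite -rmorphXn lecR exprMn.
by apply: ler_pM; rewrite ?fsq_ge0.
Qed.

End PsdForm.

Section HilbertBasics.
Variable R : realType.
Local Notation C := R[i].

Lemma inner_psd (H : hilbertType C) : psd_form (@inner C H).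
Proof.
split=> [a x y z|x y|x].
- by rewrite linearDl /= linearZl_LR.
- by rewrite hermC expr0 mul1r.
- by rewrite inner_norm exprn_ge0.
Qed.

Definition n2 (H : hilbertType C) (x : H) : R := fsq inner x.

Section One.
Variable H : hilbertType C.
Implicit Types x y : H.

Lemma innerE x : '[x, x] = (n2 x)%:C.
Proof. exact: psdE (inner_psd H) x. Qed.

Lemma norm_n2 x : `|x| ^+ 2 = (n2 x)%:C.
Proof. by rewrite -inner_norm innerE. Qed.

Lemma n2_ge0 x : 0 <= n2 x.
Proof. exact: fsq_ge0 (inner_psd H) x. Qed.

Lemma norm_lt x (e : R) : 0 <= e -> (`|x| < e%:C) = (n2 x < e ^+ 2).
Proof.
move=> e0; rewrite -(@ltr_pXn2r _ 2)// ?nnegrE ?ler0c//.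
by rewrite norm_n2 -rmorphXn ltcR.
Qed.

Lemma inner_CS x y : `|'[x, y]| <= `|x| * `|y|.
Proof.
rewrite -(@ler_pXn2r _ 2)// ?nnegrE ?mulr_ge0//.
apply: le_trans (psd_CS (inner_psd H) x y) _.
by rewrite exprMn !norm_n2 rmorphM.
Qed.

Lemma n2_eq0 x : n2 x = 0 -> x = 0.
Proof.
move=> h; apply/normr0_eq0/eqP.
by rewrite -sqrf_eq0 norm_n2 h.
Qed.

Lemma inner_ext x y : (forall z, '[x, z] = '[y, z]) -> x = y.
Proof.
move=> h; apply/subr0_eq/n2_eq0.
by rewrite /n2 /fsq (psdBl (inner_psd H)) h subrr.
Qed.

Lemma cvg_n2P (u : nat -> H) l : u @ \oo --> l <->
  forall e : R, 0 < e -> exists N, forall n, (N <= n)%N -> n2 (l - u n) < e.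
Proof.
split=> [/cvgrPdist_lt h e e0|h].
  have : 0 < (Num.sqrt e)%:C by rewrite ltcR sqrtr_gt0.
  move=> /h [N _ hN]; exists N => n Nn.
  by have := hN n Nn; rewrite /= norm_lt ?sqrtr_ge0// sqr_sqrtr// ltW.
apply/cvgrPdist_lt => e e0; rewrite (ge0_Re (ltW e0)).
have {}e0 : 0 < complex.Re e by rewrite -ltcR -(ge0_Re (ltW e0)).
have [|N hN] := h (complex.Re e ^+ 2); first by rewrite exprn_gt0.
by exists N => // n Nn /=; rewrite norm_lt ?hN// ltW.
Qed.

Definition n2_cauchy (u : nat -> H) := forall e : R, 0 < e ->
  exists N, forall m n, (N <= m)%N -> (N <= n)%N -> n2 (u m - u n) < e.

Lemma n2_cauchy_cvg (u : nat -> H) : n2_cauchy u -> exists l : H, u @ \oo --> l.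
Proof.
move=> h; suff /cvg_ex[l ul] : cvgn u by exists l.
apply/cauchy_cvgP/cauchy_exP => e e0.
rewrite (ge0_Re (ltW e0)).
have {}e0 : 0 < complex.Re e by rewrite -ltcR -(ge0_Re (ltW e0)).
have [|N hN] := h (complex.Re e ^+ 2); first by rewrite exprn_gt0.
exists (u N); exists N => // n Nn /=.
by rewrite -ball_normE /ball_ /= norm_lt ?hN// ltW.
Qed.

Lemma cvg_inner_l (u : nat -> H) l z : u @ \oo --> l ->
  (fun n => '[u n, z] : C^o) @ \oo --> ('[l, z] : C^o).
Proof.
move=> /cvgrPdist_lt h; apply/cvgrPdist_lt => e e0.
have z0 : 0 < `|z| + 1 by rewrite ltr_wpDl.
have /h : 0 < e / (`|z| + 1) by rewrite divr_gt0.
apply: filterS => n hn; rewrite -(psdBl (inner_psd H)).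
apply: le_lt_trans (inner_CS _ _) _.
have : `|l - u n| * (`|z| + 1) < e by rewrite -ltr_pdivlMr.
by apply: le_lt_trans; rewrite ler_wpM2l// lerDl.
Qed.

Lemma riesz_repr (f : H -> C) (c : R) : 0 <= c -> linear_for *%R f ->
  (forall x, `|f x| ^+ 2 <= (c * n2 x)%:C) -> exists y, forall x, f x = '[x, y].
Proof.
move=> c0 lf bf.
have fD x y : f (x + y) = f x + f y.
  by rewrite -[x]scale1r lf mul1r scale1r.
have f0 : f 0 = 0.
  by have := fD 0 0; rewrite addr0 => /eqP; rewrite addrC -subr_eq subrr => /eqP.
have fZ a x : f (a *: x) = a * f x by rewrite -[a *: x]addr0 lf f0 addr0.
have fZr (s : R) x : complex.Re (f (s%:C *: x)) = s * complex.Re (f x).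
  by rewrite fZ ReM /= mul0r subr0.
(* The representing vector is the minimizer of [J]. *)
pose J x := n2 x - 2 * complex.Re (f x).
have Jlb x : - c <= J x.
  have : complex.Re (f x) ^+ 2 <= c * n2 x.
    rewrite -lecR; apply: le_trans (bf x); rewrite -add_Re2_Im2 lecR.
    by rewrite lerDl sqr_ge0.
  have := n2_ge0 x; rewrite /J.
  set r := complex.Re _; set n := n2 x => n0 h.
  (* Follows from [r ^+ 2 <= c * n] and [4 * c * n <= (n + c) ^+ 2]. *)
  suff : 2 * r <= n + c by lra.
  rewrite leNgt; apply/negP => hh.
  have : (n + c) ^+ 2 < (2 * r) ^+ 2 by rewrite ltrXn2r//; lra.
  by have := sqr_ge0 (n - c); nra.
pose d := inf (range J).
have hinf : has_inf (range J).
  by split; [exists (J 0); exists 0|exists (- c) => _ [x _ <-]].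
have dJ x : d <= J x by apply: inf_lbound; [exact: hinf.2|exists x].
have /choice [u hu] : forall n : nat, exists x, J x < d + n.+1%:R^-1.
  move=> n; have e0 : (0 : R) < n.+1%:R^-1 by rewrite invr_gt0.
  by have [_ [x _ <-] hx] := inf_adherent e0 hinf; exists x.
(* The parallelogram identity, with [J >= d] at the midpoint; it makes minimizing sequences
   Cauchy. *)
have par x y : n2 (x - y) <= 2 * (J x - d) + 2 * (J y - d).
  have := dJ ((2^-1 : R)%:C *: (x + y)).
  rewrite /J /n2 (fsqZr (inner_psd H)) fZr fD ReD !(fsqB (inner_psd H)) !(fsqD (inner_psd H)).
  lra.
have [y uy] : exists l : H, u @ \oo --> l.
  apply: n2_cauchy_cvg => e e0.
  have [N hN] : exists N : nat, N.+1%:R^-1 < e / 4.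
    have e4 : 0 < 4 / e by rewrite divr_gt0.
    exists (Num.truncn (4 / e)); rewrite -[e / 4]invf_div ltf_pV2 ?posrE//.
    exact: truncnS_gt.
  exists N => m n Nm Nn.
  have hk k : (N <= k)%N -> J (u k) < d + N.+1%:R^-1.
    by move=> Nk; rewrite (lt_le_trans (hu k))// lerD2l lef_pV2 ?posrE// ler_nat.
  apply: le_lt_trans (par _ _) _.
  move: hN (hk _ Nm) (hk _ Nn); move: (N.+1%:R^-1) => r; lra.
have ReE z : complex.Re (f z) = complex.Re '[z, y].
  pose a := complex.Re '[y, z] - complex.Re (f z).
  have key (s : R) : 0 <= s ^+ 2 * n2 z + 2 * s * a.
    have cv : (fun n => s ^+ 2 * n2 z + 2 * s * (complex.Re '[u n, z] - complex.Re (f z))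
        + n.+1%:R^-1) @ \oo --> s ^+ 2 * n2 z + 2 * s * a + 0.
      apply: cvgD; last exact: cvg_harmonic.
      apply: cvgD; first exact: cvg_cst.
      apply: cvgM; first exact: cvg_cst.
      by apply: cvgB; [exact/cvg_Re/cvg_inner_l|exact: cvg_cst].
    rewrite addr0 in cv; apply: (cvgr_to_ge cv); apply: nearW => n.
    have := dJ (u n + s%:C *: z); have := hu n; move: (n.+1%:R^-1) => r.
    rewrite /J /n2 (fsqD (inner_psd H)) (fsqZr (inner_psd H)) fD ReD fZr.
    have -> : complex.Re '[u n, s%:C *: z] = s * complex.Re '[u n, z].
      by rewrite (psdZr (inner_psd H)) conjR ReM /= mul0r subr0.
    lra.
  have : a = 0.
    have n0 := n2_ge0 z.
    (* Nearly the minimizer [- a / n2 z]; the added 1 covers [z = 0], and the value is still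
       negative unless [a = 0]. *)
    have := key (- a / (n2 z + 1)).
    have -> : (- a / (n2 z + 1)) ^+ 2 * n2 z + 2 * (- a / (n2 z + 1)) * a
      = - (a ^+ 2 * ((n2 z + 2) / (n2 z + 1) ^+ 2)).
      by field; rewrite gt_eqF// ltr_wpDl.
    rewrite oppr_ge0 => h; apply/eqP; rewrite -sqrf_eq0 eq_le sqr_ge0 andbT.
    rewrite -(@pmulr_lle0 _ ((n2 z + 2) / (n2 z + 1) ^+ 2)) //.
    by rewrite divr_gt0 ?exprn_gt0 ?ltr_wpDl.
  move=> a0; rewrite (psd_herm (inner_psd H)) Re_conj.
  by apply/esym/subr0_eq.
exists y => x; apply: cplxP; first exact: ReE.
(* Linearity over the complex numbers recovers the imaginary part from the real part at [i x]. *)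
have := ReE ('i%C *: x); rewrite fZ (psdZl (inner_psd H)) !ReM /= !mul0r !mul1r !add0r.
by move=> /oppr_inj.
Qed.

End One.
End HilbertBasics.

Lemma polarization_identity (F : numFieldType) (i p q r s : F) : i * i = -1 ->
  q = 4^-1 * (p + q + (r + s) - (p - q + (- r - - s)) +
    i * (p + - i * q + (i * r + i * (- i * s)) -
      (p - - i * q + (- (i * r) - - (i * (- i * s)))))).
Proof.
move=> i2.
transitivity (4^-1 * (2 * q + 2 * r - (i * i) * (2 * q) + (i * i) * (2 * r))).
  by rewrite i2; field.
by ring.
Qed.

Lemma polarization (C : numClosedFieldType) (V : lmodType C) (b : V -> V -> C) :
  (forall a x y z, b (a *: x + y) z = a * b x z + b y z) ->
  (forall a x y z, b z (a *: x + y) = a^*%R * b z x + b z y) ->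
  forall h k, b h k = 4^-1 * (b (h + k) (h + k) - b (h - k) (h - k) +
    'i * (b (h + 'i *: k) (h + 'i *: k) - b (h - 'i *: k) (h - 'i *: k))).
Proof.
move=> bl br h k.
have bDl x y z : b (x + y) z = b x z + b y z.
  by rewrite -[x]scale1r bl mul1r scale1r.
have b0l z : b 0 z = 0.
  by have := bDl 0 0 z; rewrite addr0 => /eqP; rewrite addrC -subr_eq subrr => /eqP.
have bZl a x z : b (a *: x) z = a * b x z by rewrite -[a *: x]addr0 bl b0l addr0.
have bDr x y z : b z (x + y) = b z x + b z y.
  by rewrite -[x]scale1r br rmorph1 mul1r scale1r.
have b0r z : b z 0 = 0.
  by have := bDr 0 0 z; rewrite addr0 => /eqP; rewrite addrC -subr_eq subrr => /eqP.
have bZr a x z : b z (a *: x) = a^*%R * b z x.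
  by rewrite -[a *: x]addr0 br b0r addr0.
have i2 : ('i : C) * 'i = -1 by rewrite -expr2 sqrCi.
have bNl x z : b (- x) z = - b x z by rewrite -scaleN1r bZl mulN1r.
have bNr x z : b z (- x) = - b z x.
  by rewrite -scaleN1r bZr rmorphN rmorph1 mulN1r.
rewrite !(bDl, bDr, bNl, bNr, bZl, bZr) conjCi.
by apply: polarization_identity.
Qed.

Lemma cvg_axpy (K : numFieldType) (a : K) (u v : nat -> K) (l m : K) :
  (u : nat -> K^o) @ \oo --> (l : K^o) -> (v : nat -> K^o) @ \oo --> (m : K^o) ->
  (fun n => a * u n + v n : K^o) @ \oo --> (a * l + m : K^o).
Proof.
move=> ul vm; apply: cvgD vm.
exact: (cvgM (cvg_cst (a : K^o)) ul).
Qed.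

Lemma cvg_polarization (K : numFieldType) (a b : K) (p q r s : nat -> K) (p' q' r' s' : K) :
  (p : nat -> K^o) @ \oo --> (p' : K^o) -> (q : nat -> K^o) @ \oo --> (q' : K^o) ->
  (r : nat -> K^o) @ \oo --> (r' : K^o) -> (s : nat -> K^o) @ \oo --> (s' : K^o) ->
  (fun n => a * (p n - q n + b * (r n - s n)) : K^o) @ \oo -->
    (a * (p' - q' + b * (r' - s')) : K^o).
Proof.
move=> hp hq hr hs; apply: (cvgM (cvg_cst (a : K^o))).
apply: cvgD; first exact: cvgB.
by apply: (cvgM (cvg_cst (b : K^o))); exact: cvgB.
Qed.

Lemma normc_le_sqrt (R : realType) (z : R[i]) (s : R) : 0 <= s ->
  (`|z| ^+ 2 <= s%:C) = (`|z| <= (Num.sqrt s)%:C).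
Proof.
move=> s0; rewrite -(@ler_pXn2r _ 2 _ (`|z|))// ?nnegrE ?ler0c ?sqrtr_ge0//.
suff -> : (Num.sqrt s)%:C ^+ 2 = s%:C by [].
by rewrite -rmorphXn /= sqr_sqrtr.
Qed.

(** * Bounded operators: adjoints, quadratic forms and weak limits *)

Section Operators.
Variable R : realType.
Local Notation C := R[i].
Implicit Types H K : hilbertType C.

HB.instance Definition _ H K (A : 'B(H, K)) :=
  GRing.isLinear.Build C H K *:%R (bop_fun A) (bopP A).1.

Lemma bopDE H K (A B : 'B(H, K)) x : (A + B) x = A x + B x. Proof. by []. Qed.
Lemma bopNE H K (A : 'B(H, K)) x : (- A) x = - A x. Proof. by []. Qed.
Lemma bopZE H K (A : 'B(H, K)) a x : (a *: A) x = a *: A x. Proof. by []. Qed.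
Lemma bop0E H K x : (0 : 'B(H, K)) x = 0. Proof. by []. Qed.
Lemma bopME H (A B : 'B(H)) x : (A * B) x = A (B x). Proof. by []. Qed.
Lemma bop1E H x : (1 : 'B(H)) x = x. Proof. by []. Qed.
Lemma bop_sumE H K (I : Type) (r : seq I) (P : pred I) (F : I -> 'B(H, K)) x :
  (\sum_(i <- r | P i) F i) x = \sum_(i <- r | P i) F i x.
Proof. by elim/big_ind2 : _ => [//|A u B v <- <-|//]; rewrite bopDE. Qed.
Definition bopE := (bop_sumE, bopDE, bopNE, bopZE, bop0E, bopME, bop1E).

Lemma bop_ext H K (A B : 'B(H, K)) : (forall x, A x = B x) -> A = B.
Proof. by move=> h; apply/val_inj/funext. Qed.

Lemma bopD H K (A : 'B(H, K)) x y : A (x + y) = A x + A y.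
Proof. exact: linearD. Qed.
Lemma bopZ H K (A : 'B(H, K)) a x : A (a *: x) = a *: A x.
Proof. exact: linearZ. Qed.
Lemma bop0 H K (A : 'B(H, K)) : A 0 = 0.
Proof. exact: linear0. Qed.
Lemma bop_sum H K (A : 'B(H, K)) (I : Type) (r : seq I) (P : pred I) (F : I -> H) :
  A (\sum_(i <- r | P i) F i) = \sum_(i <- r | P i) A (F i).
Proof. exact: linear_sum. Qed.

Lemma innerDl H (x y z : H) : '[x + y, z] = '[x, z] + '[y, z].
Proof. exact: psdDl (inner_psd H) x y z. Qed.
Lemma innerDr H (x y z : H) : '[z, x + y] = '[z, x] + '[z, y].
Proof. exact: psdDr (inner_psd H) x y z. Qed.
Lemma innerBl H (x y z : H) : '[x - y, z] = '[x, z] - '[y, z].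
Proof. exact: psdBl (inner_psd H) x y z. Qed.
Lemma innerZl H a (x z : H) : '[a *: x, z] = a * '[x, z].
Proof. exact: psdZl (inner_psd H) a x z. Qed.
Lemma innerZr H a (x z : H) : '[z, a *: x] = a^*%R * '[z, x].
Proof. exact: psdZr (inner_psd H) a x z. Qed.
Lemma inner0l H (z : H) : '[0, z] = 0.
Proof. exact: psd0l (inner_psd H) z. Qed.
Lemma inner0r H (z : H) : '[z, 0] = 0.
Proof. exact: psd0r (inner_psd H) z. Qed.
Lemma innerC H (x y : H) : '[y, x] = '[x, y]^*%R.
Proof. exact: psd_herm (inner_psd H) x y. Qed.
Lemma inner_suml H (I : Type) (r : seq I) (P : pred I) (F : I -> H) z :
  '[\sum_(i <- r | P i) F i, z] = \sum_(i <- r | P i) '[F i, z].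
Proof.
by elim/big_ind2 : _ => [|u a v b <- <-|//]; rewrite ?inner0l ?innerDl.
Qed.
Lemma inner_sumr H (I : Type) (r : seq I) (P : pred I) (F : I -> H) z :
  '[z, \sum_(i <- r | P i) F i] = \sum_(i <- r | P i) '[z, F i].
Proof.
by elim/big_ind2 : _ => [|u a v b <- <-|//]; rewrite ?inner0r ?innerDr.
Qed.

Lemma bop_bound H K (A : 'B(H, K)) :
  exists c : R, [/\ 0 < c, forall x, `|A x| <= c%:C * `|x| &
    forall x, n2 (A x) <= c ^+ 2 * n2 x].
Proof.
have [_ [c0 hc]] := bopP A.
(* On the zero space the constant supplied by [bopP] may be any complex number; a nonzero vector
   forces it to be real and nonnegative. *)
have [x0|/existsNP[x0 /eqP x0N]] := pselect (forall x : H, x = 0).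
  exists 1; split=> [//|x|x].
    by rewrite (x0 x) linear0 normr0 mulr_ge0.
  by rewrite (x0 x) linear0 expr1n mul1r /n2 /fsq !inner0l.
have nx : 0 < `|x0| by rewrite normr_gt0.
have c00 : 0 <= c0.
  by rewrite -(pmulr_lge0 _ nx); apply: le_trans (hc x0).
have ce := ge0_Re c00; set c := complex.Re c0 in ce.
have cp : 0 <= c by rewrite -ler0c -ce.
have hA x : `|A x| <= (c + 1)%:C * `|x|.
  apply: le_trans (hc x) _; rewrite ce ler_wpM2r// lecR lerDl//.
exists (c + 1); split => // [|x]; first by rewrite ltr_wpDl.
rewrite -lecR rmorphM rmorphXn /= -!norm_n2 -exprMn lerXn2r ?nnegrE//.
by rewrite mulr_ge0// ler0c addr_ge0.
Qed.

Lemma form_bop H K (b : H -> K -> C) (c : R) : 0 <= c ->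
  (forall a x y z, b (a *: x + y) z = a * b x z + b y z) ->
  (forall a x y z, b z (a *: x + y) = a^*%R * b z x + b z y) ->
  (forall x y, `|b x y| ^+ 2 <= (c * n2 x * n2 y)%:C) ->
  exists A : 'B(H, K), forall x y, '[A x, y] = b x y.
Proof.
move=> c0 bl br bb.
have /choice[A hA] : forall x, exists y, forall z, b x z = '[y, z].
  move=> x.
  (* [b x] is antilinear, so the representation theorem is applied to its conjugate. *)
  have [|||y hy] := @riesz_repr R K (fun z => (b x z)^*%R) (c * n2 x).
  - by rewrite mulr_ge0// n2_ge0.
  - by move=> a u v; rewrite br rmorphD rmorphM /= conjCK.
  - by move=> u; rewrite norm_conjC; exact: bb.
  by exists y => z; rewrite innerC -hy conjCK.
have lA : linear A.
  by move=> a x y; apply: inner_ext => z; rewrite innerDl innerZl -!hA bl.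
have bA : (A : H -> K) \in @bounded_linear_pred C H K.
  apply/asboolP; split=> //; exists (Num.sqrt c)%:C => x.
  rewrite -(@ler_pXn2r _ 2)// ?nnegrE ?mulr_ge0 ?ler0c ?sqrtr_ge0//.
  rewrite exprMn -rmorphXn sqr_sqrtr// !norm_n2 -(rmorphM (real_complex R)) lecR.
  have := bb x (A x).
  rewrite hA innerE ger0_norm ?ler0c ?n2_ge0// -rmorphXn lecR expr2.
  have [->|] := eqVneq (n2 (A x)) 0; first by rewrite mulr_ge0// n2_ge0.
  move=> nz; rewrite ler_pM2r//; by rewrite lt0r nz n2_ge0.
by exists (Bop bA) => x y; rewrite hA.
Qed.

(** [adjoint] is a choice with default 0, so its defining property rests on existence, which
    [form_bop] provides for the form [<y, A x>]. *)
Lemma adjointP H K (A : 'B(H, K)) x y : '[A x, y] = '[x, A^adj y].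
Proof.
have [c [c0 _ hc]] := bop_bound A.
have [||||B hB] := @form_bop K H (fun y x => '[y, A x]) (c ^+ 2).
- by rewrite sqr_ge0.
- by move=> a u v z; rewrite innerDl innerZl.
- by move=> a u v z; rewrite linearP innerDr innerZr.
- move=> u v; apply: le_trans (psd_CS (inner_psd K) _ _) _.
  rewrite lecR [leLHS]mulrC [leRHS]mulrAC; apply: ler_wpM2r; last exact: hc.
  exact: n2_ge0.
have : [set B : 'B(K, H) | forall x y, '[A x, y] = '[x, B y]] B.
  by move=> u v /=; rewrite innerC -hB -innerC.
move=> hS; have := @xgetPex _ 0 [set B : 'B(K, H) | forall x y, '[A x, y] = '[x, B y]]
  (ex_intro _ _ hS).
exact.
Qed.

Lemma adjointPr H K (A : 'B(H, K)) x y : '[A^adj y, x] = '[y, A x].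
Proof. by rewrite innerC -adjointP -innerC. Qed.

Lemma bop_sesqui_l H K (A : 'B(H, K)) a x y z :
  '[A (a *: x + y), z] = a * '[A x, z] + '[A y, z].
Proof. by rewrite linearP innerDl innerZl. Qed.
Lemma bop_sesqui_r H K (A : 'B(H, K)) a x y z :
  '[A z, a *: x + y] = a^*%R * '[A z, x] + '[A z, y].
Proof. by rewrite innerDr innerZr. Qed.

Definition bop_polarization H (A : 'B(H)) :=
  polarization (bop_sesqui_l A) (bop_sesqui_r A).

Lemma bop_qform_ext H (A B : 'B(H)) : (forall h, '[A h, h] = '[B h, h]) -> A = B.
Proof.
move=> h; apply: bop_ext => x; apply: inner_ext => z.
by rewrite (bop_polarization A) (bop_polarization B) !h.
Qed.

(** Over the complex numbers real diagonal values force hermitian symmetry: the vanishing imaginary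
    parts at [h + k] and at [h + i k] give the two components of the identity. *)
Lemma ge0_psd H (A : 'B(H)) : bop_ge0 A -> psd_form (fun x y => '[A x, y]).
Proof.
move=> A0; split=> [a x y z|h k|x]; [exact: bop_sesqui_l| |exact: A0].
have im0 x : complex.Im '[A x, x] = 0 by exact/ger0_Im/A0.
have e1 := im0 (h + k); have e2 := im0 (h + 'i%C *: k).
rewrite bopD !innerDl !innerDr !ImD !im0 addr0 add0r in e1.
rewrite bopD bopZ !innerDl !innerDr !innerZl !innerZr !(ImD, ReM, ImM, Re_conj, Im_conj) !im0 /= in e2.
by apply: cplxP; rewrite ?Re_conj ?Im_conj; lra.
Qed.

(** Polarization turns convergence on the diagonal into convergence of all [<B n h, k>]. The limit
    is sesquilinear, and it is bounded because the Cauchy-Schwarz inequality for each [B n >= 0]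
    holds with the same [c]. This produces the operators for half-lines and for countable disjoint
    unions. *)
Lemma weak_limit H (B : nat -> 'B(H)) (c : R) : 0 <= c ->
  (forall n h, 0 <= '[B n h, h] /\ complex.Re '[B n h, h] <= c * n2 h) ->
  (forall h, cvgn (fun n => '[B n h, h] : C^o)) ->
  exists A : 'B(H), forall h, (fun n => '[B n h, h] : C^o) @ \oo --> ('[A h, h] : C^o).
Proof.
move=> c0 bB cB.
have /choice [b hb] : forall hk : H * H, exists l : C,
    (fun n => '[B n hk.1, hk.2] : C^o) @ \oo --> (l : C^o).
  move=> [h k] /=.
  have /choice [q hq] : forall h, exists l : C,
      (fun n => '[B n h, h] : C^o) @ \oo --> (l : C^o).
    by move=> x; have /cvg_ex := cB x.
  rewrite (funext (fun n => bop_polarization (B n) h k)).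
  exists (4^-1 * (q (h + k) - q (h - k) +
    'i * (q (h + 'i *: k) - q (h - 'i *: k)))).
  have := @cvg_polarization C 4^-1 'i _ _ _ _ _ _ _ _ (hq (h + k)) (hq (h - k))
    (hq (h + 'i *: k)) (hq (h - 'i *: k)).
  apply.
have uniq (u : nat -> C) (l l' : C) : (u : nat -> C^o) @ \oo --> (l : C^o) ->
    (u : nat -> C^o) @ \oo --> (l' : C^o) -> l = l'.
  by move=> ul ul'; exact: (@cvg_unique C^o (@norm_hausdorff _ C^o) _ _ _ _ ul ul').
have [||||A hA] := @form_bop H H (fun h k => b (h, k)) (c ^+ 2).
- by rewrite sqr_ge0.
- move=> a x y z; apply: (uniq _ _ _ (hb (_, _))) => /=.
  rewrite (funext (fun n => bop_sesqui_l (B n) a x y z)).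
  have := @cvg_axpy C a _ _ _ _ (hb (x, z)) (hb (y, z)); apply.
- move=> a x y z; apply: (uniq _ _ _ (hb (_, _))) => /=.
  rewrite (funext (fun n => bop_sesqui_r (B n) a x y z)).
  have := @cvg_axpy C a^*%R _ _ _ _ (hb (z, x)) (hb (z, y)); apply.
- move=> h k.
  have bd n : `|'[B n h, k]| ^+ 2 <= (c ^+ 2 * n2 h * n2 k)%:C.
    have B0 : bop_ge0 (B n) by move=> x; exact: (bB n x).1.
    apply: le_trans (psd_CS (ge0_psd B0) h k) _; rewrite lecR.
    have -> : c ^+ 2 * n2 h * n2 k = (c * n2 h) * (c * n2 k) by ring.
    have [p1 q1] := bB n h; have [p2 q2] := bB n k.
    by apply: ler_pM => //; exact: (fsq_ge0 (ge0_psd B0)).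
  have r0 : 0 <= c ^+ 2 * n2 h * n2 k.
    by rewrite !mulr_ge0 ?sqr_ge0 ?n2_ge0.
  rewrite normc_le_sqrt//.
  have bd' n : `|'[B n h, k]| <= (Num.sqrt (c ^+ 2 * n2 h * n2 k))%:C.
    by rewrite -normc_le_sqrt.
  rewrite (ge0_Re (normr_ge0 _)) lecR.
  apply: (cvgr_to_le (cvg_Re (cvg_norm (hb (h, k))))); apply: nearW => n.
  by rewrite -lecR -(ge0_Re (normr_ge0 _)) /= bd'.
by exists A => h; rewrite hA; exact: (hb (_, _)).
Qed.
End Operators.

Lemma sqrtr_le_add (R : rcfType) (a b c r : R) : 0 <= a -> 0 <= b ->
  c = a + b + 2 * r -> r <= Num.sqrt a * Num.sqrt b ->
  Num.sqrt c <= Num.sqrt a + Num.sqrt b.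
Proof.
move=> a0 b0 -> h; rewrite -[leRHS]ger0_norm ?addr_ge0 ?sqrtr_ge0//.
rewrite -sqrtr_sqr ler_wsqrtr// sqrrD !sqr_sqrtr//.
rewrite -mulr_natl; move: (Num.sqrt a * Num.sqrt b) h => s; lra.
Qed.

Section ComplexLimits.
Variable R : realType.
Local Notation C := R[i].

Lemma normc_le_ReIm (z : C) :
  `|z| <= (`|complex.Re z| + `|complex.Im z|)%:C.
Proof.
case: z => x y /=.
have -> : x +i* y = x%:C + 'i%C * y%:C by simpc.
apply: le_trans (ler_normD _ _) _; rewrite rmorphD normrM.
rewrite !normc_def /= !expr0n /= !addr0 !add0r expr1n sqrtr1 mul1r.
by rewrite !sqrtr_sqr.
Qed.

Lemma Re_le_norm (z : C) (M : R) : `|z| <= M%:C -> complex.Re z <= M.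
Proof.
move=> h; rewrite -lecR; apply: le_trans h; apply: le_trans (normc_ge_Re z).
by rewrite lecR ler_norm.
Qed.

Lemma cvg_ReIm (u : nat -> C) (l : C) :
  (fun n => complex.Re (u n)) @ \oo --> complex.Re l ->
  (fun n => complex.Im (u n)) @ \oo --> complex.Im l ->
  (u : nat -> C^o) @ \oo --> (l : C^o).
Proof.
move=> /cvgrPdist_lt hr /cvgrPdist_lt hi; apply/cvgrPdist_lt => e e0.
rewrite (ge0_Re (ltW e0)).
have {}e0 : 0 < complex.Re e by rewrite -ltcR -(ge0_Re (ltW e0)).
have e2 : 0 < complex.Re e / 2 by rewrite divr_gt0.
near=> n.
apply: le_lt_trans (normc_le_ReIm _) _; rewrite ltcR !raddfB /=.
have h1 : `|complex.Re l - complex.Re (u n)| < complex.Re e / 2.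
  by near: n; exact: hr.
have h2 : `|complex.Im l - complex.Im (u n)| < complex.Re e / 2.
  by near: n; exact: hi.
lra.
Unshelve. all: by end_near. Qed.

Lemma cvg_Im (u : nat -> C) (l : C) : (u : nat -> C^o) @ \oo --> (l : C^o) ->
  (fun n => complex.Im (u n)) @ \oo --> complex.Im l.
Proof.
move=> /(@cvg_axpy C (- 'i%C) _ (fun=> 0) _ 0) /(_ (cvg_cst _)) /cvg_Re.
have E z : complex.Re (- 'i%C * z + 0) = complex.Im z.
  by case: z => x y; rewrite -[LHS]/(- 0 * x - - 1 * y + 0) /=; ring.
by rewrite E; under eq_fun do rewrite E.
Qed.

Lemma cvg_conjC (u : nat -> C) (l : C) : (u : nat -> C^o) @ \oo --> (l : C^o) ->
  (fun n => (u n)^*%R : C^o) @ \oo --> (l^*%R : C^o).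
Proof.
move=> ul; apply: cvg_ReIm.
  by rewrite Re_conj; under eq_fun do rewrite Re_conj; exact: cvg_Re.
rewrite Im_conj; under eq_fun do rewrite Im_conj.
by apply: cvgN; exact: cvg_Im.
Qed.

Lemma cvgC_unique (u : nat -> C) (l l' : C) : (u : nat -> C^o) @ \oo --> (l : C^o) ->
  (u : nat -> C^o) @ \oo --> (l' : C^o) -> l = l'.
Proof. by move=> h h'; exact: (@cvg_unique C^o (@norm_hausdorff _ C^o) _ _ _ _ h h'). Qed.

Lemma cvgC_eps (u : nat -> C) (l : C) : (u : nat -> C^o) @ \oo --> (l : C^o) <->
  forall e : R, 0 < e -> exists N, forall n, (N <= n)%N -> `|l - u n| < e%:C.
Proof.
split=> [/cvgrPdist_lt h e e0|h].
  have /h [N _ hN] : 0 < e%:C by rewrite ltcR.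
  by exists N => n Nn; exact: hN n Nn.
apply/cvgrPdist_lt => e e0; rewrite (ge0_Re (ltW e0)).
have {}e0 : 0 < complex.Re e by rewrite -ltcR -(ge0_Re (ltW e0)).
by have [N hN] := h _ e0; exists N.
Qed.

Lemma cauchyC_cvg (u : nat -> C) :
  (forall e : R, 0 < e -> exists N, forall m n, (N <= m)%N -> (N <= n)%N ->
    `|u m - u n| < e%:C) ->
  exists l : C, (u : nat -> C^o) @ \oo --> (l : C^o).
Proof.
move=> h.
have aux (g : C -> R) : (forall x y, g (x - y) = g x - g y) ->
    (forall z, `|g z|%:C <= `|z|) -> exists l : R, (g \o u) @ \oo --> l.
  move=> gB gn; suff /cvg_ex[l ul] : cvgn (g \o u) by exists l.
  apply/cauchy_cvgP/cauchy_exP => e e0; have [N hN] := h e e0.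
  exists (g (u N)); exists N => // n Nn; rewrite -ball_normE /ball_ /=.
  by rewrite -gB -ltcR (le_lt_trans (gn _))// hN.
have [|z|a ha] := aux (@complex.Re R).
- exact: raddfB.
- exact: normc_ge_Re.
have [|z|b hb] := aux (@complex.Im R).
- exact: raddfB.
- case: z => x y /=.
  by rewrite normc_def lecR /= -[leLHS]sqrtr_sqr ler_wsqrtr// lerDr sqr_ge0.
by exists (a +i* b); apply: cvg_ReIm.
Qed.

End ComplexLimits.

(** * Completion of a pre-Hilbert space *)

Section Completion.
Variable R : realType.
Local Notation C := R[i].

Record preHilbert := PreHilbert {
  ph_sort : lmodType C;
  ph_form : ph_sort -> ph_sort -> C;
  ph_formP : psd_form ph_form }.

Variable P : preHilbert.
Local Notation V := (ph_sort P).
Local Notation B := (@ph_form P).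
Let hB : psd_form B := @ph_formP P.

Definition ph_cauchy (v : nat -> V) := forall e : R, 0 < e ->
  exists N, forall m n, (N <= m)%N -> (N <= n)%N -> fsq B (v m - v n) < e.

Definition ph_rep (f : V -> C) (v : nat -> V) := ph_cauchy v /\
  forall w, (fun n => B (v n) w : C^o) @ \oo --> (f w : C^o).

Lemma ph_form_small (M e : R) : 0 < M -> 0 < e -> exists2 d : R, 0 < d &
  forall x y, fsq B x < d -> fsq B y <= M ^+ 2 ->
    `|B x y| < e%:C /\ `|B y x| < e%:C.
Proof.
move=> M0 e0; exists ((e / (2 * M)) ^+ 2); first by rewrite exprn_gt0 ?divr_gt0 ?mulr_gt0.
move=> x y hx hy; have d0 : 0 <= e / (2 * M) by rewrite divr_ge0 ?mulr_ge0 ?ltW.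
have -> : `|B y x| = `|B x y| by rewrite (psd_herm hB) norm_conjC.
suff : `|B x y| < e%:C by [].
apply: le_lt_trans (psd_CS_le hB d0 (ltW M0) (ltW hx) hy) _.
rewrite ltcR; have -> : e / (2 * M) * M = e / 2 by field; rewrite gt_eqF.
lra.
Qed.

Lemma ph_cauchy_bounded v : ph_cauchy v -> exists2 M : R, 0 < M &
  exists N, forall n, (N <= n)%N -> fsq B (v n) <= M ^+ 2.
Proof.
move=> /(_ 1 ltr01)[N hN]; exists (2 * fsq B (v N) + 2).
  by rewrite ltr_wpDl// mulr_ge0// fsq_ge0.
exists N => n Nn; have := fsqDle hB (v n - v N) (v N); rewrite subrK.
have := hN n N Nn (leqnn _); have := fsq_ge0 hB (v N) => a b c.
apply: le_trans (_ : 2 * fsq B (v N) + 2 <= _); first lra.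
by rewrite expr2 ler_peMr; lra.
Qed.

(** A Cauchy sequence that tends weakly to 0 tends to 0 in seminorm: expand [fsq (v n - v N)], whose
    cross term tends to 0 with [N] fixed. *)
Lemma ph_rep0 v : ph_rep (fun=> 0) v -> (fun n => fsq B (v n)) @ \oo --> (0 : R).
Proof.
move=> [cv lv]; apply/cvgrPdist_lt => e e0.
have [|N hN] := cv (e / 2); first by rewrite divr_gt0.
have [|N' hN'] := (@cvgC_eps R _ _).1 (lv (v N)) (e / 4); first by rewrite divr_gt0.
exists (maxn N N') => // n /=; rewrite geq_max => /andP[Nn Nn'].
rewrite sub0r normrN ger0_norm; last exact: fsq_ge0.
have := hN n N Nn (leqnn _); have := hN' n Nn'.
rewrite sub0r normrN fsqB// => h1 h2.
have := le_lt_trans (normc_ge_Re _) h1; rewrite ltcR ltr_norml => /andP[_ h3].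
have := fsq_ge0 hB (v N); lra.
Qed.

Lemma ph_repP (a : C) f g v w : ph_rep f v -> ph_rep g w ->
  ph_rep (fun x => a * f x + g x) (fun n => a *: v n + w n).
Proof.
move=> [cv lv] [cw lw]; split.
  move=> e e0; set A := complex.Re (`|a| ^+ 2).
  have hA : `|a| ^+ 2 = A%:C by rewrite /A -ge0_Re// exprn_ge0.
  have A0 : 0 <= A by rewrite -ler0c -hA exprn_ge0.
  have [|N hN] := cv (e / (4 * (A + 1))).
    by rewrite divr_gt0 ?mulr_gt0// ltr_wpDl.
  have [|N' hN'] := cw (e / 4); first by rewrite divr_gt0.
  exists (maxn N N') => m n; rewrite !geq_max => /andP[Nm Nm'] /andP[Nn Nn'].
  have h1 := hN m n Nm Nn; have h2 := hN' m n Nm' Nn'.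
  rewrite opprD addrACA -scalerBr.
  apply: le_lt_trans (fsqDle hB _ _) _.
  have -> : fsq B (a *: (v m - v n)) = A * fsq B (v m - v n).
    by apply: complexI; rewrite (fsqZ hB) hA rmorphM.
  have : A * fsq B (v m - v n) <= e / 4.
    apply: le_trans (_ : (A + 1) * (e / (4 * (A + 1))) <= _).
      by apply: ler_pM; rewrite ?fsq_ge0 ?lerDl// ltW.
    by rewrite le_eqVlt; apply/orP; left; apply/eqP; field; rewrite gt_eqF// ltr_wpDl.
  lra.
move=> x; under eq_fun do rewrite (psd_lin hB).
by have := @cvg_axpy C a _ _ _ _ (lv x) (lw x); apply.
Qed.

(* A point [x] of the completion is encoded as the functional [<x, ->] on [V],
   i.e. a pointwise limit of [B (v n)] for some Cauchy sequence [v]; vectors of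
   seminorm 0 are thereby identified with 0. *)
Definition compl_pred : {pred V -> C} := fun f => `[< exists v, ph_rep f v >].

Record completion := Completion {
  compl_fun :> V -> C;
  compl_subproof : compl_fun \in compl_pred }.

HB.instance Definition _ := [isSub for compl_fun].
HB.instance Definition _ := [Choice of completion by <:].

Lemma compl_submod_closed : submod_closed compl_pred.
Proof.
split=> [|a f g /asboolP[v hv] /asboolP[w hw]]; apply/asboolP.
  exists (fun=> 0); split=> [e e0|w].
    by exists 0%N => m n _ _; rewrite subrr /fsq (psd0l hB).
  by under eq_fun do rewrite (psd0l hB); exact: cvg_cst.
by exists (fun n => a *: v n + w n); exact: ph_repP.
Qed.

HB.instance Definition _ :=
  GRing.isSubmodClosed.Build C (V -> C) compl_pred compl_submod_closed.
HB.instance Definition _ := [SubChoice_isSubLmodule of completion by <:].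

Implicit Types f g : completion.

Lemma compl_rep f : exists v, ph_rep f v.
Proof. exact/asboolP/compl_subproof. Qed.

Lemma compl_ext f g : f =1 g -> f = g.
Proof. by move=> h; apply/val_inj/funext. Qed.

Lemma complE a f g : (a *: f + g : V -> C) = (fun x => a * f x + g x).
Proof. by []. Qed.

Lemma ph_form_cvg v w : ph_cauchy v -> ph_cauchy w ->
  exists l : C, (fun n => B (v n) (w n) : C^o) @ \oo --> (l : C^o).
Proof.
move=> cv cw; apply: cauchyC_cvg => e e0.
have [M M0 [N1 b1]] := ph_cauchy_bounded cv.
have [M' M0' [N2 b2]] := ph_cauchy_bounded cw.
have e2 : 0 < e / 2 by rewrite divr_gt0.
have [d d0 hd] := ph_form_small M0' e2.
have [d' d0' hd'] := ph_form_small M0 e2.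
have [N3 c3] := cv d d0; have [N4 c4] := cw d' d0'.
exists (maxn (maxn N1 N2) (maxn N3 N4)) => m n.
rewrite !geq_max => /andP[/andP[m1 m2] /andP[m3 m4]] /andP[/andP[n1 n2] /andP[n3 n4]].
have -> : B (v m) (w m) - B (v n) (w n) = B (v m - v n) (w m) + B (v n) (w m - w n).
  by rewrite (psdBl hB) (psdBr hB) addrA subrK.
apply: le_lt_trans (ler_normD _ _) _.
have -> : e%:C = (e / 2)%:C + (e / 2)%:C by rewrite -rmorphD -splitr.
apply: ltrD; first by have [] := hd _ _ (c3 m n m3 n3) (b2 _ m2).
by have [] := hd' _ _ (c4 m n m4 n4) (b1 _ n1).
Qed.

Lemma ph_rep_sub f v v' : ph_rep f v -> ph_rep f v' ->
  (fun n => fsq B (v n - v' n)) @ \oo --> (0 : R).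
Proof.
move=> hv hv'; have := ph_repP (-1) hv' hv.
under eq_fun do rewrite mulN1r addNr.
move=> /ph_rep0; under eq_fun do rewrite scaleN1r addrC.
by [].
Qed.

(** The limit is the same for all representing sequences, since two representatives of one
    functional differ by a sequence of vanishing seminorm ([ph_rep_sub]). This makes the inner
    product well defined. *)
Lemma cinner_ex f g : exists l : C, forall v w, ph_rep f v -> ph_rep g w ->
  (fun n => B (v n) (w n) : C^o) @ \oo --> (l : C^o).
Proof.
have [v0 h0] := compl_rep f; have [w0 k0] := compl_rep g.
have [l hl] := ph_form_cvg h0.1 k0.1; exists l => v w hv hw.
apply/cvgC_eps => e e0.
have e3 : 0 < e / 3 by rewrite divr_gt0.
have [M M0 [N1 b1]] := ph_cauchy_bounded hv.1.
have [M' M0' [N2 b2]] := ph_cauchy_bounded k0.1.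
have [d d0 hd] := ph_form_small M0' e3.
have [d' d0' hd'] := ph_form_small M0 e3.
have /cvgrPdist_lt/(_ d d0)[N3 _ c3] := ph_rep_sub h0 hv.
have /cvgrPdist_lt/(_ d' d0')[N4 _ c4] := ph_rep_sub k0 hw.
have [N5 c5] := (@cvgC_eps R _ _).1 hl _ e3.
exists (maxn (maxn N1 N2) (maxn (maxn N3 N4) N5)) => n.
rewrite !geq_max => /andP[/andP[n1 n2] /andP[/andP[n3 n4] n5]].
have -> : l - B (v n) (w n) = (l - B (v0 n) (w0 n)) +
    (B (v0 n - v n) (w0 n) + B (v n) (w0 n - w n)).
  by rewrite (psdBl hB) (psdBr hB); ring.
have {}c3 : fsq B (v0 n - v n) < d.
  by apply: le_lt_trans (c3 n n3); rewrite sub0r normrN ler_norm.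
have {}c4 : fsq B (w0 n - w n) < d'.
  by apply: le_lt_trans (c4 n n4); rewrite sub0r normrN ler_norm.
apply: le_lt_trans (ler_normD _ _) _.
have -> : e%:C = (e / 3)%:C + ((e / 3)%:C + (e / 3)%:C).
  by rewrite -!rmorphD /=; congr (_%:C); field.
apply: ltrD; first exact: c5.
apply: le_lt_trans (ler_normD _ _) _; apply: ltrD.
  by have [] := hd _ _ c3 (b2 _ n2).
by have [] := hd' _ _ c4 (b1 _ n1).
Qed.

Definition cinner f g : C := projT1 (cid (cinner_ex f g)).

Lemma cinner_cvg f g v w : ph_rep f v -> ph_rep g w ->
  (fun n => B (v n) (w n) : C^o) @ \oo --> (cinner f g : C^o).
Proof. exact: (projT2 (cid (cinner_ex f g))). Qed.

Opaque cinner.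

Lemma cinner_psd : psd_form cinner.
Proof.
split=> [a f g h|f g|f].
- have [v hv] := compl_rep f; have [w hw] := compl_rep g; have [u hu] := compl_rep h.
  have hvw : ph_rep (a *: f + g) (fun n => a *: v n + w n) by rewrite complE; exact: ph_repP.
  apply: cvgC_unique (cinner_cvg hvw hu) _.
  under eq_fun do rewrite (psd_lin hB).
  have := @cvg_axpy C a _ _ _ _ (cinner_cvg hv hu) (cinner_cvg hw hu).
  by apply.
- have [v hv] := compl_rep f; have [w hw] := compl_rep g.
  apply: cvgC_unique (cinner_cvg hw hv) _.
  under eq_fun do rewrite (psd_herm hB).
  exact/cvg_conjC/cinner_cvg.
- have [v hv] := compl_rep f; have cf := cinner_cvg hv hv.
  rewrite lecE; apply/andP; split.
    apply/eqP; have := cvg_Im cf; under eq_fun do rewrite (psdE hB) /=.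
    by move=> /(@cvg_unique _ (@Rhausdorff R) _ _ _ 0); apply; exact: cvg_cst.
  apply: (cvgr_to_ge (cvg_Re cf)); apply: nearW => n.
  exact: fsq_ge0.
Qed.

(** Definiteness comes from the encoding: [f w] is the limit of [B (v n) w], which Cauchy-Schwarz
    bounds by the vanishing seminorms of [v n]. *)
Lemma cinner_eq0 f : fsq cinner f = 0 -> f = 0.
Proof.
move=> f0; have [v hv] := compl_rep f.
apply: compl_ext => w; have -> : (0 : completion) w = 0 by [].
apply: cvgC_unique (hv.2 w) _; apply/cvgC_eps => e e0.
have M0 : 0 < fsq B w + 1 by rewrite ltr_wpDl// fsq_ge0.
have [d d0 hd] := ph_form_small M0 e0.
have /cvgrPdist_lt/(_ d d0)[N _ hN] := cvg_Re (cinner_cvg hv hv).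
exists N => n /hN; rewrite -/(fsq cinner f) f0 !sub0r !normrN => h.
have hw : fsq B w <= (fsq B w + 1) ^+ 2 by have := fsq_ge0 hB w; nra.
by have [] := hd (v n) w (le_lt_trans (ler_norm _) h) hw.
Qed.

Definition cnorm f : C := (Num.sqrt (fsq cinner f))%:C.

Lemma cnorm_ler_normD f g : cnorm (f + g) <= cnorm f + cnorm g.
Proof.
have f0 := fsq_ge0 cinner_psd f; have g0 := fsq_ge0 cinner_psd g.
rewrite /cnorm -rmorphD lecR.
apply: (sqrtr_le_add f0 g0 (fsqD cinner_psd f g)).
apply: Re_le_norm.
apply: (psd_CS_le cinner_psd (sqrtr_ge0 _) (sqrtr_ge0 _)).
  by rewrite (sqr_sqrtr f0); exact: lexx.
by rewrite (sqr_sqrtr g0); exact: lexx.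
Qed.

Lemma cnorm_normrZ (a : C) f : cnorm (a *: f) = `|a| * cnorm f.
Proof.
have f0 := fsq_ge0 cinner_psd f.
rewrite /cnorm -[`|a|]ger0_norm//; have := fsqZ cinner_psd a f.
move: f0 (fsq_ge0 cinner_psd (a *: f)); move: (fsq cinner f) (fsq cinner _) => x y x0 y0.
rewrite normr_id (ge0_Re (normr_ge0 a)); have : 0 <= complex.Re `|a|.
  by rewrite -ler0c -ge0_Re.
move: (complex.Re `|a|) => r r0; rewrite -rmorphXn -rmorphM => /(@complexI R) ->.
by rewrite sqrtrM ?sqr_ge0// sqrtr_sqr ger0_norm// rmorphM.
Qed.

Lemma cnorm_eq0 f : cnorm f = 0 -> f = 0.
Proof.
move=> /(@complexI R) /eqP; rewrite sqrtr_eq0 => h.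
by apply/cinner_eq0/eqP; rewrite eq_le h fsq_ge0//; exact: cinner_psd.
Qed.

HB.instance Definition _ :=
  Lmodule_isNormed.Build C completion cnorm_ler_normD cnorm_normrZ cnorm_eq0.

End Completion.

Section CompletionHilbert.
Variable R : realType.
Local Notation C := R[i].
Variable P : preHilbert R.
Local Notation V := (ph_sort P).
Local Notation B := (@ph_form _ P).
Local Notation K := (completion P).
Let hB : psd_form B := @ph_formP _ P.
Implicit Types f g : K.

Lemma cnormE f : `|f| = (Num.sqrt (fsq (@cinner _ P) f))%:C.
Proof. by []. Qed.

Lemma cnorm_lt f (e : R) : 0 < e -> fsq (@cinner _ P) f < e ^+ 2 -> `|f| < e%:C.
Proof.
move=> e0 h; rewrite cnormE ltcR -[e]gtr0_norm// -sqrtr_sqr ltr_sqrt//.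
by rewrite exprn_gt0.
Qed.

Lemma cnorm_lt_fsq f (e : R) : `|f| < e%:C -> fsq (@cinner _ P) f < e ^+ 2.
Proof.
rewrite cnormE ltcR => h; have f0 := fsq_ge0 (cinner_psd P) f.
rewrite -(sqr_sqrtr f0) ltr_pXn2r// ?nnegrE ?sqrtr_ge0//.
exact/ltW/(le_lt_trans _ h)/sqrtr_ge0.
Qed.

Lemma emb_repr u : ph_rep (B u) (fun=> u).
Proof.
split=> [e e0|w]; last exact: cvg_cst.
by exists 0%N => m n _ _; rewrite subrr /fsq (psd0l hB).
Qed.

Lemma emb_subproof u : B u \in @compl_pred R P.
Proof. by apply/asboolP; exists (fun=> u); exact: emb_repr. Qed.

Definition emb (u : V) : K := Completion (emb_subproof u).

Lemma emb_rep u : ph_rep (emb u) (fun=> u).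
Proof. exact: emb_repr. Qed.

Lemma cinner_emb u w : cinner (emb u) (emb w) = B u w.
Proof.
by apply: cvgC_unique (cinner_cvg (emb_rep u) (emb_rep w)) _; exact: cvg_cst.
Qed.

Lemma emb_linear : linear emb.
Proof. by move=> a u v; apply: compl_ext => w; rewrite complE /= (psd_lin hB). Qed.

Lemma embB u v : emb (u - v) = emb u - emb v.
Proof.
have := emb_linear (-1) v u; rewrite !scaleN1r ![- _ + _]addrC.
exact.
Qed.

Lemma fsq_emb u : fsq (@cinner _ P) (emb u) = fsq B u.
Proof. by rewrite /fsq cinner_emb. Qed.

Lemma emb_cvg f v : ph_rep f v -> forall e : R, 0 < e -> exists N,
  forall k, (N <= k)%N -> fsq (@cinner _ P) (f - emb (v k)) < e.
Proof.
move=> hv e e0; have e2 : 0 < e / 2 by rewrite divr_gt0.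
have [N hN] := hv.1 _ e2; exists N => k Nk.
have hr : ph_rep (f - emb (v k)) (fun n => v n - v k).
  have := ph_repP (-1) (emb_rep (v k)) hv; rewrite -complE.
  by rewrite scaleN1r addrC; under eq_fun do rewrite scaleN1r addrC.
apply: (@le_lt_trans _ _ (e / 2)); last lra.
apply: (cvgr_to_le (cvg_Re (cinner_cvg hr hr))).
by exists N => // n Nn; exact/ltW/hN.
Qed.

(** By density, the Cauchy filter contains a ball of radius [1 / (k + 1)] around some [emb (u k)]
    for every [k]. The sequence [u] is then Cauchy in [V] and itself represents the limit. *)
Lemma completion_complete (F : set_system K) : ProperFilter F -> cauchy F -> cvg F.
Proof.
move=> FF /cauchyP cF.
have /choice[u hu] : forall k : nat, exists u : V, F (ball (emb u) (k.+1%:R^-1 : R)%:C).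
  move=> k; set e : R := _^-1; have e0 : 0 < e by rewrite invr_gt0.
  have e2 : 0 < e / 2 by rewrite divr_gt0.
  have /cF[f hf] : 0 < (e / 2)%:C by rewrite ltcR.
  have [v hv] := compl_rep f.
  have e22 : 0 < (e / 2) ^+ 2 by rewrite exprn_gt0.
  have [N hN] := emb_cvg hv e22.
  exists (v N); apply: filterS hf => g.
  rewrite -!ball_normE /ball_ /= => fg.
  rewrite -(subrK f (emb (v N))) -addrA; apply: le_lt_trans (ler_normD _ _) _.
  rewrite [e]splitr rmorphD; apply: ltrD fg.
  by rewrite distrC; apply: cnorm_lt => //; exact: hN.
have invN (e : R) : 0 < e -> exists N, forall n, (N <= n)%N -> (n.+1%:R^-1 : R) < e.
  move=> e0; have ei : 0 < e^-1 by rewrite invr_gt0.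
  exists (Num.truncn e^-1) => n Nn; rewrite -[e]invrK ltf_pV2 ?posrE//.
  by apply: lt_le_trans (truncnS_gt _) _; rewrite ler_nat.
have cu : ph_cauchy u.
  move=> e e0; have s0 : 0 < Num.sqrt e by rewrite sqrtr_gt0.
  have [N hN] := invN (Num.sqrt e / 2) (divr_gt0 s0 (ltr0Sn _ 1)).
  exists N => m n Nm Nn.
  have [x []] := filter_ex (filterI (hu m) (hu n)).
  rewrite -!ball_normE /ball_ /= => hm hn.
  rewrite -fsq_emb embB -[e]sqr_sqrtr ?ltW//; apply: cnorm_lt_fsq.
  rewrite -(subrK x (emb (u m))) -addrA; apply: le_lt_trans (ler_normD _ _) _.
  rewrite [Num.sqrt e]splitr rmorphD; apply: ltrD.
    by apply: lt_trans hm _; rewrite ltcR hN.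
  by rewrite distrC; apply: lt_trans hn _; rewrite ltcR hN.
have /choice[f0 hf0] : forall w, exists l : C, (fun n => B (u n) w : C^o) @ \oo --> (l : C^o).
  by move=> w; exact: (ph_form_cvg cu (emb_repr w).1).
have f0P : f0 \in @compl_pred R P by apply/asboolP; exists u.
pose f : K := Completion f0P; have hf : ph_rep f u by split.
apply/cvg_ex; exists f; apply/fcvg_ballP => e e0; rewrite (ge0_Re (ltW e0)).
have {}e0 : 0 < complex.Re e by rewrite -ltcR -(ge0_Re (ltW e0)).
set r := complex.Re e in e0 *; have r2 : 0 < r / 2 by rewrite divr_gt0.
have [N hN] := emb_cvg hf (exprn_gt0 2 r2); have [N' hN'] := invN _ r2.
apply: filterS (hu (maxn N N')) => g; rewrite -!ball_normE /ball_ /= => hg.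
rewrite -(subrK (emb (u (maxn N N'))) f) -addrA; apply: le_lt_trans (ler_normD _ _) _.
rewrite [r]splitr rmorphD; apply: ltrD.
  by apply: cnorm_lt => //; apply: hN; rewrite leq_maxl.
by apply: lt_trans hg _; rewrite ltcR; apply: hN'; rewrite leq_maxr.
Qed.

HB.instance Definition _ := Uniform_isComplete.Build K completion_complete.

Lemma cinner_bilinear :
  bilinear_for *%R (Num.conj \; *%R) (@cinner _ P).
Proof.
split=> [u a x y|u a x y] /=; first exact: (psd_lin (cinner_psd P)).
by rewrite (psdDr (cinner_psd P)) (psdZr (cinner_psd P)).
Qed.

HB.instance Definition _ := bilinear_isBilinear.Build C K K C _ _
  (@cinner _ P) cinner_bilinear.

Lemma cinner_hermitian x y : @cinner _ P x y = (-1) ^+ false * (cinner y x)^*%R.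
Proof. by rewrite expr0 mul1r; exact: psd_herm (cinner_psd P) y x. Qed.

HB.instance Definition _ := isHermitianSesquilinear.Build C K false Num.conj
  (@cinner _ P) cinner_hermitian.

Lemma cinner_gt0 f : f != 0 -> 0 < cinner f f.
Proof.
move=> f0; rewrite lt_def (psd_ge0 (cinner_psd P)) andbT.
apply: contra f0 => /eqP h; apply/eqP/cinner_eq0.
by rewrite /fsq h.
Qed.

HB.instance Definition _ := isDotProduct.Build C K (@cinner _ P) cinner_gt0.

Lemma cinner_norm f : cinner f f = `|f| ^+ 2.
Proof.
rewrite cnormE -rmorphXn /= sqr_sqrtr ?(psdE (cinner_psd P))//.
exact: fsq_ge0 (cinner_psd P) f.
Qed.

HB.instance Definition _ := CompleteNormedModule_isHilbert.Build C K cinner_norm.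

End CompletionHilbert.

(** * Extension of a bounded positive symmetric map to the completion *)

Section Extension.
Variable R : realType.
Local Notation C := R[i].
Variable P : preHilbert R.
Local Notation V := (ph_sort P).
Local Notation B := (@ph_form _ P).
Local Notation K := (completion P : hilbertType C).
Let hB : psd_form B := @ph_formP _ P.

Lemma inner_compl (f g : K) : '[f, g] = cinner f g.
Proof. by []. Qed.

Variables (s : V -> V) (c : R).
Hypotheses (sym_s : forall v w, B (s v) w = B v (s w)).
Hypotheses (lin_s : forall a v w, s (a *: v + w) = a *: s v + s w).
Hypotheses (bnd_s : forall v, fsq B (s v) <= c ^+ 2 * fsq B v).
Hypotheses (pos_s : forall v, 0 <= complex.Re (B (s v) v)).

(** Symmetry gives [<s v, w> = <v, s w>], so on functionals the extension of [s] is precomposition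
    with [s]. *)
Lemma ext_rep (f : completion P) v : ph_rep f v -> ph_rep (f \o s) (s \o v).
Proof.
move=> [cv lv]; split=> [e e0|w]; last first.
  by rewrite /=; under eq_fun do rewrite sym_s; exact: lv.
have c0 : 0 < c ^+ 2 + 1 by rewrite ltr_wpDl// sqr_ge0.
have [N hN] := cv (e / (c ^+ 2 + 1)) (divr_gt0 e0 c0).
exists N => m n Nm Nn /=.
have -> : s (v m) - s (v n) = s (v m - v n).
  by rewrite addrC -scaleN1r -lin_s scaleN1r addrC.
apply: le_lt_trans (bnd_s _) _; have := hN m n Nm Nn.
rewrite ltr_pdivlMr//; apply: le_lt_trans.
rewrite mulrDr mulr1 mulrC lerDl; exact: fsq_ge0 hB _.
Qed.

Lemma ext_subproof (f : completion P) : compl_fun f \o s \in @compl_pred R P.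
Proof.
by have [v hv] := compl_rep f; apply/asboolP; exists (s \o v); exact: ext_rep.
Qed.

Definition ext_fun (f : completion P) : completion P := Completion (ext_subproof f).

Lemma ext_bounded : (ext_fun : K -> K) \in @bounded_linear_pred C K K.
Proof.
apply/asboolP; split.
  move=> a f g; apply: compl_ext => w.
  exact: etrans (congr1 (@^~ (s w)) (complE a f g))
    (esym (congr1 (@^~ w) (complE a (ext_fun f) (ext_fun g)))).
exists `|c|%:C => f; rewrite !cnormE -(rmorphM (real_complex R)) /= lecR.
have [v hv] := compl_rep f.
have h : fsq (@cinner _ P) (ext_fun f) <= c ^+ 2 * fsq (@cinner _ P) f.
  have hs : ph_rep (ext_fun f) (s \o v) by exact: ext_rep.
  have l1 := cvg_Re (cinner_cvg hs hs).
  have l2 : (fun n => c ^+ 2 * complex.Re (B (v n) (v n))) @ \oo -->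
      c ^+ 2 * complex.Re (cinner f f).
    by apply: cvgM; [exact: cvg_cst|exact: cvg_Re (cinner_cvg hv hv)].
  have l3 := cvgB l2 l1.
  suff : 0 <= c ^+ 2 * complex.Re (cinner f f)
      - complex.Re (cinner (ext_fun f) (ext_fun f)) by rewrite subr_ge0.
  apply: (cvgr_to_ge (l3 _)); apply: nearW => n /=.
  by rewrite subr_ge0; exact: bnd_s.
by rewrite -sqrtr_sqr -sqrtrM ?sqr_ge0// ler_wsqrtr.
Qed.

Definition ext_bop : 'B(K) := Bop ext_bounded.

Lemma ext_bop_emb u : ext_bop (emb u : K) = emb (s u) :> K.
Proof. by apply: compl_ext => w /=; rewrite sym_s. Qed.

Lemma ext_bop_ge0 : bop_ge0 ext_bop.
Proof.
move=> f; have [v hv] := compl_rep f.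
have hs : ph_rep (ext_fun f) (s \o v) by exact: ext_rep.
have hl := cinner_cvg hs hv; rewrite inner_compl lecE; apply/andP; split.
  apply/eqP; have := cvg_Im hl.
  have im0 n : complex.Im (B ((s \o v) n) (v n)) = 0.
    have := psd_herm hB (s (v n)) (v n); rewrite -sym_s => /(congr1 (@complex.Im R)).
    rewrite Im_conj /=; lra.
  under eq_fun do rewrite im0.
  by move=> /(@cvg_unique _ (@Rhausdorff R) _ _ _ 0); apply; exact: cvg_cst.
by apply: (cvgr_to_ge (cvg_Re hl)); apply: nearW => n; exact: pos_s.
Qed.

End Extension.

(** * Positive functionals on polynomials *)

Lemma cvg_sumr (K : numFieldType) (V : normedModType K) (I : Type) (r : seq I)
    (F : I -> nat -> V) (l : I -> V) : (forall i, F i @ \oo --> l i) ->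
  (fun N => \sum_(i <- r) F i N) @ \oo --> \sum_(i <- r) l i.
Proof.
move=> h; elim: r => [|i r IH].
  by rewrite big_nil; under eq_fun do rewrite big_nil; exact: cvg_cst.
by rewrite big_cons; under eq_fun do rewrite big_cons; exact: cvgD.
Qed.

Section PolyFunctional.
Variable R : realType.

Record pfun (L : {poly R} -> R) : Prop := PFun {
  pfun_lin : forall c p q, L (c *: p + q) = c * L p + L q }.

Variables (L : {poly R} -> R) (hL : pfun L).

Lemma pfun0 : L 0 = 0.
Proof.
have := pfun_lin hL 1 0 0; rewrite scaler0 addr0 mul1r => /eqP.
by rewrite addrC -subr_eq subrr eq_sym => /eqP.
Qed.
Lemma pfunZ c p : L (c *: p) = c * L p.
Proof. by rewrite -[c *: p]addr0 (pfun_lin hL) pfun0 addr0. Qed.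
Lemma pfunD p q : L (p + q) = L p + L q.
Proof. by rewrite -[p]scale1r (pfun_lin hL) mul1r scale1r. Qed.
Lemma pfunN p : L (- p) = - L p.
Proof. by rewrite -scaleN1r pfunZ mulN1r. Qed.
Lemma pfunB p q : L (p - q) = L p - L q.
Proof. by rewrite pfunD pfunN. Qed.
Lemma pfun_sum (I : Type) (r : seq I) (P : pred I) (F : I -> {poly R}) :
  L (\sum_(i <- r | P i) F i) = \sum_(i <- r | P i) L (F i).
Proof.
by elim/big_ind2 : _ => [|p u q v <- <-|//]; rewrite ?pfun0 ?pfunD.
Qed.
Lemma pfunC c : L c%:P = c * L 1.
Proof. by rewrite -pfunZ alg_polyC. Qed.
Lemma pfun_coef p : L p = \sum_(i < size p) p`_i * L 'X^i.
Proof.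
rewrite -[in LHS](coefK p) poly_def pfun_sum.
by apply: eq_bigr => i _; rewrite pfunZ.
Qed.

End PolyFunctional.

(** * Bernstein polynomials on [[0, a]] *)

Section Bernstein.
Variables (R : realType) (a : R).
Hypothesis a0 : 0 < a.

Definition bern (N k : nat) : {poly R} :=
  ('C(N, k)%:R / a ^+ N) *: ('X^k * (a%:P - 'X) ^+ (N - k)).

Definition node (N k : nat) : R := k%:R * a / N%:R.

Definition bernop (N : nat) (f : R -> R) : {poly R} :=
  \sum_(k < N.+1) f (node N k) *: bern N k.

Lemma bern_sum1 N : \sum_(k < N.+1) bern N k = 1.
Proof.
have := exprDn (a%:P - 'X : {poly R}) 'X N; rewrite subrK => h.
have aN : a ^+ N != 0 by rewrite expf_eq0 gt_eqF// andbF.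
have e : 1 = (a ^+ N)^-1 *: (a%:P ^+ N) :> {poly R}.
  by rewrite -rmorphXn /= -alg_polyC scalerA mulVf// scale1r.
rewrite e h scaler_sumr; apply: eq_bigr => k _.
by rewrite /bern mulrC -scalerA scaler_nat mulrC.
Qed.

Lemma bernS N k : (k.+1)%:R *: bern N.+1 k.+1 =
  (N.+1%:R / a) *: ('X * bern N k).
Proof.
rewrite /bern subSS -scalerAr !scalerA.
have -> : 'X^(k.+1) * (a%:P - 'X) ^+ (N - k) =
  'X * ('X^k * (a%:P - 'X) ^+ (N - k)) :> {poly R} by rewrite exprS mulrA.
congr (_ *: _); rewrite [LHS]mulrA -natrM -mul_bin_diag natrM exprS invfM /=.
by rewrite mulrACA.
Qed.

(** Falling factorials of [k], unlike its powers, are weights that produce exact monomials: [bernS]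
    trades one factor of [k] for one factor [X] at each step. *)
Lemma bern_ffact j N :
  \sum_(k < N.+1) (k ^_ j)%:R *: bern N k = ((N ^_ j)%:R / a ^+ j) *: 'X^j.
Proof.
elim: j N => [|j IH] [|N].
- by rewrite ffactn0 !expr0 divr1 scale1r -(bern_sum1 0); apply: eq_bigr => k _; rewrite ffactn0 scale1r.
- rewrite ffactn0 !expr0 divr1 scale1r -(bern_sum1 N.+1).
  by apply: eq_bigr => k _; rewrite ffactn0 scale1r.
- by rewrite big_ord_recl big_ord0 ffact0n /= !mul0r !scale0r addr0.
rewrite big_ord_recl /= ffact0n scale0r add0r.
transitivity ((N.+1%:R / a) *: ('X * \sum_(k < N.+1) (k ^_ j)%:R *: bern N k)).
  rewrite mulr_sumr scaler_sumr; apply: eq_bigr => k _ /=.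
  have -> : bump 0 k = k.+1 by [].
  rewrite ffactSS natrM [_ * (k ^_ j)%:R]mulrC -(scalerA (k ^_ j)%:R) bernS.
  by rewrite -[in RHS]scalerAr !scalerA; congr (_ *: _); exact: mulrC.
rewrite IH -scalerAr scalerA -exprS ffactSS natrM [a ^+ j.+1]exprS invfM.
by congr (_ *: _); rewrite mulrACA.
Qed.

(** Induction on the number of factors: the new factor [(k - j) / (N - j)] is within [2 j / N] of
    [k / N], and [j + j ^ 2 <= (j + 1) ^ 2] accounts for the quadratic constant. The condition on
    [N] keeps [N - j] at least [N / 2]. *)
Lemma ffact_ratio (j N k : nat) : (j.*2 <= N)%N -> (0 < N)%N -> (k <= N)%N ->
  let P : R := (k ^_ j)%:R / (N ^_ j)%:R in
  0 <= P <= 1 /\ `|P - (k%:R / N%:R) ^+ j| <= (j ^ 2)%:R * 2 / N%:R.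
Proof.
move=> jN N0 kN /=; elim: j jN => [|j IH] jN.
  by rewrite !ffactn0 divr1 expr0 subrr normr0 exp0n// !mul0r !lexx ler01.
have [|/andP[P0 P1] hP] := IH; first by apply: leq_trans jN; rewrite leq_double.
have jltN : (j < N)%N by lia.
have Nj0 : (0 : R) < (N - j)%:R by rewrite ltr0n subn_gt0.
have NR : (0 : R) < N%:R by rewrite ltr0n.
have kNR : 0 <= (k%:R / N%:R : R) <= 1.
  by rewrite divr_ge0//= ler_pdivrMr// mul1r ler_nat.
have -> : (k ^_ j.+1)%:R / (N ^_ j.+1)%:R =
    (k ^_ j)%:R / (N ^_ j)%:R * ((k - j)%:R / (N - j)%:R) :> R.
  by rewrite !ffactnSr !natrM invfM mulrACA.
set p := (k ^_ j)%:R / (N ^_ j)%:R in P0 P1 hP *.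
have q01 : 0 <= ((k - j)%:R / (N - j)%:R : R) <= 1.
  by rewrite divr_ge0//= ler_pdivrMr// mul1r ler_nat leq_sub2r.
have hq : `|(k - j)%:R / (N - j)%:R - k%:R / N%:R| <= j%:R * 2 / N%:R :> R.
  have [kj|jk] := leqP k j.
    have -> : (k - j)%N = 0%N by apply/eqP; rewrite subn_eq0.
    rewrite mul0r sub0r normrN ger0_norm ?divr_ge0//.
    by rewrite ler_pM2r ?invr_gt0// -natrM ler_nat muln2 -addnn (leq_trans kj) ?leq_addr.
  rewrite natrB ?(ltnW jk)// natrB ?(ltnW jltN)//.
  have d0 : (0 : R) < N%:R - j%:R by rewrite -natrB// ltnW.
  have -> : (k%:R - j%:R) / (N%:R - j%:R) - k%:R / N%:R =
      - (j%:R * (N%:R - k%:R) / ((N%:R - j%:R) * N%:R)) :> R.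
    by field; rewrite gt_eqF//= gt_eqF.
  have nk : (0 : R) <= N%:R - k%:R by rewrite subr_ge0 ler_nat.
  rewrite normrN ger0_norm; last first.
    by rewrite divr_ge0 ?mulr_ge0// ltW.
  rewrite invfM !mulrA ler_pM2r ?invr_gt0// -mulrA ler_wpM2l// ler_pdivrMr//.
  have : (j.+1.*2)%:R <= N%:R :> R by rewrite ler_nat.
  rewrite -muln2 natrM -natr1; have : (0 : R) <= k%:R by [].
  lra.
move/andP: q01 => [q0 q1]; set q := (k - j)%:R / _ in hq q0 q1 *.
move/andP: kNR => [x0 x1]; set x := k%:R / N%:R in hP hq x0 x1 *.
split; first by rewrite mulr_ge0//= mulr_ile1.
have -> : p * q - x ^+ j.+1 = p * (q - x) + x * (p - x ^+ j) by rewrite exprS; ring.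
apply: le_trans (ler_normD _ _) _; rewrite (normrM p) (normrM x) (ger0_norm P0) (ger0_norm x0).
have h1 : p * `|q - x| <= j%:R * 2 / N%:R.
  by apply: le_trans hq; rewrite ler_piMl.
have h2 : x * `|p - x ^+ j| <= (j ^ 2)%:R * 2 / N%:R.
  by apply: le_trans hP; rewrite ler_piMl.
apply: le_trans (lerD h1 h2) _.
rewrite -mulrDl ler_pM2r ?invr_gt0// -mulrDl ler_pM2r// -natrD ler_nat.
clear; rewrite -[j.+1]addn1 sqrnD; lia.
Qed.

Lemma node_itv N k : (k <= N)%N -> 0 <= node N k <= a.
Proof.
move=> kN; rewrite /node divr_ge0 ?mulr_ge0 ?(ltW a0)//=.
have [->|N0] := posnP N; first by rewrite invr0 mulr0 ltW.
by rewrite ler_pdivrMr ?ltr0n// mulrC ler_wpM2l ?(ltW a0)// ler_nat.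
Qed.

Section Functional.
Variables (L : {poly R} -> R) (hL : pfun L).
Hypothesis pos : forall k l, 0 <= L ('X^k * (a%:P - 'X) ^+ l).

Lemma pfun_bern_ge0 N k : 0 <= L (bern N k).
Proof.
by rewrite /bern (pfunZ hL) mulr_ge0// divr_ge0// exprn_ge0// ltW.
Qed.

(** Both terms are sums with the weights [L (bern N k) >= 0], of total mass [L 1]; [ffact_ratio]
    bounds the difference of the coefficients. *)
Lemma bernop_errXn j N : (j.*2 < N)%N ->
  `|L 'X^j - L (bernop N (fun x => x ^+ j))| <=
    a ^+ j * (j ^ 2)%:R * 2 * L 1 * N%:R^-1.
Proof.
move=> jN; have N0 : (0 < N)%N by lia.
have Nj : ((N ^_ j)%:R : R) != 0 by rewrite pnatr_eq0 -lt0n ffact_gt0; lia.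
have -> : L 'X^j = \sum_(k < N.+1) (a ^+ j * ((k ^_ j)%:R / (N ^_ j)%:R)) * L (bern N k).
  have -> : 'X^j = (a ^+ j / (N ^_ j)%:R) *:
      \sum_(k < N.+1) (k ^_ j)%:R *: bern N k :> {poly R}.
    rewrite bern_ffact scalerA mulrA mulfVK// mulfV ?scale1r//.
    by rewrite expf_eq0 gt_eqF// andbF.
  rewrite scaler_sumr (pfun_sum hL); apply: eq_bigr => k _.
  by rewrite scalerA (pfunZ hL); congr (_ * _); rewrite mulrAC mulrA.
rewrite /bernop (pfun_sum hL) -sumrB.
apply: le_trans (ler_norm_sum _ _ _) _.
rewrite -(bern_sum1 N) (pfun_sum hL) mulr_sumr mulr_suml.
apply: ler_sum => k _; rewrite (pfunZ hL (node N k ^+ j)) -mulrBl normrM (ger0_norm (pfun_bern_ge0 _ _)).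
rewrite [leRHS]mulrAC ler_wpM2r ?pfun_bern_ge0//.
have -> : node N k ^+ j = a ^+ j * (k%:R / N%:R) ^+ j.
  by rewrite /node mulrAC exprMn mulrC.
rewrite -mulrBr normrM ger0_norm ?exprn_ge0 ?(ltW a0)//.
rewrite -!mulrA ler_wpM2l ?exprn_ge0 ?(ltW a0)//.
have [|//||_] := @ffact_ratio j N k; [exact: ltnW|by rewrite -ltnS|].
by rewrite !mulrA.
Qed.

Lemma bernop_cvgXn j :
  (fun N => L (bernop N (fun x => x ^+ j))) @ \oo --> L 'X^j.
Proof.
have lim0 : (fun N => (a ^+ j * (j ^ 2)%:R * 2 * L 1) * N%:R^-1) @ \oo --> (0 : R).
  rewrite -[X in _ --> X](mulr0 (a ^+ j * (j ^ 2)%:R * 2 * L 1)).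
  apply: cvgM; first exact: cvg_cst.
  have := @cvg_harmonic R; rewrite -(cvg_shiftS (fun N => N%:R^-1 : R)).
  exact.
apply/cvgrPdist_le => e e0.
move/cvgrPdist_le : lim0 => /(_ e e0); apply: filterS2 (nbhs_infty_ge j.*2.+1) => N jN.
rewrite sub0r normrN; apply: le_trans.
by apply: le_trans (bernop_errXn jN) _; rewrite ler_norm.
Qed.

Lemma bernop_cvg f : (fun N => L (bernop N (horner f))) @ \oo --> L f.
Proof.
rewrite (pfun_coef hL f).
have -> : (fun N => L (bernop N (horner f))) = (fun N =>
    \sum_(i < size f) f`_i * L (bernop N (fun x => x ^+ i))).
  apply/funext => N; rewrite /bernop (pfun_sum hL).
  under [in RHS]eq_bigr => i _ do rewrite (pfun_sum hL) mulr_sumr.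
  rewrite exchange_big /=; apply: eq_bigr => k _.
  rewrite (pfunZ hL f.[_]) horner_coef mulr_suml; apply: eq_bigr => i _.
  by rewrite (pfunZ hL (node N k ^+ i)) mulrA.
apply: cvg_sumr => i.
by apply: cvgM; [exact: cvg_cst|exact: bernop_cvgXn].
Qed.

Lemma pfun_itv_ge0 f : (forall t, 0 <= t <= a -> 0 <= f.[t]) -> 0 <= L f.
Proof.
move=> hf; apply: (cvgr_to_ge (bernop_cvg (f := f))); apply: nearW => N.
rewrite /bernop (pfun_sum hL); apply: sumr_ge0 => k _.
rewrite (pfunZ hL f.[_]) mulr_ge0 ?pfun_bern_ge0// hf// node_itv//.
by rewrite -ltnS.
Qed.

End Functional.

(** * Positivity on an interval from squares and moment growth *)

Section Growth.
Variables (L : {poly R} -> R) (hL : pfun L).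
Hypothesis sqL : forall r, 0 <= L (r ^+ 2).
Hypothesis sqXL : forall r, 0 <= L ('X * r ^+ 2).
Variable c0 : R.
Hypothesis grL : forall n, L 'X^n <= c0 * a ^+ n.

Lemma pfun_Xn_sqr n r : 0 <= L ('X^n * r ^+ 2).
Proof.
rewrite -(odd_double_half n) exprD -muln2 exprM; case: (odd n).
  by rewrite expr1 -mulrA -exprMn sqXL.
by rewrite expr0 mul1r -exprMn sqL.
Qed.

(** The discriminant of the quadratic [u |-> L (X^n ((u - X) r)^2)], which is nonnegative. *)
Lemma pfun_logconvex n r : L ('X^(n.+1) * r ^+ 2) ^+ 2 <=
  L ('X^n * r ^+ 2) * L ('X^(n.+2) * r ^+ 2).
Proof.
set x := L ('X^n * _); set y := L _; set z := L _.
have key u : 0 <= u ^+ 2 * x - 2 * u * y + z.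
  have := pfun_Xn_sqr n ((u%:P - 'X) * r).
  have -> : 'X^n * ((u%:P - 'X) * r) ^+ 2 = u ^+ 2 *: ('X^n * r ^+ 2)
      - (2 * u) *: ('X^(n.+1) * r ^+ 2) + 'X^(n.+2) * r ^+ 2.
    by rewrite -!mul_polyC !rmorphM /= rmorph_nat !exprS; ring.
  by rewrite (pfunD hL) (pfunB hL) !(pfunZ hL).
have x0 : 0 <= x by exact: pfun_Xn_sqr.
have z0 : 0 <= z by exact: pfun_Xn_sqr.
have [xe|xN] := eqVneq x 0.
  rewrite xe mul0r; have [->|yN] := eqVneq y 0; first by rewrite expr0n.
  have := key ((z + 1) / (2 * y)); rewrite xe mulr0 add0r.
  have -> : 2 * ((z + 1) / (2 * y)) * y = z + 1 by field.
  lra.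
have xp : 0 < x by rewrite lt0r xN.
have := key (y / x).
have -> : (y / x) ^+ 2 * x - 2 * (y / x) * y + z = z - y ^+ 2 / x by field.
by rewrite subr_ge0 ler_pdivrMr// mulrC.
Qed.

Lemma bernoulli_expr (d : R) n : 0 <= d -> 1 + n%:R * d <= (1 + d) ^+ n.
Proof.
move=> d0; elim: n => [|n IH]; first by rewrite mul0r addr0.
rewrite exprS; apply: le_trans (ler_wpM2l _ IH); last lra.
rewrite -natr1; have : 0 <= n%:R * d * d by rewrite !mulr_ge0.
lra.
Qed.

Lemma pfun_aX_sqr r : 0 <= L ((a%:P - 'X) * r ^+ 2).
Proof.
pose c n := L ('X^n * r ^+ 2).
have c_ge0 n : 0 <= c n by exact: pfun_Xn_sqr.
have c_logconvex n : c n.+1 ^+ 2 <= c n * c n.+2 by exact: pfun_logconvex.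
(* The factor [r ^+ 2] only changes the constant in the growth bound, by a sum over its
   coefficients. *)
have [K hK] : exists K, forall n, c n <= K * a ^+ n.
  exists (\sum_(j < size (r ^+ 2)) `|(r ^+ 2)`_j| * (c0 * a ^+ j)) => n.
  rewrite /c -[in 'X^n * _](coefK (r ^+ 2)) poly_def mulr_sumr (pfun_sum hL) mulr_suml.
  apply: ler_sum => j _; rewrite -scalerAr (pfunZ hL) -exprD.
  have p0 : 0 <= L 'X^(n + j) by have := pfun_Xn_sqr (n + j) 1; rewrite expr1n mulr1.
  apply: le_trans (_ : `|(r ^+ 2)`_j| * L 'X^(n + j) <= _).
    by rewrite ler_wpM2r// ler_norm.
  rewrite -!mulrA -exprD addnC ler_wpM2l// addnC; exact: grL.
rewrite mulrBl (pfunB hL) mul_polyC (pfunZ hL).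
have -> : L (r ^+ 2) = c 0%N by rewrite /c mul1r.
have -> : L ('X * r ^+ 2) = c 1%N by [].
rewrite subr_ge0 leNgt; apply/negP => h.
have c1 : 0 < c 1%N by apply: le_lt_trans h; rewrite mulr_ge0// ltW.
have cp : 0 < c 0%N.
  rewrite lt0r c_ge0 andbT; apply/eqP => e.
  have := c_logconvex 0%N; rewrite e mul0r leNgt exprn_gt0//.
(* Log-convexity makes [c] grow at least like [rho ^+ n] with [rho > a]. *)
pose rho := c 1%N / c 0%N.
have rho_a : a < rho by rewrite ltr_pdivlMr.
have rho0 : 0 < rho by exact: lt_trans a0 rho_a.
have ratio n : 0 < c n /\ rho * c n <= c n.+1.
  elim: n => [|n [cn hn]]; first by rewrite /rho mulfVK ?gt_eqF.
  have cn1 : 0 < c n.+1 by apply: lt_le_trans hn; rewrite mulr_gt0.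
  split=> //; rewrite -(ler_pM2l cn); apply: le_trans (c_logconvex n).
  by rewrite expr2 mulrA ler_pM2r// mulrC.
have geom n : rho ^+ n * c 0%N <= c n.
  elim: n => [|n IH]; first by rewrite mul1r.
  by apply: le_trans (ratio n).2; rewrite exprS -mulrA ler_pM2l.
pose d := rho / a - 1.
have d0 : 0 < d by rewrite subr_gt0 ltr_pdivlMr// mul1r.
(* Comparing [rho ^+ n] with [a ^+ n] through Bernoulli's inequality for [rho / a = 1 + d] would
   bound all natural numbers. *)
have bnd n : n%:R <= K / c 0%N / d.
  rewrite ler_pdivlMr// ler_pdivlMr//.
  have := le_trans (geom n) (hK n).
  have -> : rho = (1 + d) * a by rewrite /d addrCA subrr addr0 mulfVK// gt_eqF.
  rewrite exprMn mulrAC ler_pM2r ?exprn_gt0// => hh; apply: le_trans hh.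
  rewrite ler_pM2r//; apply: le_trans (bernoulli_expr n (ltW d0)).
  by rewrite lerDr.
have := bnd (Num.truncn (K / c 0%N / d)).+1.
by rewrite leNgt truncnS_gt.
Qed.

(** Even parts of the exponents go into a square, so what matters is the parity of [k] and [l]. If
    both are odd, the identity below rewrites the product as a sum of terms already treated. *)
Lemma pfun_growth_pos k l : 0 <= L ('X^k * (a%:P - 'X) ^+ l).
Proof.
rewrite -(odd_double_half l) -muln2 exprD exprM mulrA.
set s := (_ ^+ l./2); case: (odd l); last first.
  by rewrite expr0 mulr1 -[s ^+ 2]exprM exprM pfun_Xn_sqr.
rewrite expr1 -(odd_double_half k) -muln2 exprD exprM; set t := 'X^(k./2).
case: (odd k); last first.
  rewrite expr0 mul1r (_ : _ * _ * _ = (a%:P - 'X) * (t * s) ^+ 2); last by ring.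
  exact: pfun_aX_sqr.
rewrite expr1 -(pmulr_rge0 _ a0) -(pfunZ hL).
(* [a X (a - X) = (a - X) X^2 + X (a - X)^2] *)
have -> : a *: ('X * t ^+ 2 * (a%:P - 'X) * s ^+ 2) =
    (a%:P - 'X) * ('X * t * s) ^+ 2 + 'X * ((a%:P - 'X) * t * s) ^+ 2.
  by rewrite -mul_polyC; ring.
by rewrite (pfunD hL) addr_ge0// pfun_aX_sqr.
Qed.

End Growth.
End Bernstein.

(** * Polynomial approximants of half-line indicators; distribution functions *)

Section StepPolynomials.
Variables (R : realType) (a : R).
Hypothesis a0 : 0 < a.

(** Bernstein's argument: evaluation at a point [t] of the interval is a functional to which
    [bernop_errXn] applies. Its cases [j = 1] and [j = 2] bound the variance of the nodes around
    [t]. *)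
Lemma lipschitz_poly_approx (g : R -> R) (K : R) : 0 <= K ->
  (forall s t, `|g s - g t| <= K * `|s - t|) ->
  forall e : R, 0 < e -> exists q : {poly R}, forall t : R, 0 <= t <= a -> `|q.[t] - g t| <= e.
Proof.
move=> K0 gK e e0.
pose d := e / (2 * (K + 1)).
have K1 : 0 < K + 1 by rewrite ltr_wpDl.
have d0 : 0 < d by rewrite divr_gt0 ?mulr_gt0.
(* The variance is at most [12 a^2 / N]: 8 from the error for [X^2], and 4 from twice [t] times the
   error for [X]. Adding 5 ensures [2.*2 < N]. *)
pose N := (Num.truncn (12 * a ^+ 2 / d ^+ 2)).+3.+2.
have NR : 0 < N%:R :> R by rewrite ltr0n.
have Nbig : 12 * a ^+ 2 / N%:R <= d ^+ 2.
  rewrite ler_pdivrMr// [d ^+ 2 * _]mulrC -ler_pdivrMr ?exprn_gt0//; apply/ltW.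
  by apply: lt_le_trans (truncnS_gt _) _; rewrite ler_nat /N ltnS; do 4!apply: leqW.
exists (bernop a N g) => t t01.
have hE : pfun (fun p : {poly R} => p.[t]) by split=> c p q; rewrite hornerD hornerZ.
have posE k l : 0 <= ('X^k * (a%:P - 'X) ^+ l).[t].
  move/andP: t01 => [t0 ta].
  by rewrite hornerM !horner_exp hornerD hornerN hornerC !hornerX mulr_ge0 ?exprn_ge0// subr_ge0.
have b0 k : 0 <= (bern a N k).[t] by exact: (pfun_bern_ge0 a0 hE posE).
have sum1 : \sum_(k < N.+1) (bern a N k).[t] = 1.
  by rewrite -(pfun_sum hE) (bern_sum1 a0) hornerC.
have mom : \sum_(k < N.+1) (node a N k - t) ^+ 2 * (bern a N k).[t] <= d ^+ 2.
  have e1 := bernop_errXn a0 hE posE (isT : (1.*2 < N)%N).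
  have e2 := bernop_errXn a0 hE posE (isT : (2.*2 < N)%N).
  rewrite /= hornerC !hornerXn in e1 e2.
  rewrite /bernop !(pfun_sum hE) in e1 e2.
  have -> : \sum_(k < N.+1) (node a N k - t) ^+ 2 * (bern a N k).[t] =
     \sum_(k < N.+1) (node a N k ^+ 2 *: bern a N k).[t]
     - 2 * t * (\sum_(k < N.+1) (node a N k ^+ 1 *: bern a N k).[t])
     + t ^+ 2 * \sum_(k < N.+1) (bern a N k).[t].
    rewrite !mulr_sumr -sumrB -big_split /=; apply: eq_bigr => k _.
    by rewrite !hornerZ; ring.
  rewrite sum1 mulr1.
  move: (\sum_(k < N.+1) (node a N k ^+ 2 *: bern a N k).[t]) e2 => S2.
  move: (\sum_(k < N.+1) (node a N k ^+ 1 *: bern a N k).[t]) e1 => S1.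
  rewrite !expr1 exp1n !mulr1 (_ : (2 ^ 2)%:R = 4 :> R)// => e1 e2.
  apply: le_trans Nbig; have r0 : 0 < N%:R^-1 :> R by rewrite invr_gt0.
  move: (N%:R^-1 : R) r0 e1 e2 => r r0 e1 e2.
  rewrite distrC in e1; rewrite distrC in e2; move/andP: t01 => [t0 ta].
  move: e1 e2; rewrite !ler_norml => /andP[h1 _] /andP[_ h2].
  have h3 : t * (a * r) <= a * (a * r) by rewrite ler_wpM2r// mulr_ge0// ltW.
  have h4 : 0 <= t * (S1 - t + a * 2 * r) by apply: mulr_ge0 => //; lra.
  have -> : S2 - 2 * t * S1 + t ^+ 2 = (S2 - t ^+ 2)
     - 2 * (t * (S1 - t + a * 2 * r)) + 4 * (t * (a * r)) by ring.
  have -> : 12 * a ^+ 2 * r = a ^+ 2 * 4 * 2 * r + 4 * (a * (a * r)) by ring.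
  lra.
rewrite /bernop horner_sum.
have -> : g t = \sum_(k < N.+1) g t * (bern a N k).[t] by rewrite -mulr_sumr sum1 mulr1.
rewrite -sumrB; apply: le_trans (ler_norm_sum _ _ _) _.
(* As in Chebyshev's inequality, [|u| <= d + u ^+ 2 / d] trades the distance to a node for its
   square. *)
have bnd k : `|(g (node a N k) *: bern a N k).[t] - g t * (bern a N k).[t]| <=
    K * d * (bern a N k).[t] + K / d * ((node a N k - t) ^+ 2 * (bern a N k).[t]).
  rewrite hornerZ -mulrBl normrM (ger0_norm (b0 _)).
  rewrite [K / d * _]mulrA -mulrDl ler_wpM2r//; apply: le_trans (gK _ _) _.
  rewrite -!mulrA -mulrDr ler_wpM2l//; set u := node a N k - t.
  rewrite -[u ^+ 2]real_normK ?num_real//.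
  have -> : d^-1 * `|u| ^+ 2 = d^-1 * (`|u| - d) ^+ 2 + 2 * `|u| - d.
    by field; rewrite gt_eqF.
  have : 0 <= d^-1 * (`|u| - d) ^+ 2 by rewrite mulr_ge0 ?sqr_ge0 ?invr_ge0 ?ltW.
  by have := normr_ge0 u; lra.
apply: (@le_trans _ _ (\sum_(k < N.+1) (K * d * (bern a N k).[t] +
    K / d * ((node a N k - t) ^+ 2 * (bern a N k).[t])))).
  by apply: ler_sum => k _; exact: bnd.
rewrite big_split /= -!mulr_sumr sum1 mulr1.
apply: le_trans (_ : K * d + K / d * d ^+ 2 <= _).
  by rewrite lerD2l ler_wpM2l// divr_ge0// ltW.
have -> : K * d + K / d * d ^+ 2 = 2 * K * d by field; rewrite gt_eqF.
have -> : 2 * K * d = e * (K / (K + 1)) by rewrite /d; field; rewrite gt_eqF.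
by rewrite ler_piMr ?(ltW e0)// ler_pdivrMr// mul1r lerDl.
Qed.

Definition clamp (u : R) : R := if u <= 0 then 0 else if 1 <= u then 1 else u.

Lemma clamp_itv u : 0 <= clamp u <= 1.
Proof.
by rewrite /clamp; have [?|?] := lerP u 0; have [?|?] := lerP 1 u;
  apply/andP; split; lra.
Qed.
Lemma clamp1 u : 1 <= u -> clamp u = 1.
Proof. by rewrite /clamp; have [?|?] := lerP u 0; have [?|?] := lerP 1 u; lra. Qed.
Lemma clamp0 u : u <= 0 -> clamp u = 0.
Proof. by rewrite /clamp => ->. Qed.
Lemma clamp_le u v : u <= v -> clamp u <= clamp v <= clamp u + (v - u).
Proof.
move=> uv; rewrite /clamp; have [?|?] := lerP u 0; have [?|?] := lerP 1 u;
  have [?|?] := lerP v 0; have [?|?] := lerP 1 v; apply/andP; split; lra.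
Qed.
Lemma clamp_lip u v : `|clamp u - clamp v| <= `|u - v|.
Proof.
wlog uv : u v / u <= v.
  move=> h; case/orP: (le_total u v) => [/h//|/h hv].
  by rewrite distrC (distrC u).
have /andP[h1 h2] := clamp_le uv.
by rewrite distrC [leRHS]distrC !ger0_norm ?subr_ge0//; lra.
Qed.

(** A ramp: 1 up to [x], 0 from [x + d] on, affine in between. *)
Definition hat (x d t : R) : R := clamp (1 + (x - t) / d).

Lemma hat_itv x d t : 0 <= hat x d t <= 1.
Proof. exact: clamp_itv. Qed.
Lemma hat1 x d t : 0 < d -> t <= x -> hat x d t = 1.
Proof. by move=> d0 tx; rewrite /hat clamp1// lerDl divr_ge0 ?subr_ge0// ltW. Qed.
Lemma hat0 x d t : 0 < d -> x + d <= t -> hat x d t = 0.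
Proof.
move=> d0 xt; rewrite /hat clamp0// -[1](@divff _ d) ?gt_eqF// -mulrDl.
by rewrite pmulr_lle0 ?invr_gt0//; lra.
Qed.
Lemma hat_lip x d s t : 0 < d -> `|hat x d s - hat x d t| <= d^-1 * `|s - t|.
Proof.
move=> d0; apply: le_trans (clamp_lip _ _) _.
have -> : 1 + (x - s) / d - (1 + (x - t) / d) = d^-1 * (t - s) by ring.
by rewrite normrM gtr0_norm ?invr_gt0// distrC.
Qed.
Lemma hat_mono x y d t : 0 < d -> x <= y ->
  hat x d t <= hat y d t <= hat x d t + (y - x) / d.
Proof.
move=> d0 xy; have := @clamp_le (1 + (x - t) / d) (1 + (y - t) / d).
have -> : 1 + (y - t) / d - (1 + (x - t) / d) = (y - x) / d by ring.
by apply; rewrite lerD2l ler_pM2r ?invr_gt0// lerB.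
Qed.
Lemma hat_anti x d d' t : 0 < d' -> d' <= d -> hat x d' t <= hat x d t.
Proof.
move=> d'0 d'd; have d0 : 0 < d by exact: lt_le_trans d'd.
have [tx|xt] := lerP t x; first by rewrite !hat1.
have [|//] := andP (@clamp_le (1 + (x - t) / d') (1 + (x - t) / d) _).
by rewrite lerD2l ler_nM2l ?subr_lt0// lef_pV2 ?posrE.
Qed.

Definition eta (m : nat) : R := m.+1%:R^-1.

Lemma eta_gt0 m : 0 < eta m.
Proof. by rewrite invr_gt0. Qed.
Lemma eta_lt m : eta m.+1 < eta m.
Proof. by rewrite ltf_pV2 ?posrE// ltr_nat. Qed.
Lemma eta_cvg : eta @ \oo --> (0 : R).
Proof. exact: cvg_harmonic. Qed.
Lemma eta_small (e : R) : 0 < e -> \forall m \near \oo, eta m < e.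
Proof.
move=> e0; have /cvgrPdist_lt/(_ e e0) := eta_cvg.
by apply: filterS => m; rewrite sub0r normrN gtr0_norm// eta_gt0.
Qed.

(* The margins [eta m.+1] and [eta m] make the approximants decrease in [m], so
   that no double limit is needed below. *)
Lemma stepq_ex x m : exists q : {poly R}, forall t, 0 <= t <= a ->
  hat x (eta m) t + eta m.+1 <= q.[t] <= hat x (eta m) t + eta m.
Proof.
have h := eta_lt m; pose e := (eta m - eta m.+1) / 2.
have e0 : 0 < e by rewrite divr_gt0// subr_gt0.
pose g t := hat x (eta m) t + (eta m + eta m.+1) / 2.
have [|s t|q hq] := @lipschitz_poly_approx g (eta m)^-1 _ _ e e0.
- by rewrite invr_ge0 ltW// eta_gt0.
- by rewrite /g opprD addrACA subrr addr0 hat_lip// eta_gt0.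
exists q => t /hq; rewrite ler_norml /g /e => /andP[h1 h2].
by apply/andP; split; lra.
Qed.

Definition stepq x m : {poly R} := projT1 (cid (stepq_ex x m)).

Lemma stepqP x m t : 0 <= t <= a ->
  hat x (eta m) t + eta m.+1 <= (stepq x m).[t] <= hat x (eta m) t + eta m.
Proof. exact: (projT2 (cid (stepq_ex x m))). Qed.

Lemma stepq_ge1 x m t : 0 <= t <= a -> t <= x -> 1 <= (stepq x m).[t].
Proof.
move=> /(stepqP x m)/andP[h _] tx; apply: le_trans h.
by rewrite hat1 ?eta_gt0// lerDl ltW// eta_gt0.
Qed.

Lemma stepq_ge0 x m t : 0 <= t <= a -> 0 <= (stepq x m).[t].
Proof.
move=> /(stepqP x m)/andP[h _]; apply: le_trans h.
by rewrite addr_ge0 ?(ltW (eta_gt0 _))//; have /andP[] := hat_itv x (eta m) t.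
Qed.

Lemma stepq_le x m t : 0 <= t <= a -> x + eta m <= t -> (stepq x m).[t] <= eta m.
Proof.
by move=> /(stepqP x m)/andP[_ h] xt; apply: le_trans h _; rewrite hat0 ?eta_gt0// add0r.
Qed.

Lemma stepq_le1 x m t : 0 <= t <= a -> (stepq x m).[t] <= 1 + eta m.
Proof.
move=> /(stepqP x m)/andP[_ h]; apply: le_trans h _.
by rewrite lerD2r; have /andP[] := hat_itv x (eta m) t.
Qed.

Lemma stepq_decr x m t : 0 <= t <= a -> (stepq x m.+1).[t] <= (stepq x m).[t].
Proof.
move=> ht; have /andP[_ h1] := stepqP x m.+1 ht; have /andP[h2 _] := stepqP x m ht.
have := @hat_anti x (eta m) (eta m.+1) t (eta_gt0 _) (ltW (eta_lt m)); lra.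
Qed.

Lemma stepq_shift x y m t : 0 <= t <= a -> x <= y ->
  (stepq x m).[t] <= (stepq y m).[t] + eta m /\
  (stepq y m).[t] <= (stepq x m).[t] + (eta m + (y - x) / eta m).
Proof.
move=> ht xy; have /andP[h1 h2] := stepqP x m ht; have /andP[h3 h4] := stepqP y m ht.
have /andP[h5 h6] := hat_mono t (eta_gt0 m) xy.
by have := eta_gt0 m.+1; split; lra.
Qed.

(* [cdf x] is the value of [L], extended by monotone limits, at the indicator of
   the half-line up to [x]. *)
Section Cdf.
Variables (L : {poly R} -> R) (hL : pfun L).
Hypothesis posL : forall f, (forall t, 0 <= t <= a -> 0 <= f.[t]) -> 0 <= L f.

Lemma pfun_le f g : (forall t, 0 <= t <= a -> f.[t] <= g.[t]) -> L f <= L g.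
Proof.
move=> h; rewrite -subr_ge0 -(pfunB hL); apply: posL => t ht.
by rewrite hornerD hornerN subr_ge0 h.
Qed.

Lemma posL1 : 0 <= L 1.
Proof. by apply: posL => t _; rewrite hornerC. Qed.

Definition cdf x : R := lim ((fun m => L (stepq x m)) @ \oo).

Lemma stepq_ninc x : {homo (fun m => L (stepq x m)) : n m / (n <= m)%N >-> m <= n}.
Proof.
apply/nonincreasing_seqP => m; apply: pfun_le => t ht; exact: stepq_decr.
Qed.

Lemma cdf_is_cvg x : cvgn (fun m => L (stepq x m)).
Proof.
apply: nonincreasing_is_cvgn; first exact: stepq_ninc.
exists 0 => _ [m _ <-]; apply: posL => t; exact: stepq_ge0.
Qed.

Lemma cdf_cvg x : (fun m => L (stepq x m)) @ \oo --> cdf x.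
Proof. exact: cdf_is_cvg. Qed.

Lemma cdf_le x m : cdf x <= L (stepq x m).
Proof. by have /(_ m) := nonincreasing_cvgn_ge (@stepq_ninc x) (@cdf_is_cvg x). Qed.

Lemma cdf_ge0 x : 0 <= cdf x.
Proof.
apply: (cvgr_to_ge (@cdf_cvg x)); apply: nearW => m.
by apply: posL => t; exact: stepq_ge0.
Qed.

(** The approximants at [x] and at [y] are chosen separately and compare only up to [eta m]; that
    error disappears in the limit. *)
Lemma cdf_ndecr x y : x <= y -> cdf x <= cdf y.
Proof.
move=> xy.
have cv : (fun m => L (stepq y m) + eta m * L 1) @ \oo --> cdf y + 0 * L 1.
  apply: cvgD; first exact: cdf_cvg.
  by apply: cvgM; [exact: eta_cvg|exact: cvg_cst].
rewrite mul0r addr0 in cv; apply: (cvgr_to_ge cv); apply: nearW => m.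
apply: le_trans (cdf_le x m) _; rewrite -(pfunC hL) -(pfunD hL); apply: pfun_le => t ht.
by rewrite hornerD hornerC; have [] := stepq_shift m ht xy.
Qed.

Lemma cdf_right_continuous : right_continuous cdf.
Proof.
move=> x; apply/cvgrPdist_le => e e0.
have cv : (fun m => L (stepq x m) + eta m * L 1) @ \oo --> cdf x + 0 * L 1.
  apply: cvgD; first exact: cdf_cvg.
  by apply: cvgM; [exact: eta_cvg|exact: cvg_cst].
rewrite mul0r addr0 in cv.
have e2 : 0 < e / 2 by rewrite divr_gt0.
move/cvgrPdist_lt : cv => /(_ _ e2)/filter_ex[m].
rewrite ltr_norml => /andP[h _].
have L1 : 0 < 2 * (L 1 + 1) by rewrite mulr_gt0// ltr_wpDl// posL1.
(* With [m] fixed, this radius makes the change [(y - x) / eta m * L 1] of the approximant at most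
   [e / 2]; [L 1 + 1] replaces [L 1], which may be 0. *)
have d0 : 0 < e * eta m / (2 * (L 1 + 1)) by rewrite divr_gt0// mulr_gt0// eta_gt0.
have := nbhs_right_lt (_ : x < x + e * eta m / (2 * (L 1 + 1))).
rewrite ltrDl => /(_ d0) => h1.
near=> y.
have xy : x <= y by near: y; exact: nbhs_right_ge.
have yd : y < x + e * eta m / (2 * (L 1 + 1)) by near: y.
rewrite distrC ger0_norm ?subr_ge0 ?cdf_ndecr//.
have hy : cdf y <= L (stepq x m) + (eta m + (y - x) / eta m) * L 1.
  apply: le_trans (cdf_le y m) _; rewrite -(pfunC hL) -(pfunD hL).
  by apply: pfun_le => t ht; rewrite hornerD hornerC; have [] := stepq_shift m ht xy.
have : (y - x) / eta m * L 1 <= e / 2.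
  apply: le_trans (_ : (y - x) / eta m * (L 1 + 1) <= _).
    by rewrite ler_wpM2l ?lerDl// divr_ge0 ?subr_ge0// ltW// eta_gt0.
  rewrite -ler_pdivlMr ?ltr_wpDl ?posL1// ler_pdivrMr ?eta_gt0//.
  have -> : e / 2 / (L 1 + 1) * eta m = e * eta m / (2 * (L 1 + 1)).
    by field; rewrite gt_eqF// ltr_wpDl ?posL1.
  lra.
rewrite mulrDl in hy; lra.
Unshelve. all: by end_near. Qed.

Lemma cdf_lt0 x : x < 0 -> cdf x = 0.
Proof.
move=> x0; apply/eqP; rewrite eq_le cdf_ge0 andbT.
have cv : (fun m => eta m * L 1) @ \oo --> (0 * L 1 : R).
  by apply: cvgM; [exact: eta_cvg|exact: cvg_cst].
rewrite mul0r in cv; apply: (cvgr_to_ge cv).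
have nx : 0 < - x by rewrite oppr_gt0.
apply: filterS (eta_small nx) => m hm.
apply: le_trans (cdf_le x m) _; rewrite -(pfunC hL); apply: pfun_le => t ht.
by rewrite hornerC; apply: stepq_le => //; move/andP: ht => [t0 _]; lra.
Qed.

Lemma cdf_ge x : a <= x -> cdf x = L 1.
Proof.
move=> ax; apply/eqP; rewrite eq_le; apply/andP; split.
  have cv : (fun m => (1 + eta m) * L 1) @ \oo --> ((1 + 0) * L 1 : R).
    apply: cvgM; last exact: cvg_cst.
    by apply: cvgD; [exact: cvg_cst|exact: eta_cvg].
  rewrite addr0 mul1r in cv; apply: (cvgr_to_ge cv); apply: nearW => m.
  apply: le_trans (cdf_le x m) _; rewrite -(pfunC hL); apply: pfun_le => t ht.
  by rewrite hornerC; exact: stepq_le1.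
apply: (cvgr_to_ge (@cdf_cvg x)); apply: nearW => m; apply: pfun_le => t ht.
rewrite hornerC; apply: stepq_ge1 => //; apply: le_trans ax.
by case/andP: ht.
Qed.

Lemma cdf_le1 x : cdf x <= L 1.
Proof.
have [ax|xa] := lerP a x; first by rewrite cdf_ge.
by rewrite -(@cdf_ge a)// cdf_ndecr// ltW.
Qed.

Section Moment.
Variables (n K : nat).
Hypothesis K0 : (0 < K)%N.
Let d : R := a / K%:R.
Let x (k : nat) : R := k%:R * d.
Let D (k : nat) : R := x k.+1 ^+ n - x k ^+ n.

Let d0 : 0 < d. Proof. by rewrite divr_gt0// ltr0n. Qed.
Let x_ge0 k : 0 <= x k. Proof. by rewrite mulr_ge0// ltW. Qed.
Let xS k : x k.+1 = x k + d. Proof. by rewrite /x -natr1 mulrDl mul1r. Qed.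
Let x_le k : x k <= x k.+1. Proof. by rewrite xS lerDl ltW. Qed.
Let D_ge0 k : 0 <= D k.
Proof. by rewrite subr_ge0 lerXn2r ?nnegrE. Qed.

(** Telescoping [phi t] over the mesh splits [a ^+ n - t ^+ n] into increments. The [k]-th one is
    [D k] if [t <= x k], vanishes if [t >= x k.+1], and lies between 0 and [D k] otherwise; it is
    thus sandwiched between multiples of two half-line indicators. *)
Let phi (t y : R) := (Num.max y t) ^+ n.

Let phi_sum t : 0 <= t <= a ->
  \sum_(k < K) (phi t (x k.+1) - phi t (x k)) = a ^+ n - t ^+ n.
Proof.
move=> /andP[t0 ta].
rewrite -(big_mkord xpredT (fun k => phi t (x k.+1) - phi t (x k))) telescope_sumr//.
rewrite /phi /x mul0r (max_r t0) max_l; first by rewrite /d mulrC mulfVK// gt_eqF// ltr0n.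
by rewrite /d mulrC mulfVK// gt_eqF// ltr0n.
Qed.

Lemma moment_le_cdf : a ^+ n * L 1 - L 'X^n <= \sum_(k < K) D k * cdf (x k.+1).
Proof.
have cv : (fun m => \sum_(k < K) D k * L (stepq (x k.+1) m)) @ \oo -->
    \sum_(k < K) D k * cdf (x k.+1).
  apply: cvg_sumr => k; apply: cvgM; [exact: cvg_cst|exact: cdf_cvg].
apply: (cvgr_to_ge cv); apply: nearW => m.
rewrite -(pfunC hL) -(pfunB hL).
under eq_bigr do rewrite -(pfunZ hL); rewrite -(pfun_sum hL).
apply: pfun_le => t ht; rewrite hornerD hornerN hornerC hornerXn horner_sum -phi_sum//.
apply: ler_sum => k _; rewrite hornerZ /phi.
have [tx|xt] := lerP t (x k.+1).
  apply: le_trans (_ : D k <= _); last first.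
    by rewrite ler_peMr// stepq_ge1.
  rewrite lerB// lerXn2r ?nnegrE ?le_max ?x_ge0 ?lexx//.
rewrite max_r ?subrr; last by rewrite (le_trans (x_le k))// ltW.
by rewrite mulr_ge0// stepq_ge0.
Qed.

(** The approximant at [x k - d] is small only from [x k - d + eta m] on. The extra mesh step to the
    left puts this before [x k] once [eta m < d], where the increment may already be less than
    [D k]. *)
Lemma cdf_le_moment : \sum_(k < K) D k * cdf (x k - d) <= a ^+ n * L 1 - L 'X^n.
Proof.
have cv : (fun m => \sum_(k < K) D k * (L (stepq (x k - d) m) - eta m * L 1)) @ \oo -->
    \sum_(k < K) D k * (cdf (x k - d) - 0 * L 1).
  apply: cvg_sumr => k; apply: cvgM; first exact: cvg_cst.
  apply: cvgB; first exact: cdf_cvg.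
  by apply: cvgM; [exact: eta_cvg|exact: cvg_cst].
under [X in X <= _]eq_bigr do rewrite -[cdf _]subr0 -[X in _ - X](mul0r (L 1)).
apply: (cvgr_to_le cv); apply: filterS (eta_small d0) => m hm.
rewrite -(pfunC hL (a ^+ n)) -(pfunB hL (a ^+ n)%:P).
under eq_bigr do rewrite -(pfunC hL (eta m)) -(pfunB hL) -(pfunZ hL); rewrite -(pfun_sum hL).
apply: pfun_le => t ht; rewrite hornerD hornerN hornerC hornerXn horner_sum -phi_sum//.
apply: ler_sum => k _; rewrite hornerZ hornerD hornerN hornerC /phi.
have [xt|tx] := lerP (x k) t.
  apply: le_trans (_ : 0 <= _); last first.
    by rewrite subr_ge0 lerXn2r ?nnegrE ?le_max ?x_ge0 ?lexx ?orbT//; case/andP: ht.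
  rewrite mulr_ge0_le0// subr_le0 stepq_le//; lra.
rewrite max_l; last by rewrite (le_trans (ltW tx)).
rewrite -/(D k) ler_piMr// lerBlDr; exact: stepq_le1.
Qed.

End Moment.
End Cdf.

Lemma powB_le n : exists2 c : R, 0 <= c & forall x y, 0 <= x -> x <= y -> y <= a ->
  y ^+ n - x ^+ n <= c * (y - x).
Proof.
elim: n => [|n [c c0 IH]].
  by exists 0 => // x y _ _ _; rewrite subrr mul0r.
exists (a * c + a ^+ n); first by rewrite addr_ge0 ?mulr_ge0 ?exprn_ge0 ?(ltW a0).
move=> x y x0 xy ya; have y0 := le_trans x0 xy.
have -> : y ^+ n.+1 - x ^+ n.+1 = y * (y ^+ n - x ^+ n) + x ^+ n * (y - x).
  by rewrite !exprS; ring.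
rewrite mulrDl; apply: lerD.
  rewrite -mulrA; apply: ler_pM => //; last exact: IH.
  by rewrite subr_ge0 lerXn2r ?nnegrE.
by rewrite ler_wpM2r ?subr_ge0// lerXn2r ?nnegrE// ?(le_trans xy)// (le_trans y0).
Qed.

(** * Recovery of the moments from the distribution function *)

Section Determinacy.
Variables (L J : {poly R} -> R) (hL : pfun L) (hJ : pfun J).
Hypothesis posL : forall f, (forall t, 0 <= t <= a -> 0 <= f.[t]) -> 0 <= L f.
Hypothesis posJ : forall f, (forall t, 0 <= t <= a -> 0 <= f.[t]) -> 0 <= J f.
Hypothesis cdfLJ : forall x, cdf L x = cdf J x.

(* Riemann sums for [a ^+ n - t ^+ n] over the mesh [a / K]; the two bounds differ
   by a telescoping sum of order [1 / K]. *)
Lemma cdf_moment_le n : L 'X^n <= J 'X^n.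
Proof.
have L1 : L 1 = J 1 by rewrite -(cdf_ge hL posL (lexx a)) -(cdf_ge hJ posJ (lexx a)).
have [c c0 hc] := powB_le n.
apply/ler_addgt0Pr => e e0.
pose K := (Num.truncn (c * a * (2 * L 1) / e)).+1.
have K0 : (0 < K)%N by [].
have KR : 0 < K%:R :> R by rewrite ltr0n.
have Kbig : c * a * (2 * L 1) / K%:R <= e.
  by rewrite ler_pdivrMr// [e * _]mulrC -ler_pdivrMr// ltW// truncnS_gt.
have h1 := cdf_le_moment hL posL n K0; have h2 := moment_le_cdf hJ posJ n K0.
rewrite -L1 in h2.
pose d : R := a / K%:R; pose x (k : nat) : R := k%:R * d.
pose D (k : nat) : R := x k.+1 ^+ n - x k ^+ n.
have d0 : 0 < d by rewrite divr_gt0.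
have xS k : x k.+1 = x k + d by rewrite /x -natr1 mulrDl mul1r.
have xK : x K = a by rewrite /x /d mulrC mulfVK// gt_eqF.
have x0 k : 0 <= x k by rewrite /x mulr_ge0// ltW.
suff : \sum_(k < K) D k * cdf J (x k.+1) - \sum_(k < K) D k * cdf L (x k - d) <= e.
  move: h1 h2; rewrite -/d /=.
  rewrite -[\sum_(k < K) (_ - _) * cdf L _]/(\sum_(k < K) D k * cdf L (x k - d)).
  rewrite -[\sum_(k < K) (_ - _) * cdf J _]/(\sum_(k < K) D k * cdf J (x k.+1)).
  lra.
apply: le_trans Kbig; rewrite -sumrB.
have Dle (k : 'I_K) : D k <= c * d.
  have xle : x k <= x k.+1 by rewrite xS lerDl ltW.
  have dE : x k.+1 - x k = d by rewrite xS addrC addKr.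
  have xa : x k.+1 <= a.
    by rewrite -xK ler_wpM2r ?(ltW d0)// ler_nat; exact: ltn_ord.
  by have := hc _ _ (x0 k) xle xa; rewrite dE.
have -> : c * a * (2 * L 1) / K%:R = c * d * (L 1 + L 1) by rewrite /d; ring.
apply: le_trans (_ : \sum_(k < K) c * d * (cdf L (x k.+1) - cdf L (x k - d)) <= _).
  apply: ler_sum => k _; rewrite -cdfLJ -mulrBr ler_wpM2r// subr_ge0.
  by apply: (cdf_ndecr hL posL); rewrite xS; lra.
rewrite -mulr_sumr ler_wpM2l ?(mulr_ge0 c0 (ltW d0))//.
(* Each difference spans two mesh steps, hence two telescoping sums, each at most [L 1]; this is the
   factor 2 in the choice of [K]. *)
have -> : \sum_(k < K) (cdf L (x k.+1) - cdf L (x k - d)) =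
  \sum_(k < K) (cdf L (x k.+1) - cdf L (x k)) +
  \sum_(k < K) (cdf L (x k.+1 - d) - cdf L (x k - d)).
  rewrite -big_split /=; apply: eq_bigr => k _.
  by rewrite (_ : x k.+1 - d = x k) ?xS ?addrK// addrA subrK.
rewrite -(big_mkord xpredT (fun k => cdf L (x k.+1) - cdf L (x k))).
rewrite -(big_mkord xpredT (fun k => cdf L (x k.+1 - d) - cdf L (x k - d))).
rewrite !telescope_sumr//.
have := cdf_le1 hL posL (x K); have := cdf_le1 hL posL (x K - d).
have := cdf_ge0 hL posL (x 0%N); have := cdf_ge0 hL posL (x 0%N - d).
lra.
Qed.

End Determinacy.

Lemma cdf_inj (L J : {poly R} -> R) : pfun L -> pfun J ->
  (forall f, (forall t, 0 <= t <= a -> 0 <= f.[t]) -> 0 <= L f) ->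
  (forall f, (forall t, 0 <= t <= a -> 0 <= f.[t]) -> 0 <= J f) ->
  (forall x, cdf L x = cdf J x) -> forall f, L f = J f.
Proof.
move=> hL hJ posL posJ LJ f; rewrite (pfun_coef hL) (pfun_coef hJ).
apply: eq_bigr => i _; congr (_ * _); apply/eqP; rewrite eq_le.
by rewrite (cdf_moment_le hL hJ)// (cdf_moment_le hJ hL).
Qed.

End StepPolynomials.

(** * Measures on the half-line and their moments *)

Section MeasureMoments.
Variables (R : realType) (a : R).
Hypothesis a0 : 0 < a.
Local Notation I := (`[0, a]%classic : set R).
Local Notation Rplus := (@Rplus R).

Lemma measurable_Rplus : measurable (Rplus : set R).
Proof. exact: measurable_itv. Qed.

Lemma sub_itv_Rplus : I `<=` Rplus.
Proof. by move=> x; rewrite /Defs.Rplus /= !in_itv /= andbT => /andP[]. Qed.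

Lemma horner_continuous (q : {poly R}) : continuous (horner q).
Proof.
elim/poly_ind: q => [|q c IH] x.
  by rewrite (_ : horner 0 = cst 0); [exact: cvg_cst|apply/funext => y; rewrite horner0].
rewrite (_ : horner _ = (fun y => q.[y] * y + c)); last first.
  by apply/funext => y; rewrite hornerMXaddC.
apply: cvgD; last exact: cvg_cst.
by apply: cvgM; [exact: IH|exact: cvg_id].
Qed.

Lemma measurable_horner (q : {poly R}) D : measurable_fun D (horner q).
Proof.
apply: (@measurable_funTS _ _ _ _ D (horner q)).
apply: continuous_measurable_fun.
exact: horner_continuous.
Qed.

Section OneMeasure.
Variable nu : {measure set R -> \bar R}.
Hypothesis nufin : (nu setT < +oo)%E.
Hypothesis nuI : nu (~` I) = 0%E.

Lemma nu_fin D : measurable D -> (nu D < +oo)%E.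
Proof. by move=> mD; apply: le_lt_trans nufin; rewrite le_measure ?inE. Qed.

Lemma nu_fin_num D : measurable D -> nu D \is a fin_num.
Proof. by move=> mD; rewrite ge0_fin_numE// nu_fin. Qed.

Lemma nu_Rplus : nu (Rplus `\` I) = 0%E.
Proof.
apply: (subset_measure0 _ _ _ nuI).
- exact: measurableD measurable_Rplus (measurable_itv _).
- exact: measurableC (measurable_itv _).
- by move=> x [].
Qed.

Lemma Rplus_setD : Rplus `\` (Rplus `\` I) = I.
Proof.
by rewrite setDD setIidr//; exact: sub_itv_Rplus.
Qed.

Lemma poly_bounded_itv (q : {poly R}) : [bounded q.[x] | x in I].
Proof.
have cI : compact I by exact: segment_compact.
have := compact_bounded (continuous_compact (continuous_subspaceT (@horner_continuous q)) cI).
by move=> [M [Mr hM]]; exists M; split => // r Mr' x Ix /=; apply: (hM r Mr'); exists x.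
Qed.

Lemma poly_integrable_itv q : nu.-integrable I (EFin \o horner q).
Proof.
apply: measurable_bounded_integrable.
- exact: measurable_itv.
- by apply: nu_fin; exact: measurable_itv.
- exact: measurable_horner.
- exact: poly_bounded_itv.
Qed.

Lemma poly_integrable q : nu.-integrable Rplus (EFin \o horner q).
Proof.
apply/(@negligible_integrable _ _ _ nu Rplus (Rplus `\` I)).
- exact: measurableD measurable_Rplus (measurable_itv _).
- exact: measurable_Rplus.
- by apply/measurable_EFinP; exact: measurable_horner.
- exact: nu_Rplus.
by rewrite Rplus_setD; exact: poly_integrable_itv.
Qed.

Definition polyint (q : {poly R}) : R := \int[nu]_(x in Rplus) q.[x].

Lemma polyintE q : polyint q = \int[nu]_(x in I) q.[x].
Proof.
rewrite /polyint /Rintegral; congr fine.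
rewrite (@negligible_integral _ _ _ nu Rplus (Rplus `\` I)) ?Rplus_setD//.
- exact: measurableD measurable_Rplus (measurable_itv _).
- exact: measurable_Rplus.
- exact: poly_integrable.
- exact: nu_Rplus.
Qed.

Lemma polyint_pfun : pfun polyint.
Proof.
split=> c p q; rewrite /polyint -RintegralZl ?measurable_Rplus ?poly_integrable//; last exact: measurable_Rplus.
rewrite -RintegralD.
- by apply: eq_Rintegral => x _; rewrite hornerD hornerZ.
- exact: measurable_Rplus.
- have := poly_integrable (c *: p); apply: eq_integrable; first exact: measurable_Rplus.
  by move=> x _ /=; rewrite hornerZ.
- exact: poly_integrable.
Qed.

Lemma polyint_pos f : (forall t, 0 <= t <= a -> 0 <= f.[t]) -> 0 <= polyint f.
Proof.
by move=> hf; rewrite polyintE; apply: Rintegral_ge0 => x; rewrite /= in_itv /= => /hf.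
Qed.

Definition halfline (x : R) : set R := `]-oo, x]%classic.

Lemma measurable_halfline x : measurable (halfline x).
Proof. exact: measurable_itv. Qed.

Lemma nu_halfline_itv x : nu (halfline x `&` I) = nu (halfline x).
Proof.
have mh := measurable_halfline x; have mI : measurable I by exact: measurable_itv.
rewrite -[X in _ = nu X](@setUIDK _ (halfline x) I) measureU//.
- rewrite [X in (_ + X)%E](_ : _ = 0%E) ?adde0//.
  apply: (subset_measure0 _ _ _ nuI); [exact: measurableD|exact: measurableC|by move=> t []].
- exact: measurableI.
- exact: measurableD.
- by rewrite setIDA setIAC setDE -setIA setICr setI0.
Qed.

Lemma integrable_indic_itv x : nu.-integrable I (EFin \o \1_(halfline x)).
Proof.
have mI : measurable I by exact: measurable_itv.
apply: measurable_bounded_integrable => //.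
- exact: nu_fin.
- by apply: measurable_funTS; apply: measurable_indic; exact: measurable_halfline.
- exists 1; split => // r r1 t _ /=; rewrite /indic; case: (_ \in _) => /=.
    by rewrite normr1 ltW.
  by rewrite normr0 (le_trans ler01)// ltW.
Qed.

Lemma Rint_halfline x : \int[nu]_(t in I) \1_(halfline x) t = fine (nu (halfline x)).
Proof.
rewrite /Rintegral integral_indic ?nu_halfline_itv//.
exact: measurable_itv.
Qed.

Lemma halfline_cvg x : (fun m => fine (nu (halfline (x + eta R m)))) @ \oo --> fine (nu (halfline x)).
Proof.
have mh y := measurable_halfline y.
have capE : \bigcap_m halfline (x + eta R m) = halfline x.
  apply/seteqP; split => y /=.
    rewrite /halfline /= in_itv /= => h; apply/ler_addgt0Pr => e e0.
    have [m hm] := filter_ex (eta_small e0).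
    have /= := h m Logic.I; rewrite in_itv /= => h'; apply: le_trans h' _.
    by rewrite lerD2l ltW.
  rewrite /halfline /= in_itv /= => yx m _ /=; rewrite in_itv /= (le_trans yx)//.
  by rewrite lerDl ltW// eta_gt0.
have cv : (nu \o (fun m => halfline (x + eta R m))) @ \oo --> nu (halfline x).
  rewrite -capE; apply: nonincreasing_cvg_mu => [|//||].
  - exact: nu_fin.
  - by rewrite capE.
  apply/nonincreasing_seqP => m; apply/subsetPset => y; rewrite /halfline /= !in_itv /=.
  by move=> yx; apply: le_trans yx _; rewrite lerD2l ltW// eta_lt.
by apply: fine_cvg; rewrite fineK ?nu_fin_num.
Qed.

(** On the interval, [stepq] lies between the indicator of the half-line up to [x] and that of the
    half-line up to [x + eta m] plus [eta m]. Continuity of the measure from above closes the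
    gap. *)
Lemma halfline_cdf x : cdf a0 polyint x = fine (nu (halfline x)).
Proof.
have mI : measurable I by exact: measurable_itv.
have cv := cdf_cvg (a0 := a0) polyint_pfun polyint_pos (x := x).
apply/eqP; rewrite eq_le; apply/andP; split; last first.
  apply: (cvgr_to_ge cv); apply: nearW => m.
  rewrite -Rint_halfline polyintE; apply: le_Rintegral => //.
  - exact: integrable_indic_itv.
  - exact: poly_integrable_itv.
  move=> t; rewrite /= in_itv /= => ht; rewrite indicE.
  have [|_] := boolP (t \in _); last by rewrite stepq_ge0.
  by rewrite inE /halfline /= in_itv /=; exact: stepq_ge1.
have cv2 : (fun m => fine (nu (halfline (x + eta R m))) + eta R m * fine (nu I)
   - polyint (stepq a0 x m)) @ \oo --> fine (nu (halfline x)) + 0 * fine (nu I) - cdf a0 polyint x.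
  apply: cvgB cv; apply: cvgD; first exact: halfline_cvg.
  by apply: cvgM; [exact: eta_cvg|exact: cvg_cst].
rewrite mul0r addr0 in cv2; rewrite -subr_ge0; apply: (cvgr_to_ge cv2); apply: nearW => m.
have iC : nu.-integrable I (EFin \o (fun=> eta R m)).
  have := poly_integrable_itv (eta R m)%:P; apply: eq_integrable => //.
  by move=> t _ /=; rewrite hornerC.
rewrite subr_ge0 -Rint_halfline -Rintegral_cst// polyintE -RintegralD//; last first.
  exact: integrable_indic_itv.
apply: le_Rintegral => //.
- exact: poly_integrable_itv.
- have := integrableD mI (integrable_indic_itv (x + eta R m)) iC.
  by apply: eq_integrable.
move=> t; rewrite /= in_itv /= => ht; rewrite indicE.
have [_|] := boolP (t \in _); first exact: stepq_le1.
rewrite notin_setE /halfline /= in_itv /= => /negP; rewrite -ltNge => xt.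
by rewrite add0r stepq_le// ltW.
Qed.

End OneMeasure.

Lemma measurable_halflineE :
  (measurable : set (set R)) = <<s [set A | exists x, A = halfline x] >>.
Proof.
apply/seteqP; split.
  rewrite -[X in X `<=` _]/((@ocitv R).-sigma.-measurable) RGenOInfty.measurableE.
  apply: smallest_sub; first exact: smallest_sigma_algebra.
  move=> _ [x ->].
  have -> : `]x, +oo[%classic = ~` halfline x.
    apply/seteqP; split => y; rewrite /halfline /= !in_itv /= andbT.
      by move=> xy; apply/negP; rewrite -ltNge.
    by move=> /negP; rewrite -ltNge.
  apply: (@measurableC _ (g_sigma_algebraType [set A | exists x, A = halfline x])).
  by apply: sub_sigma_algebra; exists x.
apply: smallest_sub; first exact: sigma_algebra_measurable.
by move=> _ [x ->]; exact: measurable_halfline.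
Qed.

Lemma halfline_measure_unique (mu nu : {measure set R -> \bar R}) :
  (mu setT < +oo)%E -> (forall x, mu (halfline x) = nu (halfline x)) ->
  forall D, measurable D -> mu D = nu D.
Proof.
move=> mufin mn D mD.
apply: (@measure_unique _ _ _ [set A | exists x, A = halfline x] (fun n => halfline n%:R)).
- exact: measurable_halflineE.
- move=> _ _ [x ->] [y ->]; exists (Num.min x y).
  apply/seteqP; split => z; rewrite /halfline /= !in_itv /= le_min.
    by move=> [-> ->].
  by move=> /andP[].
- by move=> i; exists i%:R.
- apply/seteqP; split => // x _; exists (Num.truncn x).+1 => //.
  by rewrite /halfline /= in_itv /= ltW// truncnS_gt.
- by move=> _ [x ->].
- move=> k; apply: le_lt_trans mufin; rewrite le_measure ?inE//; exact: measurable_halfline.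
- by [].
Qed.

(** Bundling the proofs with the functional lets the cumulative-function structure on [pcdf L] be
    inferred from [L]. *)
Record posfun := PosFun {
  posfun_fun :> {poly R} -> R;
  posfun_lin : pfun posfun_fun;
  posfun_pos : forall f, (forall t, 0 <= t <= a -> 0 <= f.[t]) -> 0 <= posfun_fun f }.

Section Existence.
Variable L : posfun.

Definition pcdf : R -> R := cdf a0 L.

HB.instance Definition _ := isCumulative.Build R _ R pcdf
  (@cdf_ndecr _ _ a0 _ (posfun_lin L) (@posfun_pos L))
  (@cdf_right_continuous _ _ a0 _ (posfun_lin L) (@posfun_pos L)).

Definition lsm (D : set R) : \bar R := lebesgue_stieltjes_measure pcdf D.

Let lsm0 : lsm set0 = 0%E. Proof. exact: measure0. Qed.
Let lsm_ge0 D : (0 <= lsm D)%E. Proof. exact: measure_ge0. Qed.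
Let lsm_sigma_additive : semi_sigma_additive lsm.
Proof.
exact: (@measure_semi_sigma_additive _ _ _ (lebesgue_stieltjes_measure pcdf)).
Qed.

HB.instance Definition _ := isMeasure.Build _ _ R lsm lsm0 lsm_ge0 lsm_sigma_additive.

Lemma lsm_oc (x y : R) : x <= y -> lsm `]x, y]%classic = (pcdf y - pcdf x)%:E.
Proof.
move=> xy; rewrite /lsm /lebesgue_stieltjes_measure.
rewrite /measure_extension measurable_mu_extE/=; last exact: is_ocitv.
by rewrite wlength_itv_bnd.
Qed.

Lemma lsm_halfline x : lsm (halfline x) = (pcdf x)%:E.
Proof.
have cupE : \bigcup_(n : nat) `](- n%:R)%R, x]%classic = halfline x :> set R.
  apply/seteqP; split => y; rewrite /halfline /=.
    by move=> [n _] /=; rewrite !in_itv /= => /andP[].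
  rewrite in_itv /= => yx; exists (Num.truncn (- y)).+1 => //=.
  by rewrite in_itv /= yx andbT ltrNl truncnS_gt.
have := @nondecreasing_cvg_mu _ _ _ lsm (fun n : nat => `](- n%:R)%R, x]%classic) _ _ _.
rewrite cupE => h; apply/esym; apply: (@cvg_unique _ (@ereal_hausdorff R) _ _ _ _ _ (h _ _ _)).
- apply: cvg_near_cst; exists (Num.truncn (- x)).+1 => // n /= xn.
  rewrite lsm_oc; last first.
    by rewrite lerNl ltW//; apply: lt_le_trans (truncnS_gt _) _; rewrite ler_nat.
  rewrite {2}/pcdf (cdf_lt0 a0 (posfun_lin L) (@posfun_pos L)) ?subr0//.
  by rewrite oppr_lt0 ltr0n; apply: leq_trans xn.
- by move=> n; exact: measurable_itv.
- exact: measurable_halfline.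
apply/nondecreasing_seqP => n; apply/subsetPset => y; rewrite /= !in_itv /=.
by move=> /andP[h1 ->]; rewrite andbT; apply: le_lt_trans h1; rewrite lerN2 ler_nat.
Qed.

Lemma lsm_setT : lsm setT = (L 1)%:E.
Proof.
have := @nondecreasing_cvg_mu _ _ _ lsm (fun n : nat => halfline n%:R) _ _ _.
have -> : \bigcup_n halfline n%:R = setT :> set R.
  apply/seteqP; split => // x _; exists (Num.truncn x).+1 => //.
  by rewrite /halfline /= in_itv /= ltW// truncnS_gt.
move=> h; apply/esym; apply: (@cvg_unique _ (@ereal_hausdorff R) _ _ _ _ _ (h _ _ _)).
- apply: cvg_near_cst; exists (Num.truncn a).+1 => // n /= an.
  rewrite lsm_halfline /pcdf (cdf_ge a0 (posfun_lin L) (@posfun_pos L))//.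
  by rewrite ltW//; apply: lt_le_trans (truncnS_gt _) _; rewrite ler_nat.
- by move=> n; exact: measurable_halfline.
- exact: measurableT.
apply/nondecreasing_seqP => n; apply/subsetPset => y; rewrite /halfline /= !in_itv /=.
by move=> /le_trans; apply; rewrite ler_nat.
Qed.

Lemma lsm_fin : (lsm setT < +oo)%E.
Proof. by rewrite lsm_setT ltry. Qed.

(** To the left, [pcdf] vanishes at every [x < 0], so an atom at 0 stays inside the interval; to the
    right, [pcdf a] is already the total mass [L 1]. *)
Lemma lsm_itv : lsm (~` I) = 0%E.
Proof.
have mA : measurable (`]-oo, 0[%classic : set R) by exact: measurable_itv.
have mB : measurable (`]a, +oo[%classic : set R) by exact: measurable_itv.
have -> : ~` I = `]-oo, 0[%classic `|` `]a, +oo[%classic.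
  apply/seteqP; split => x /=; rewrite !in_itv /= ?andbT.
    by move=> /negP; rewrite negb_and -!ltNge => /orP[]; [left|right].
  by move=> [x0|xa]; apply/negP; rewrite negb_and -!ltNge ?x0 ?xa ?orbT.
have A0 : lsm `]-oo, 0[%classic = 0%E.
  have := @nondecreasing_cvg_mu _ _ _ lsm (fun m => halfline (- eta R m)) _ _ _.
  have -> : \bigcup_m halfline (- eta R m) = `]-oo, 0[%classic.
    apply/seteqP; split => x; rewrite /halfline /=.
      move=> [m _] /=; rewrite !in_itv /= => /le_lt_trans; apply.
      by rewrite oppr_lt0 eta_gt0.
    rewrite in_itv /= -oppr_gt0 => /eta_small/filter_ex[m hm]; exists m => //=.
    by rewrite in_itv /= lerNr ltW.
  move=> h; apply/esym; apply: (@cvg_unique _ (@ereal_hausdorff R) _ _ _ _ _ (h _ _ _)).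
  - apply: cvg_near_cst; apply: nearW => m.
    rewrite /= lsm_halfline /pcdf (cdf_lt0 a0 (posfun_lin L) (@posfun_pos L))//.
    by rewrite oppr_lt0 eta_gt0.
  - by move=> n; exact: measurable_halfline.
  - exact: measurable_itv.
  apply/nondecreasing_seqP => n; apply/subsetPset => y; rewrite /halfline /= !in_itv /=.
  by move=> /le_trans; apply; rewrite lerN2 ltW// eta_lt.
have B0 : lsm `]a, +oo[%classic = 0%E.
  have : lsm setT = (lsm (halfline a) + lsm `]a, +oo[%classic)%E.
    rewrite -measureU ?measurable_halfline//; last 2 first.
      exact: measurable_halfline.
      apply/seteqP; split => // x; rewrite /halfline /= !in_itv /= andbT => -[h1 h2].
      by move: (le_lt_trans h1 h2); rewrite ltxx.
    congr (lsm _); apply/seteqP; split => // x _; rewrite /halfline /= !in_itv /= andbT.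
    by have [?|?] := lerP x a; [left|right].
  rewrite lsm_setT lsm_halfline {1}/pcdf (cdf_ge a0 (posfun_lin L) (@posfun_pos L) (lexx a)).
  have : (lsm `]a, +oo[%classic <= lsm setT)%E by rewrite le_measure ?inE.
  rewrite lsm_setT; case: (lsm _) => [r|//|//] _ /=.
  by rewrite -EFinD => -[/eqP]; rewrite -subr_eq0 opprD addrA subrr sub0r oppr_eq0 => /eqP ->.
apply/eqP; rewrite eq_le measure_ge0 andbT.
apply: le_trans (measureU2 _ mA mB) _.
by rewrite -[0%E]adde0; apply: leeD; [rewrite -A0|rewrite -B0].
Qed.

(** Integration against [lsm] is a positive functional with the same [cdf] as [L], and [cdf_inj]
    says that this function determines the functional. *)
Lemma lsm_moment q : polyint lsm q = L q.
Proof.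
apply: (@cdf_inj _ _ a0 (polyint lsm) L).
- exact: polyint_pfun lsm_fin lsm_itv.
- exact: posfun_lin.
- exact: polyint_pos lsm_fin lsm_itv.
- exact: posfun_pos.
move=> x; apply: etrans (halfline_cdf lsm_fin lsm_itv x) _.
by have := congr1 (@fine R) (lsm_halfline x).
Qed.

End Existence.
End MeasureMoments.

(** * Linear maps given on monomials; real and imaginary parts of polynomials *)

Section PolySum.
Variables (F : nzRingType) (V : lmodType F) (G : nat -> V).

(** The linear map that sends [X^i] to [G i]. Its instances are [p<T>], the functionals [Lam h], and
    [q(S)]. *)
Definition polysum (p : {poly F}) : V := \sum_(i < size p) p`_i *: G i.

Lemma polysum_widen n (p : {poly F}) : (size p <= n)%N ->
  polysum p = \sum_(i < n) p`_i *: G i.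
Proof.
move=> pn; rewrite /polysum (big_ord_widen n (fun i => p`_i *: G i))//.
rewrite [RHS](bigID (fun i : 'I_n => (i < size p)%N)) /= [X in _ + X]big1 ?addr0//.
by move=> i; rewrite -leqNgt => hi; rewrite nth_default// scale0r.
Qed.

Lemma polysum_lin c (p q : {poly F}) :
  polysum (c *: p + q) = c *: polysum p + polysum q.
Proof.
pose n := maxn (size (c *: p + q)) (maxn (size p) (size q)).
rewrite !(@polysum_widen n) ?leq_max ?leqnn ?orbT//.
rewrite scaler_sumr -big_split /=; apply: eq_bigr => i _.
by rewrite coefD coefZ scalerDl scalerA.
Qed.

Lemma polysumXn n : polysum 'X^n = G n.
Proof.
rewrite /polysum size_polyXn big_ord_recr /= big1 ?add0r; last first.
  by move=> i _; rewrite coefXn ltn_eqF// scale0r.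
by rewrite coefXn eqxx scale1r.
Qed.

Lemma polysum0 : polysum 0 = 0.
Proof. by rewrite /polysum size_poly0 big_ord0. Qed.
Lemma polysumZ c p : polysum (c *: p) = c *: polysum p.
Proof. by have := polysum_lin c p 0; rewrite polysum0 !addr0. Qed.
Lemma polysumD p q : polysum (p + q) = polysum p + polysum q.
Proof. by have := polysum_lin 1 p q; rewrite !scale1r. Qed.
Lemma polysumB p q : polysum (p - q) = polysum p - polysum q.
Proof. by rewrite polysumD -[- q]scaleN1r polysumZ scaleN1r. Qed.

End PolySum.

Lemma pfun_ext (R : realType) (L J : {poly R} -> R) : pfun L -> pfun J ->
  (forall n, L 'X^n = J 'X^n) -> forall q, L q = J q.
Proof.
move=> hL hJ h q; rewrite (pfun_coef hL) (pfun_coef hJ).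
by apply: eq_bigr => i _; rewrite h.
Qed.

Section ComplexPoly.
Variable R : realType.
Local Notation C := R[i].

Definition cpoly (p : {poly R}) : {poly C} := map_poly (real_complex R) p.
Definition repoly (q : {poly C}) : {poly R} := \poly_(i < size q) complex.Re q`_i.
Definition impoly (q : {poly C}) : {poly R} := \poly_(i < size q) complex.Im q`_i.

Lemma coef_cpoly p i : (cpoly p)`_i = (p`_i)%:C.
Proof. exact: coef_map. Qed.

Lemma coef_repoly q i : (repoly q)`_i = complex.Re q`_i.
Proof. by rewrite coef_poly; case: ltnP => // h; rewrite nth_default. Qed.

Lemma coef_impoly q i : (impoly q)`_i = complex.Im q`_i.
Proof. by rewrite coef_poly; case: ltnP => // h; rewrite nth_default. Qed.

Lemma cpoly_ReIm q : q = cpoly (repoly q) + 'i%C *: cpoly (impoly q).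
Proof.
apply/polyP => i; rewrite coefD coefZ !coef_cpoly coef_repoly coef_impoly.
exact: complexE.
Qed.

Lemma horner_cpoly p (x : R) : (cpoly p).[x%:C] = p.[x]%:C.
Proof. exact: horner_map. Qed.

Lemma Re_horner q (x : R) : complex.Re q.[x%:C] = (repoly q).[x].
Proof.
rewrite {1}(cpoly_ReIm q) hornerD hornerZ !horner_cpoly ReD ReM /=.
by rewrite mul0r mul1r subr0 addr0.
Qed.

Lemma Im_horner q (x : R) : complex.Im q.[x%:C] = (impoly q).[x].
Proof.
rewrite {1}(cpoly_ReIm q) hornerD hornerZ !horner_cpoly ImD ImM /=.
by rewrite mul0r mul1r !add0r.
Qed.

End ComplexPoly.

(** * The functionals attached to an operator *)

Section Bracket.
Variables (R : realType) (H : hilbertType R[i]) (T : 'B(H)).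
Local Notation C := R[i].

Lemma adj_pow n x y : '[(T^adj ^+ n) x, y] = '[x, (T ^+ n) y].
Proof.
elim: n x y => [|n IH] x y; first by rewrite !expr0.
by rewrite exprS exprSr !bopE adjointPr IH.
Qed.

Definition gram (n : nat) : 'B(H) := T^adj ^+ n * T ^+ n.

Lemma inner_gram n h k : '[gram n h, k] = '[(T ^+ n) h, (T ^+ n) k].
Proof. by rewrite /gram bopE adj_pow. Qed.

Lemma poly_bracketE p : poly_bracket p T = polysum gram p.
Proof. by []. Qed.

(** The operator behind the functionals [L_h]: for real [q] its quadratic form at [h] is [L_h q]
    ([inner_Aop]). *)
Definition Aop (q : {poly C}) : 'B(H) := poly_bracket (('X - 1) ^+ 2 * q) T.

Lemma Aop_lin c p q : Aop (c *: p + q) = c *: Aop p + Aop q.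
Proof. by rewrite /Aop mulrDr -scalerAr !poly_bracketE polysum_lin. Qed.

Lemma sqrX1_Xn (F : comNzRingType) n :
  ('X - 1) ^+ 2 * 'X^n = 'X^(n.+2) - 2 *: 'X^(n.+1) + 'X^n :> {poly F}.
Proof. by rewrite !exprS expr0 scaler_nat; ring. Qed.

Lemma Aop_Xn n : Aop 'X^n = T^adj ^+ n * B2 T * T ^+ n.
Proof.
rewrite /Aop sqrX1_Xn poly_bracketE polysumD polysumB polysumZ !polysumXn.
rewrite /B2 !mulrDr !mulrDl mulr1 mulrN mulNr.
have E m : T^adj ^+ n * (T^adj ^+ m * T ^+ m) * T ^+ n = gram (m + n).
  by rewrite !mulrA -exprD -mulrA -exprD addnC.
have E1 := E 1%N; rewrite !expr1 in E1.
rewrite [(T^adj * T) *+ 2]mulr2n mulrDr mulrDl E1 (E 2%N) scaler_nat mulr2n.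
by rewrite [LHS]addrC addrA addrAC.
Qed.

Definition Lam (h : H) : {poly R} -> R := polysum (fun n => n2 ((T ^+ n) h) : R^o).

Lemma Lam_pfun h : pfun (Lam h).
Proof. by split=> c p q; exact: polysum_lin. Qed.

Lemma LamXn h n : Lam h 'X^n = n2 ((T ^+ n) h).
Proof. exact: polysumXn. Qed.

Definition Lop (h : H) (q : {poly R}) : R := Lam h (('X - 1) ^+ 2 * q).

Lemma Lop_pfun h : pfun (Lop h).
Proof.
by split=> c p q; rewrite /Lop mulrDr -scalerAr (pfun_lin (Lam_pfun h)).
Qed.

Lemma LopXn h n : Lop h 'X^n =
  n2 ((T ^+ n.+2) h) - 2 * n2 ((T ^+ n.+1) h) + n2 ((T ^+ n) h).
Proof.
have hL := Lam_pfun h.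
by rewrite /Lop sqrX1_Xn (pfunD hL) (pfunB hL) (pfunZ hL) !LamXn.
Qed.

Lemma LopX h q : Lop h ('X * q) = Lop (T h) q.
Proof.
have h1 : pfun (fun q => Lop h ('X * q)).
  by split=> c p r; rewrite mulrDr -scalerAr (pfun_lin (Lop_pfun h)).
apply: (pfun_ext h1 (Lop_pfun _)) => n.
by rewrite -exprS !LopXn !exprSr !bopE.
Qed.

Lemma inner_bracket p h : '[poly_bracket (cpoly p) T h, h] = (Lam h p)%:C.
Proof.
have sz : size (cpoly p) = size p by rewrite size_map_poly.
rewrite poly_bracketE /polysum sz bop_sumE inner_suml /Lam /polysum rmorph_sum /=.
apply: eq_bigr => i _.
transitivity ((cpoly p)`_i * '[gram i h, h]); first by rewrite -innerZl.
by rewrite inner_gram innerE coef_cpoly -rmorphM.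
Qed.

Lemma inner_Aop q h : '[Aop (cpoly q) h, h] = (Lop h q)%:C.
Proof.
rewrite -inner_bracket /Aop; congr '[poly_bracket _ _ _, _].
by rewrite /cpoly rmorphM rmorphXn rmorphB /= map_polyX rmorph1.
Qed.

Lemma inner_AopC q h : '[Aop q h, h] = Lop h (repoly q) +i* Lop h (impoly q).
Proof.
rewrite {1}(cpoly_ReIm q) addrC Aop_lin bopDE bopZE innerDl innerZl !inner_Aop.
by apply: cplxP; rewrite ?ReD ?ReM ?ImD ?ImM /= ?mul0r ?mul1r ?mulr0 ?addr0 ?add0r ?subr0 ?sub0r ?oppr0 ?add0r.
Qed.

Lemma double_sum_poly h n (p q : {poly R}) : (size p <= n)%N -> (size q <= n)%N ->
  \sum_(i < n) \sum_(j < n) n2 ((T ^+ (i + j)) h) * (p`_i * q`_j) = Lam h (p * q).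
Proof.
move=> pn qn; have hL := Lam_pfun h.
have E (r : {poly R}) : (size r <= n)%N -> r = \sum_(i < n) r`_i *: 'X^i.
  move=> rn; rewrite -[LHS](coefK r) poly_def (big_ord_widen n (fun i => r`_i *: 'X^i))//.
  rewrite [RHS](bigID (fun i : 'I_n => (i < size r)%N)) /= [X in _ + X]big1 ?addr0//.
  by move=> i; rewrite -leqNgt => hi; rewrite nth_default// scale0r.
rewrite [in RHS](E p)// [in RHS](E q)// mulr_suml (pfun_sum hL); apply: eq_bigr => i _.
rewrite mulr_sumr (pfun_sum hL); apply: eq_bigr => j _.
have -> : p`_i *: 'X^i * (q`_j *: 'X^j) = (p`_i * q`_j) *: 'X^(i + j).
  by rewrite -scalerAl -scalerAr scalerA exprD.
by rewrite (pfunZ hL) LamXn mulrC.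
Qed.

Lemma cpd_opP : cpd_op T <-> forall h u, 0 <= Lop h (u ^+ 2).
Proof.
have gE h n : complex.Re (`|(T ^+ n) h| ^+ 2) = n2 ((T ^+ n) h) by rewrite norm_n2.
split=> [hT h u|hL h k l l0].
  (* Using [n.+1] coefficients fits the format of [cpd_seq] even when [p = 0]; the last one is 0. *)
  pose p := ('X - 1) * u; pose n := size p.
  have p1 : \sum_(i < n.+1) (p`_i)%:C = 0 :> C.
    rewrite -rmorph_sum /=; apply/eqP; rewrite eq_complex /= eqxx andbT; apply/eqP.
    have := @horner_coef_wide _ n.+1 p 1 (leqnSn _).
    rewrite hornerM hornerD hornerN hornerX hornerC subrr mul0r => e; rewrite [RHS]e.
    by apply: eq_bigr => i _; rewrite expr1n mulr1.
  have := hT h n (fun i => (p`_i)%:C) p1.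
  have -> : \sum_(i < n.+1) \sum_(j < n.+1) (complex.Re (`|(T ^+ (i + j)) h| ^+ 2))%:C
      * (p`_i)%:C * ((p`_j)%:C)^*%R = (Lop h (u ^+ 2))%:C.
    rewrite /Lop -exprMn expr2 -(@double_sum_poly h n.+1) ?leqnSn// rmorph_sum /=.
    apply: eq_bigr => i _; rewrite rmorph_sum /=; apply: eq_bigr => j _.
    by rewrite gE conjR -mulrA -!rmorphM.
  by rewrite ler0c.
(* The real and imaginary parts of [l] both sum to 0, so both polynomials are multiples of [X - 1].
   The mixed terms cancel because [pa * pb = pb * pa]. *)
pose pa : {poly R} := \poly_(i < k.+1) complex.Re (l (inord i)).
pose pb : {poly R} := \poly_(i < k.+1) complex.Im (l (inord i)).
have ca (i : 'I_k.+1) : pa`_i = complex.Re (l i) by rewrite coef_poly ltn_ord inord_val.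
have cb (i : 'I_k.+1) : pb`_i = complex.Im (l i) by rewrite coef_poly ltn_ord inord_val.
have sa : (size pa <= k.+1)%N by exact: size_poly.
have sb : (size pb <= k.+1)%N by exact: size_poly.
have fact (p : {poly R}) : p.[1] = 0 -> exists u, p = ('X - 1) * u.
  by move=> /eqP/factor_theorem[u ->]; exists u; rewrite mulrC.
have [u pu] : exists u, pa = ('X - 1) * u.
  apply: fact; rewrite (horner_coef_wide _ sa).
  under eq_bigr do rewrite expr1n mulr1 ca.
  by rewrite -raddf_sum l0.
have [v pv] : exists u, pb = ('X - 1) * u.
  apply: fact; rewrite (horner_coef_wide _ sb).
  under eq_bigr do rewrite expr1n mulr1 cb.
  by rewrite -raddf_sum l0.
have E : \sum_(i < k.+1) \sum_(j < k.+1) (complex.Re (`|(T ^+ (i + j)) h| ^+ 2))%:C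
      * l i * (l j)^*%R =
   (Lam h (pa * pa) + Lam h (pb * pb))%:C + 'i%C * (Lam h (pb * pa) - Lam h (pa * pb))%:C.
  rewrite -!(@double_sum_poly h k.+1)// -big_split /= -sumrB.
  rewrite !rmorph_sum /= mulr_sumr -big_split /=; apply: eq_bigr => i _.
  rewrite -big_split /= -sumrB !rmorph_sum /= mulr_sumr -big_split /=.
  apply: eq_bigr => j _; rewrite gE !ca !cb.
  move: (n2 _) (l i) (l j) => g [x y] [x' y'].
  by apply: cplxP; rewrite ?(ReD, ImD, ReM, ImM, Re_conj, Im_conj) /=; ring.
rewrite E [pb * pa]mulrC subrr mulr0 addr0 ler0c addr_ge0//.
  by rewrite pu -expr2 exprMn; exact: hL.
by rewrite pv -expr2 exprMn; exact: hL.
Qed.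

End Bracket.

(** * The semispectral measure of a CPD operator *)

Section Growth.
Variables (R : realType) (H : hilbertType R[i]) (T : 'B(H)).
Local Notation C := R[i].

Definition opc : R := projT1 (cid (bop_bound T)).

Lemma opc_gt0 : 0 < opc.
Proof. by rewrite /opc; case: (cid _) => c []. Qed.

Lemma n2_op h : n2 (T h) <= opc ^+ 2 * n2 h.
Proof. by rewrite /opc; case: (cid _) => c [] /=. Qed.

Lemma n2_pow n h : n2 ((T ^+ n) h) <= (opc ^+ 2) ^+ n * n2 h.
Proof.
elim: n => [|n IH]; first by rewrite expr0 mul1r.
rewrite [T ^+ n.+1]exprS bopE; apply: le_trans (n2_op _) _.
by rewrite [(opc ^+ 2) ^+ n.+1]exprS -mulrA ler_wpM2l// sqr_ge0.
Qed.

(** From the second difference in [LopXn]: the middle term is negative and dropped, and the outer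
    terms contribute 1 and [opc ^+ 4]. *)
Definition growthc : R := 1 + (opc ^+ 2) ^+ 2.

Lemma growthc_ge0 : 0 <= growthc.
Proof. by rewrite addr_ge0// sqr_ge0. Qed.

Lemma Lop_growth n h : Lop T h 'X^n <= growthc * n2 h * (opc ^+ 2) ^+ n.
Proof.
rewrite LopXn; have h1 := n2_pow n h; have h2 := n2_pow n.+2 h.
have h3 := n2_ge0 ((T ^+ n.+1) h).
have -> : growthc * n2 h * (opc ^+ 2) ^+ n =
    (opc ^+ 2) ^+ n * n2 h + (opc ^+ 2) ^+ n.+2 * n2 h.
  by rewrite /growthc -[n.+2]addn2 exprD; ring.
lra.
Qed.

(** Strictly above [opc ^+ 2], so that [rad ^+ n] outgrows the moments and a representing measure
    has no mass beyond [rad]. *)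
Definition rad : R := opc ^+ 2 + 1.

Lemma rad_gt0 : 0 < rad.
Proof. by rewrite ltr_wpDl// sqr_ge0. Qed.

Lemma opc_rad : opc ^+ 2 < rad.
Proof. by rewrite ltrDl. Qed.

Hypothesis hT : cpd_op T.

Lemma Lop_itv_ge0 h f : (forall t, 0 <= t <= rad -> 0 <= f.[t]) -> 0 <= Lop T h f.
Proof.
apply: (pfun_itv_ge0 rad_gt0 (Lop_pfun T h)).
have gr n : Lop T h 'X^n <= growthc * n2 h * rad ^+ n.
  apply: le_trans (Lop_growth n h) _.
  rewrite ler_wpM2l ?mulr_ge0 ?growthc_ge0 ?n2_ge0//.
  by rewrite lerXn2r ?nnegrE ?sqr_ge0 ?(ltW rad_gt0) ?(ltW opc_rad).
apply: (pfun_growth_pos rad_gt0 (Lop_pfun T h) _ _ gr) => r.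
  exact: (cpd_opP T).1.
by rewrite LopX; exact: (cpd_opP T).1.
Qed.

Definition Lpos h : posfun rad := PosFun (Lop_pfun T h) (@Lop_itv_ge0 h).

Definition mu h := lsm rad_gt0 (Lpos h).

Definition muv h (D : set R) : R := fine (mu h D).

Lemma mu_fin_num h D : measurable D -> mu h D \is a fin_num.
Proof. by apply: nu_fin_num; exact: lsm_fin. Qed.

Lemma muvE h D : measurable D -> mu h D = (muv h D)%:E.
Proof. by move=> mD; rewrite /muv fineK// mu_fin_num. Qed.

Lemma muv_ge0 h D : 0 <= muv h D.
Proof. by rewrite /muv fine_ge0. Qed.

Lemma muv_setT h : muv h setT = Lop T h 1.
Proof. by rewrite /muv /mu lsm_setT. Qed.

Lemma muv_le h D E : measurable D -> measurable E -> D `<=` E -> muv h D <= muv h E.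
Proof.
move=> mD mE DE; rewrite /muv fine_le ?mu_fin_num//.
by rewrite le_measure ?inE.
Qed.

Lemma Lop1_le h : Lop T h 1 <= growthc * n2 h.
Proof. by have := Lop_growth 0 h; rewrite !expr0 mulr1. Qed.

Lemma muvC h D : measurable D -> muv h (~` D) = Lop T h 1 - muv h D.
Proof.
move=> mD; have mC := measurableC mD.
rewrite -muv_setT; apply/eqP; rewrite eq_sym subr_eq; apply/eqP/EFin_inj.
rewrite EFinD -!muvE// -measureU//; last by rewrite setICl.
by rewrite setUC setUv.
Qed.

Lemma muv_bigcup h (F : nat -> set R) : (forall n, measurable (F n)) ->
  trivIset setT F ->
  (fun n => \sum_(0 <= i < n) muv h (F i)) @ \oo --> muv h (\bigcup_n F n).
Proof.
move=> mF tF; have mU : measurable (\bigcup_n F n) by exact: bigcupT_measurable.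
have : (fun n => (\sum_(0 <= i < n) mu h (F i))%E) @ \oo --> (muv h (\bigcup_n F n))%:E.
  by rewrite -muvE//; exact: (@measure_semi_sigma_additive _ _ _ (mu h) F mF tF mU).
move=> /fine_cvg; apply: cvg_trans; apply: near_eq_cvg; apply: nearW => n /=.
rewrite (eq_bigr (fun i => (muv h (F i))%:E)); last by move=> i _; exact: muvE.
by rewrite sumEFin.
Qed.

Definition has_qform (D : set R) :=
  exists A : 'B(H), forall h, '[A h, h] = (muv h D)%:C.

Lemma has_qform_setT : has_qform setT.
Proof.
exists (Aop T (cpoly 1)) => h; by rewrite inner_Aop muv_setT.
Qed.

Lemma has_qform_halfline x : has_qform (halfline x).
Proof.
pose B m := Aop T (cpoly (stepq rad_gt0 x m)).
have cvB h : (fun m => '[B m h, h] : C^o) @ \oo --> ((muv h (halfline x))%:C : C^o).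
  rewrite /muv /mu lsm_halfline /=; apply: cvg_ReIm.
    under eq_fun do rewrite inner_Aop /=.
    exact: (cdf_cvg (posfun_lin (Lpos h)) (@posfun_pos _ _ (Lpos h))).
  under eq_fun do rewrite inner_Aop /=.
  exact: cvg_cst.
(* On the interval [stepq] is at most [1 + eta m <= 2], whence the factor 2. *)
have [|||A hA] := @weak_limit R H B (2 * growthc).
- by rewrite mulr_ge0// growthc_ge0.
- move=> m h; rewrite /B inner_Aop ler0c /=; split.
    by apply: Lop_itv_ge0 => t; exact: stepq_ge0.
  have h1 := Lop1_le h.
  have h2 : Lop T h (stepq rad_gt0 x m) <= Lop T h (2 *: 1).
    apply: (pfun_le (posfun_lin (Lpos h)) (@posfun_pos _ _ (Lpos h))) => t ht.
    rewrite hornerZ hornerC mulr1; apply: le_trans (stepq_le1 rad_gt0 x m ht) _.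
    by rewrite -[2]/(1 + 1) lerD2l invf_le1// ler1n.
  rewrite (pfunZ (Lop_pfun T h)) in h2; lra.
- by move=> h; apply/cvg_ex; exists ((muv h (halfline x))%:C : C^o); exact: cvB.
by exists A => h; exact: cvgC_unique (hA h) (cvB h).
Qed.

Lemma has_qformC D : measurable D -> has_qform D -> has_qform (~` D).
Proof.
move=> mD [A hA]; have [B hB] := has_qform_setT.
exists (B - A) => h.
by rewrite bopDE bopNE innerBl hA hB muvC// muv_setT rmorphB.
Qed.

Lemma has_qform_bigcup (F : nat -> set R) : (forall n, measurable (F n)) ->
  trivIset setT F -> (forall n, has_qform (F n)) -> has_qform (\bigcup_n F n).
Proof.
move=> mF tF /choice[A hA]; pose B n := \sum_(0 <= i < n) A i.
have BE n h : '[B n h, h] = (\sum_(0 <= i < n) muv h (F i))%:C.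
  rewrite /B bop_sumE inner_suml rmorph_sum /=.
  by apply: eq_bigr => i _; rewrite hA.
have cvB h : (fun n => '[B n h, h] : C^o) @ \oo --> ((muv h (\bigcup_n F n))%:C : C^o).
  apply: cvg_ReIm; under eq_fun do rewrite BE /=; first exact: muv_bigcup.
  exact: cvg_cst.
have mU : measurable (\bigcup_n F n) by exact: bigcupT_measurable.
have [|||L hL] := @weak_limit R H B growthc.
- exact: growthc_ge0.
- move=> n h; rewrite BE ler0c /=; split.
    by apply: sumr_ge0 => i _; exact: muv_ge0.
  apply: le_trans (Lop1_le h); rewrite -muv_setT.
  apply: le_trans (muv_le h mU measurableT _) => //.
  have ndS : nondecreasing_seq (fun n => \sum_(0 <= i < n) muv h (F i)).
    by apply/nondecreasing_seqP => m; rewrite big_nat_recr//= lerDl muv_ge0.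
  have cS := muv_bigcup (h := h) mF tF.
  have := nondecreasing_cvgn_le ndS (cvgP _ cS) n.
  by rewrite (cvg_lim (@Rhausdorff R) cS).
- by move=> h; apply/cvg_ex; exists ((muv h (\bigcup_n F n))%:C : C^o); exact: cvB.
by exists L => h; exact: cvgC_unique (hL h) (cvB h).
Qed.

Lemma has_qform_measurable D : measurable D -> has_qform D.
Proof.
rewrite measurable_halflineE => mD.
apply: (@dynkin_induction _ _ [set A | exists x, A = halfline x]) mD.
- exact: measurable_halflineE.
- move=> _ _ [x ->] [y ->]; exists (Num.min x y).
  apply/seteqP; split => z; rewrite /halfline /= !in_itv /= le_min.
    by move=> [-> ->].
  by move=> /andP[].
- exact: has_qform_setT.
- by move=> _ [x ->]; exact: has_qform_halfline.
- exact: has_qformC.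
- exact: has_qform_bigcup.
Qed.

Definition spec_fun (D : set R) : 'B(H) :=
  xget 0 [set A : 'B(H) | forall h, '[A h, h] = (muv h D)%:C].

Lemma spec_funE D h : measurable D -> '[spec_fun D h, h] = (muv h D)%:C.
Proof.
move=> /has_qform_measurable hD.
exact: (@xgetPex _ 0 [set A : 'B(H) | forall h, '[A h, h] = (muv h D)%:C] hD h).
Qed.

Lemma spec_fun_ge0 D : borelRplus D -> bop_ge0 (spec_fun D).
Proof. by move=> [mD _] h; rewrite spec_funE// ler0c muv_ge0. Qed.

(** On the diagonal this is additivity of [mu h]; polarization of the partial sums gives the
    off-diagonal values. *)
Lemma spec_fun_sigma_additive (F : nat -> set R) : (forall n, borelRplus (F n)) ->
  trivIset setT F -> forall h k,
  (fun n => \sum_(0 <= i < n) '[spec_fun (F i) h, k] : C^o) @ \oo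
    --> ('[spec_fun (\bigcup_n F n) h, k] : C^o).
Proof.
move=> bF tF h k; have mF n : measurable (F n) by case: (bF n).
pose S n := \sum_(0 <= i < n) spec_fun (F i).
have SE n x y : \sum_(0 <= i < n) '[spec_fun (F i) x, y] = '[S n x, y].
  by rewrite /S bop_sumE inner_suml.
have cS x : (fun n => '[S n x, x] : C^o) @ \oo --> ('[spec_fun (\bigcup_n F n) x, x] : C^o).
  rewrite spec_funE; last exact: bigcupT_measurable.
  have E n : '[S n x, x] = (\sum_(0 <= i < n) muv x (F i))%:C.
    rewrite -SE rmorph_sum /=; apply: eq_bigr => i _; exact: spec_funE.
  apply: cvg_ReIm; under eq_fun do rewrite E /=; first exact: muv_bigcup.
  exact: cvg_cst.
rewrite (funext (fun n => SE n h k)) (funext (fun n => bop_polarization (S n) h k)).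
rewrite bop_polarization.
have := @cvg_polarization C 4^-1 'i _ _ _ _ _ _ _ _ (cS (h + k)) (cS (h - k))
  (cS (h + 'i *: k)) (cS (h - 'i *: k)).
by apply.
Qed.

Definition spec_measure : semispectral H :=
  Semispectral spec_fun_ge0 spec_fun_sigma_additive.

Lemma scalar_specE h D : measurable D -> scalar_measure spec_measure h D = mu h D.
Proof.
move=> mD; have mR := @measurable_Rplus R.
have mDR : measurable (D `&` @Rplus R) by exact: measurableI.
rewrite scalar_measureE// spec_funE//= -muvE//.
have m0 : mu h (D `\` @Rplus R) = 0%E.
  apply: (subset_measure0 _ _ _ (lsm_itv rad_gt0 (Lpos h))).
  - exact: measurableD.
  - exact: measurableC (measurable_itv _).
  by move=> x [_ nx]; apply: contra_not nx => /sub_itv_Rplus.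
have E : mu h ((D `&` @Rplus R) `|` (D `\` @Rplus R)) =
    (mu h (D `&` @Rplus R) + mu h (D `\` @Rplus R))%E.
  apply: (@measureU _ _ _ (mu h)) => //; first exact: measurableD.
  by rewrite setIDA setIAC setDE -setIA setICr setI0.
by rewrite setUIDK m0 adde0 in E.
Qed.

End Growth.

Lemma poly_taylor1 (F : fieldType) (p : {poly F}) :
  p = p.[1]%:P + p^`().[1] *: ('X - 1) +
    ('X - 1) ^+ 2 * ((p - p.[1]%:P - p^`().[1] *: ('X - 1)) %/ ('X - 1) ^+ 2).
Proof.
set r := p - p.[1]%:P - p^`().[1] *: ('X - 1).
have d1 : ('X - 1 : {poly F})^`() = 1 by rewrite derivB derivX -polyC1 derivC subr0.
have r1 : r.[1] = 0.
  by rewrite /r !(hornerD, hornerN, hornerZ) hornerX !hornerC !subrr mulr0 subr0.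
have [u ru] : exists u, r = u * ('X - 1) by move/eqP/factor_theorem: r1.
have u1 : u.[1] = 0.
  have : (r^`()).[1] = 0.
    rewrite /r !derivB derivZ d1 derivC subr0.
    by rewrite hornerD hornerN hornerZ hornerC mulr1 subrr.
  rewrite ru derivM d1 mulr1 hornerD hornerM.
  by rewrite hornerD hornerN hornerX hornerC subrr mulr0 add0r.
have [v uv] : exists v, u = v * ('X - 1) by move/eqP/factor_theorem: u1.
have nz : ('X - 1) ^+ 2 != 0 :> {poly F}.
  by rewrite expf_eq0 /= -polyC1 polyXsubC_eq0.
have -> : r %/ ('X - 1) ^+ 2 = v by rewrite ru uv -mulrA -expr2 mulpK.
rewrite [_ ^+ 2 * v]mulrC expr2 mulrA -uv -ru /r.
by rewrite -[X in _ + X]addrA -opprD [RHS]addrC subrK.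
Qed.

Lemma double_root1 (F : fieldType) (q : {poly F}) :
  let p := ('X - 1) ^+ 2 * q in
  [/\ p.[1] = 0, p^`().[1] = 0 &
    (p - p.[1]%:P - p^`().[1] *: ('X - 1)) %/ ('X - 1) ^+ 2 = q].
Proof.
have pE : ('X - 1) ^+ 2 * q = ('X - 1) * (('X - 1) * q) by rewrite expr2 -mulrA.
have p1 : (('X - 1) ^+ 2 * q).[1] = 0.
  by rewrite pE hornerM hornerD hornerN hornerX hornerC subrr mul0r.
have p'1 : (('X - 1) ^+ 2 * q)^`().[1] = 0.
  rewrite pE derivM hornerD !hornerM hornerD hornerN hornerX hornerC subrr.
  by rewrite !mul0r mulr0 addr0.
split=> //; rewrite p1 p'1 scale0r !subr0 mulKp//.
by rewrite expf_eq0 /= -polyC1 polyXsubC_eq0.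
Qed.

(** * Representing measures: equivalence of the conditions, uniqueness, support *)

Section Representing.
Variables (R : realType) (H : hilbertType R[i]) (T : 'B(H)).
Local Notation C := R[i].
Local Notation I := (`[0, rad T]%classic : set R).
Local Notation Rplus := (@Rplus R).
Implicit Types M N : semispectral H.

Lemma scalar_measure_fin M h : (scalar_measure M h setT < +oo)%E.
Proof. by rewrite scalar_measureE// ltry. Qed.

(** The hub of the measure part: each of [cond_ii], [cond_iii] and [cond_repr] leads to it, and from
    it follow [cond_ii], the CPD property, uniqueness and compact support. *)
Definition represents M := forall h, scalar_measure M h (~` I) = 0%E /\
  forall q, polyint (scalar_measure M h) q = Lop T h q.

Lemma spec_measure_represents (hT : cpd_op T) : represents (spec_measure hT).
Proof.
move=> h; split=> [|q].
  rewrite scalar_specE; first exact: lsm_itv.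
  exact: measurableC (measurable_itv _).
rewrite -[RHS](lsm_moment (rad_gt0 T) (Lpos hT h)) /polyint /Rintegral; congr fine.
by apply: eq_measure_integral => A mA _; exact: scalar_specE.
Qed.

Lemma represents_ii M : represents M -> cond_ii T M.
Proof.
move=> hM q; have ReE : (fun x : R => complex.Re q.[x%:C]) = horner (repoly q).
  by apply/funext => x; exact: Re_horner.
have ImE : (fun x : R => complex.Im q.[x%:C]) = horner (impoly q).
  by apply/funext => x; exact: Im_horner.
split=> h; have [null mom] := hM h; rewrite ReE ImE.
  by split; exact: (poly_integrable (scalar_measure_fin M h) null).
by rewrite -[poly_bracket _ _]/(Aop T q) inner_AopC -!mom.
Qed.

Lemma cond_ii_iii M : cond_ii T M -> cond_iii T M.
Proof.
move=> hM n; have := hM 'X^n; rewrite -[poly_bracket _ _]/(Aop T 'X^n) Aop_Xn.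
by under eq_fun do rewrite hornerXn -rmorphXn.
Qed.

Lemma D12_mul (p : {poly C}) : p = p.[1]%:P + p^`().[1] *: ('X - 1) +
  ('X - 1) ^+ 2 * D12 p.
Proof. exact: poly_taylor1. Qed.

(** Apply the bracket to the expansion [D12_mul] at 1: it maps 1 to [I] and [X - 1] to [- B1 T]. *)
Lemma poly_bracket_B1 (p : {poly C}) :
  poly_bracket p T = p.[1] *: (1 : 'B(H)) - p^`().[1] *: B1 T + Aop T (D12 p).
Proof.
rewrite {1}[p]D12_mul /Aop !poly_bracketE !polysumD polysumZ polysumB.
have g0 : polysum (gram T) 1 = 1.
  by rewrite -(expr0 'X) polysumXn /gram !expr0 mulr1.
have g1 : polysum (gram T) 'X = T^adj * T.
  by rewrite -['X]expr1 polysumXn /gram !expr1.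
by rewrite -alg_polyC polysumZ g0 g1 /B1 -scalerN opprB.
Qed.

Lemma cond_ii_repr M : cond_ii T M -> cond_repr T M.
Proof.
move=> hM p; exists (Aop T (D12 p)); split; first exact: hM.
exact: poly_bracket_B1.
Qed.

(** Test with [(X - 1)^2 X^n]: it has a double root at 1, so both boundary terms vanish and [D12]
    returns [X^n]. *)
Lemma cond_repr_iii M : cond_repr T M -> cond_iii T M.
Proof.
move=> hM n; have [p1 p'1 Dp] := double_root1 ('X^n : {poly C}).
have [A [hA hp]] := hM (('X - 1) ^+ 2 * 'X^n).
have zero_lin (x y B : 'B(H)) : (0 : C) *: x - (0 : C) *: y + B = B.
  by rewrite !scale0r subr0 add0r.
have AE : T^adj ^+ n * B2 T * T ^+ n = A.
  by rewrite -Aop_Xn; apply: etrans hp _; rewrite p1 p'1 zero_lin.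
have DE : @D12 R (('X - 1) ^+ 2 * 'X^n) = 'X^n by rewrite /D12 Dp.
by rewrite AE; move: hA; rewrite DE; under eq_fun do rewrite hornerXn -rmorphXn.
Qed.

Lemma indic_integrable M h D A : measurable D -> measurable A ->
  (scalar_measure M h).-integrable D (EFin \o \1_A).
Proof.
move=> mD mA; apply: measurable_bounded_integrable => //.
- by apply: nu_fin => //; exact: scalar_measure_fin.
- exists 1; split => // r r1 t _ /=; rewrite indicE; case: (_ \in _) => /=.
    by rewrite normr1 ltW.
  by rewrite normr0 (le_trans ler01)// ltW.
Qed.

Lemma cond_iii_moment M h n : cond_iii T M ->
  (scalar_measure M h).-integrable Rplus (EFin \o (fun x => x ^+ n)) /\
  \int[scalar_measure M h]_(x in Rplus) (x ^+ n) = Lop T h 'X^n.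
Proof.
move=> hM; have [/(_ h) [int _] /(_ h) e] := hM n; split; first exact: int.
move: e; rewrite -Aop_Xn.
have -> : 'X^n = cpoly 'X^n :> {poly C} by rewrite /cpoly map_polyXn.
by rewrite inner_Aop => /(congr1 (@complex.Re R)) /= ->.
Qed.

(** Markov's inequality on the half-line beyond [rad T]: [rad T ^+ n] times its mass is at most the
    [n]-th moment, which is of order [(opc T ^+ 2) ^+ n]. For all [n] at once this forces mass 0. *)
Lemma cond_iii_null M h : cond_iii T M -> scalar_measure M h (~` I) = 0%E.
Proof.
move=> hM; set nu := scalar_measure M h.
have mR := @measurable_Rplus R.
pose A : set R := `]rad T, +oo[%classic.
have mA : measurable A by exact: measurable_itv.
have nuR : nu (~` Rplus) = 0%E.
  rewrite /nu scalar_measureE; last exact: measurableC.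
  by rewrite setICl spectral_val0.
pose r := fine (nu A).
have nuAE : nu A = r%:E.
  by rewrite /r fineK// (nu_fin_num (scalar_measure_fin M h)).
have r0 : 0 <= r by rewrite /r fine_ge0.
have AR : A `<=` Rplus.
  move=> x; rewrite /A /= /Defs.Rplus /= !in_itv /= !andbT => /ltW; apply: le_trans.
  by rewrite ltW// rad_gt0.
have bnd n : rad T ^+ n * r <= growthc T * n2 h * (opc T ^+ 2) ^+ n.
  apply: le_trans (Lop_growth T n h).
  have [int <-] := cond_iii_moment h n hM.
  have -> : r = \int[nu]_(x in Rplus) \1_A x.
    by rewrite /Rintegral integral_indic//= setIidl.
  rewrite -RintegralZl//; last exact: indic_integrable.
  apply: le_Rintegral => //.
    have := @integrableZl _ _ _ nu _ mR (rad T ^+ n) _ (indic_integrable M h mR mA).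
    by apply: eq_integrable.
  move=> x; rewrite /Defs.Rplus /= in_itv /= andbT => x0; rewrite indicE.
  have [|_] := boolP (x \in A); last by rewrite mulr0 exprn_ge0.
  rewrite inE /A /= in_itv /= andbT mulr1 => rx.
  by rewrite lerXn2r ?nnegrE ?(ltW rx)// ltW// rad_gt0.
have rE0 : r = 0.
  apply/eqP; rewrite eq_le r0 andbT leNgt; apply/negP => rp.
  have c0 : 0 < opc T ^+ 2 by rewrite exprn_gt0// opc_gt0.
  (* Chosen so that [rad T / opc T ^+ 2 = 1 + d], ready for Bernoulli's inequality. *)
  pose d := (opc T ^+ 2)^-1; have d0 : 0 < d by rewrite invr_gt0.
  have bnd2 n : n%:R <= growthc T * n2 h / r / d.
    rewrite ler_pdivlMr// ler_pdivlMr//.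
    have := bnd n; have -> : rad T = (1 + d) * opc T ^+ 2.
      by rewrite mulrDl mul1r /d mulVf ?gt_eqF// addrC.
    rewrite exprMn mulrAC (ler_pM2r (exprn_gt0 n c0)) => hh; apply: le_trans hh.
    rewrite ler_pM2r//; apply: le_trans (bernoulli_expr n (ltW d0)).
    by rewrite lerDr.
  have := bnd2 (Num.truncn (growthc T * n2 h / r / d)).+1.
  by rewrite leNgt truncnS_gt.
have sub : ~` I `<=` ~` Rplus `|` A.
  move=> x /=; rewrite /A /Defs.Rplus /= !in_itv /= !andbT => /negP.
  by rewrite negb_and -!ltNge => /orP[x0|?]; [left; apply/negP; rewrite -ltNge|right].
have mC : measurable (~` Rplus) by exact: measurableC.
apply/eqP; rewrite eq_le measure_ge0 andbT.
apply: le_trans (_ : nu (~` Rplus `|` A) <= _)%E.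
  by rewrite le_measure ?inE//; [exact: measurableC (measurable_itv _)|exact: measurableU].
apply: le_trans (measureU2 _ mC mA) _.
by rewrite -[0%E]adde0; apply: leeD; [rewrite -nuR|rewrite [X in (X <= _)%E]nuAE rE0].
Qed.

Lemma cond_iii_represents M : cond_iii T M -> represents M.
Proof.
move=> hM h; have null := cond_iii_null h hM; split=> //.
apply: (pfun_ext _ (Lop_pfun T h)) => [|n].
  exact: (polyint_pfun (scalar_measure_fin M h) null).
rewrite -(cond_iii_moment h n hM).2 /polyint.
by apply: eq_Rintegral => x _; rewrite hornerXn.
Qed.

Lemma represents_cpd M : represents M -> cpd_op T.
Proof.
move=> hM; apply/cpd_opP => h u; have [null mom] := hM h; rewrite -mom.
apply: (polyint_pos (scalar_measure_fin M h) null) => t _.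
by rewrite horner_exp sqr_ge0.
Qed.

Lemma semispectral_ext M N : (forall h D, borelRplus D ->
  scalar_measure M h D = scalar_measure N h D) -> semispectral_eq M N.
Proof.
move=> h D bD; apply: bop_qform_ext => x.
have DR : D `&` Rplus = D by apply: setIidl; case: bD.
have := h x D bD; rewrite !scalar_measureE ?DR; [|by case: bD..].
move=> [e]; rewrite (ge0_Re (spectral_ge0 M bD x)) (ge0_Re (spectral_ge0 N bD x)).
by rewrite e.
Qed.

Lemma represents_unique M N : represents M -> represents N -> semispectral_eq N M.
Proof.
move=> hM hN; apply: semispectral_ext => h D [mD _].
have [nM mM] := hM h; have [nN mN] := hN h.
have fM := scalar_measure_fin M h; have fN := scalar_measure_fin N h.
apply: halfline_measure_unique => // x.
have mx := measurable_halfline x.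
rewrite -[LHS]fineK ?(nu_fin_num fN)// -[RHS]fineK ?(nu_fin_num fM)//; congr (_%:E).
rewrite -(halfline_cdf (rad_gt0 T) fN nN) -(halfline_cdf (rad_gt0 T) fM nM).
by congr (cdf _ _ _); apply/funext => q; rewrite mN mM.
Qed.

(** The support is an intersection of closed sets, one of which is the interval: its complement in
    the half-line has measure 0, first as a quadratic form and then as an operator. *)
Lemma represents_support M : represents M -> compactly_supported M.
Proof.
move=> hM; have cI : compact I by exact: segment_compact.
apply: (subclosed_compact _ cI).
  by apply: closed_bigI => F [].
move=> x; apply; split; first by apply: interval_closed.
split; first exact: sub_itv_Rplus.
have mD : measurable (Rplus `\` I).
  exact: measurableD (@measurable_Rplus R) (measurable_itv _).
have bD : borelRplus (Rplus `\` I) by split=> // y [].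
apply: bop_qform_ext => h; rewrite (ge0_Re (spectral_ge0 M bD h)) bop0E inner0l.
have := nu_Rplus (hM h).1 => e.
have e' : scalar_measure M h (Rplus `\` I) = 0%E by exact: e.
by rewrite scalar_measureE// (setIidl bD.2) in e'; case: e' => ->.
Qed.

End Representing.

Lemma cvg_sum_scalar (K : numFieldType) (I : Type) (r : seq I) (u : nat -> I -> K)
    (l : I -> K) :
  (forall i, (fun n => u n i : K^o) @ \oo --> (l i : K^o)) ->
  (fun n => \sum_(i <- r) u n i : K^o) @ \oo --> (\sum_(i <- r) l i : K^o).
Proof. exact: (@cvg_sumr K K^o). Qed.

(** * Positivity of the operator-valued moment kernel *)

Section Kernel.
Variables (R : realType) (H : hilbertType R[i]) (T : 'B(H)).
Local Notation C := R[i].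

Lemma Aop0 : Aop T 0 = 0.
Proof. by rewrite /Aop mulr0 poly_bracketE polysum0. Qed.
Lemma AopD p q : Aop T (p + q) = Aop T p + Aop T q.
Proof. by have := Aop_lin T 1 p q; rewrite !scale1r. Qed.
Lemma AopZ c q : Aop T (c *: q) = c *: Aop T q.
Proof. by have := Aop_lin T c q 0; rewrite Aop0 !addr0. Qed.
Lemma Aop_sum (J : Type) (r : seq J) (P : pred J) (E : J -> {poly C}) :
  Aop T (\sum_(i <- r | P i) E i) = \sum_(i <- r | P i) Aop T (E i).
Proof. by elim/big_ind2 : _ => [|p u q v <- <-|//]; rewrite ?Aop0 ?AopD. Qed.

Lemma cpolyZ (c : R) p : cpoly (c *: p) = c%:C *: cpoly p.
Proof. exact: map_polyZ. Qed.
Lemma cpolyXn n : cpoly ('X^n : {poly R}) = 'X^n.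
Proof. exact: map_polyXn. Qed.

Hypothesis hT : cpd_op T.

Lemma Aop_ge0 f : (forall t, 0 <= t <= rad T -> 0 <= f.[t]) -> bop_ge0 (Aop T (cpoly f)).
Proof. by move=> f0 h; rewrite inner_Aop ler0c; exact: Lop_itv_ge0. Qed.

Lemma Aop_Xn_ge0 n : bop_ge0 (Aop T 'X^n).
Proof.
rewrite -cpolyXn; apply: Aop_ge0 => t /andP[t0 _].
by rewrite hornerXn exprn_ge0.
Qed.

Lemma Aop_bern_ge0 N k : (k <= N)%N -> bop_ge0 (Aop T (cpoly (bern (rad T) N k))).
Proof.
move=> kN; apply: Aop_ge0 => t /andP[t0 tr].
rewrite /bern hornerZ hornerM horner_exp hornerX horner_exp hornerD hornerC hornerN hornerX.
by rewrite mulr_ge0 ?divr_ge0 ?mulr_ge0 ?exprn_ge0 ?subr_ge0 ?(ltW (rad_gt0 T)).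
Qed.

(** The diagonal case is [bernop_cvg] for the functional [L_x]; polarization gives the rest. *)
Lemma Aop_bernop_cvg q h k :
  (fun N => '[Aop T (cpoly (bernop (rad T) N (horner q))) h, k] : C^o) @ \oo -->
    ('[Aop T (cpoly q) h, k] : C^o).
Proof.
have diag x : (fun N => '[Aop T (cpoly (bernop (rad T) N (horner q))) x, x] : C^o) @ \oo -->
    ('[Aop T (cpoly q) x, x] : C^o).
  have pos k' l : 0 <= Lop T x ('X^k' * ((rad T)%:P - 'X) ^+ l).
    apply: (Lop_itv_ge0 hT) => t /andP[t0 tr].
    rewrite hornerM horner_exp hornerX horner_exp hornerD hornerC hornerN hornerX.
    by rewrite mulr_ge0 ?exprn_ge0 ?subr_ge0.
  have L := bernop_cvg (rad_gt0 T) (Lop_pfun T x) pos (f := q).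
  apply: cvg_ReIm.
    rewrite inner_Aop; under eq_fun do rewrite inner_Aop.
    exact: L.
  rewrite inner_Aop; under eq_fun do rewrite inner_Aop.
  exact: cvg_cst.
rewrite (bop_polarization (Aop T (cpoly q))).
rewrite (funext (fun N => bop_polarization (Aop T (cpoly (bernop (rad T) N (horner q)))) h k)).
have := @cvg_polarization C 4^-1 'i _ _ _ _ _ _ _ _ (diag (h + k)) (diag (h - k))
    (diag (h + 'i *: k)) (diag (h - 'i *: k)).
apply.
Qed.

(* For a Bernstein approximant the double sum is a combination of
   [<Aop (bern k) u_k, u_k>] with [u_k := sum_i x_k^i f_i] and weights [w x_k >= 0]. *)
Lemma kernel_ge0 (w : {poly R}) (f : nat -> H) n :
  (forall t, 0 <= t <= rad T -> 0 <= w.[t]) ->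
  0 <= \sum_(i < n) \sum_(j < n) '[Aop T (cpoly (w * 'X^(i + j))) (f i), f j].
Proof.
move=> w0.
pose z N : C := \sum_(i < n) \sum_(j < n)
  '[Aop T (cpoly (bernop (rad T) N (horner (w * 'X^(i + j))))) (f i), f j].
have zl : (z : nat -> C^o) @ \oo --> (\sum_(i < n) \sum_(j < n)
    '[Aop T (cpoly (w * 'X^(i + j))) (f i), f j] : C^o).
  apply: cvg_sum_scalar => i; apply: cvg_sum_scalar => j; exact: Aop_bernop_cvg.
have z0 N : 0 <= z N.
  pose x k := node (rad T) N k.
  pose u k := \sum_(i < n) (x k ^+ i)%:C *: f i.
  have -> : z N = \sum_(k < N.+1) w.[x k]%:C * '[Aop T (cpoly (bern (rad T) N k)) (u k), u k].
    transitivity (\sum_(i < n) \sum_(j < n) \sum_(k < N.+1)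
      (w.[x k]%:C * ((x k ^+ i)%:C * ((x k ^+ j)%:C *
        '[Aop T (cpoly (bern (rad T) N k)) (f i), f j])))).
      apply: eq_bigr => i _; apply: eq_bigr => j _.
      rewrite /bernop /cpoly rmorph_sum /= -/(cpoly _) Aop_sum bop_sumE inner_suml.
      apply: eq_bigr => k _.
      have := cpolyZ (w * 'X^(i + j)).[x k] (bern (rad T) N k).
      rewrite /cpoly => ->; rewrite AopZ bopZE innerZl hornerM hornerXn exprD.
      by rewrite (rmorphM (real_complex R)) (rmorphM (real_complex R)) /= !mulrA.
    under eq_bigr do rewrite exchange_big /=.
    rewrite exchange_big /=; apply: eq_bigr => k _.
    rewrite {1}/u bop_sum inner_suml mulr_sumr; apply: eq_bigr => i _.
    rewrite bopZ innerZl {1}/u inner_sumr !mulr_sumr; apply: eq_bigr => j _.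
    by rewrite innerZr conjR.
  apply: sumr_ge0 => k _; apply: mulr_ge0.
    rewrite ler0c; apply: w0; apply: node_itv; first exact: rad_gt0.
    by rewrite -ltnS.
  by apply: Aop_bern_ge0; rewrite -ltnS.
rewrite lecE; apply/andP; split.
  apply/eqP; have := cvg_Im zl.
  have im0 N : complex.Im (z N) = 0 by exact/ger0_Im/z0.
  under eq_fun do rewrite im0.
  by move=> /(@cvg_unique _ (@Rhausdorff R) _ _ _ 0); apply; exact: cvg_cst.
apply: (cvgr_to_ge (cvg_Re zl)); apply: nearW => N.
by have := z0 N; rewrite lecE => /andP[].
Qed.

End Kernel.

(** * The triplet representation *)

Section FinSupp.
Variables (F : nzRingType) (V : lmodType F).

Definition finsupp_pred : {pred nat -> V} :=
  fun f => `[< exists n, forall i, (n <= i)%N -> f i = 0 >].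

Record finsupp_seq := FinsuppSeq {
  finsupp_fun :> nat -> V;
  finsupp_subproof : finsupp_fun \in finsupp_pred }.

HB.instance Definition _ := [isSub for finsupp_fun].
HB.instance Definition _ := [Choice of finsupp_seq by <:].

Lemma finsupp_submod_closed : submod_closed finsupp_pred.
Proof.
split=> [|a f g /asboolP[m hm] /asboolP[n hn]]; apply/asboolP; first by exists 0%N.
exists (maxn m n) => i; rewrite geq_max => /andP[mi ni].
rewrite -[LHS]/(a *: f i + g i).
by rewrite hm// hn// scaler0 addr0.
Qed.

HB.instance Definition _ :=
  GRing.isSubmodClosed.Build F _ finsupp_pred finsupp_submod_closed.
HB.instance Definition _ := [SubChoice_isSubLmodule of finsupp_seq by <:].

Lemma finsuppE a (f g : finsupp_seq) i : (a *: f + g) i = a *: f i + g i.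
Proof. by []. Qed.

Lemma finsupp_ext (f g : finsupp_seq) : f =1 g -> f = g.
Proof. by move=> h; apply/val_inj/funext. Qed.

Lemma finsupp_bound (f : finsupp_seq) : exists n, forall i, (n <= i)%N -> f i = 0.
Proof. exact/asboolP/finsupp_subproof. Qed.

(** Some bound on the support, not the least one, hence unrelated for [f], [g] and [f + g];
    [gns_formE] lets the form be computed with any bounds. *)
Definition supp (f : finsupp_seq) : nat := projT1 (cid (finsupp_bound f)).

Lemma suppP f i : (supp f <= i)%N -> f i = 0.
Proof. by rewrite /supp; case: (cid _) => n /= h; exact: h. Qed.

Lemma shift_subproof (f : finsupp_seq) :
  (fun n => if n is m.+1 then f m else 0) \in finsupp_pred.
Proof.
by apply/asboolP; exists (supp f).+1 => -[//|i] /= h; exact: suppP.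
Qed.

Definition shift f : finsupp_seq := FinsuppSeq (shift_subproof f).

Lemma shift_lin a f g : shift (a *: f + g) = a *: shift f + shift g.
Proof.
by apply: finsupp_ext => -[|i]; rewrite !finsuppE /= ?scaler0 ?addr0.
Qed.

Lemma single_subproof (v : V) : (fun n => if n is 0%N then v else 0) \in finsupp_pred.
Proof. by apply/asboolP; exists 1%N => -[]. Qed.

Definition single v : finsupp_seq := FinsuppSeq (single_subproof v).

Lemma single_lin a v w : single (a *: v + w) = a *: single v + single w.
Proof.
by apply: finsupp_ext => -[|i]; rewrite !finsuppE /= ?scaler0 ?addr0.
Qed.

Lemma finsupp_sumE (J : Type) (r : seq J) (E : J -> finsupp_seq) i :
  (\sum_(j <- r) E j) i = \sum_(j <- r) E j i.
Proof. by elim/big_ind2 : _ => // x f y g <- <-. Qed.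

Lemma iter_shiftE n f i :
  iter n shift f i = if (n <= i)%N then f (i - n)%N else 0.
Proof.
by elim: n i => [|n IH] [|i] //=; rewrite ?subn0.
Qed.

Lemma finsupp_decomp (f : finsupp_seq) :
  f = \sum_(i < supp f) iter i shift (single (f i)).
Proof.
apply: finsupp_ext => k; rewrite finsupp_sumE.
under eq_bigr do rewrite iter_shiftE.
have [kf|fk] := ltnP k (supp f).
  rewrite (bigD1 (Ordinal kf)) //= leqnn subnn big1 ?addr0// => i ik.
  case: ifP => // ik'; suff : (0 < k - i)%N by case: (k - i)%N.
  rewrite subn_gt0 ltn_neqAle ik' andbT; apply: contra ik => /eqP e.
  exact/eqP/val_inj.
rewrite suppP// big1// => i _; rewrite (ltnW (leq_trans (ltn_ord i) fk)).
suff : (0 < k - i)%N by case: (k - i)%N.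
by rewrite subn_gt0 (leq_trans (ltn_ord i) fk).
Qed.

End FinSupp.

Lemma sum_ord_supp (V : nmodType) (F : nat -> V) m n : (forall i, (m <= i)%N -> F i = 0) ->
  (m <= n)%N -> \sum_(i < n) F i = \sum_(i < m) F i.
Proof.
move=> Fm mn; rewrite [RHS](big_ord_widen n F mn).
rewrite [LHS](bigID (fun i : 'I_n => (i < m)%N)) /= [X in _ + X]big1 ?addr0//.
by move=> i; rewrite -leqNgt; exact: Fm.
Qed.

(** * The pre-inner product and the shift *)

Section GNS.
Variables (R : realType) (H : hilbertType R[i]) (T : 'B(H)).
Local Notation C := R[i].
Local Notation V := (finsupp_seq H).
Hypothesis hT : cpd_op T.
Let G n := Aop T 'X^n.
Implicit Types f g : V.

Definition gns_form (f g : V) : C :=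
  \sum_(i < supp f) \sum_(j < supp g) '[Aop T 'X^(i + j) (f i), g j].

Lemma gns_formE n m f g : (forall i, (n <= i)%N -> f i = 0) ->
  (forall i, (m <= i)%N -> g i = 0) ->
  gns_form f g = \sum_(i < n) \sum_(j < m) '[G (i + j) (f i), g j].
Proof.
have E (a b c d : nat) : (forall i, (a <= i)%N -> f i = 0) ->
    (forall i, (b <= i)%N -> g i = 0) -> (a <= c)%N -> (b <= d)%N ->
    \sum_(i < c) \sum_(j < d) '[G (i + j) (f i), g j] =
    \sum_(i < a) \sum_(j < b) '[G (i + j) (f i), g j].
  move=> fa gb ac bd.
  rewrite (@sum_ord_supp _ (fun i => \sum_(j < d) '[G (i + j) (f i), g j]) a)//.
    apply: eq_bigr => i _.
    apply: (@sum_ord_supp _ (fun j => '[G (i + j) (f i), g j])) => // j bj.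
    by rewrite gb// inner0r.
  by move=> i ai; rewrite big1// => j _; rewrite fa// bop0 inner0l.
move=> fn gm; rewrite /gns_form.
have e1 := E _ _ _ _ (@suppP _ _ f) (@suppP _ _ g) (leq_maxl _ n) (leq_maxl _ m).
have e2 := E _ _ _ _ fn gm (leq_maxr (supp f) _) (leq_maxr (supp g) _).
by rewrite -e2 e1.
Qed.

Lemma gns_psd : psd_form gns_form.
Proof.
split=> [a f g k|f g|f].
- pose n := maxn (supp (a *: f + g)) (maxn (supp f) (supp g)).
  have b1 i : (n <= i)%N -> (a *: f + g) i = 0.
    by rewrite geq_max => /andP[h _]; exact: suppP.
  have b2 i : (n <= i)%N -> f i = 0.
    by rewrite !geq_max => /and3P[_ h _]; exact: suppP.
  have b3 i : (n <= i)%N -> g i = 0.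
    by rewrite !geq_max => /and3P[_ _ h]; exact: suppP.
  have b4 := @suppP _ _ k.
  rewrite (gns_formE b1 b4) (gns_formE b2 b4) (gns_formE b3 b4).
  rewrite mulr_sumr -big_split /=; apply: eq_bigr => i _.
  rewrite mulr_sumr -big_split /=; apply: eq_bigr => j _.
  exact: (bop_sesqui_l (G (i + j)) a (f i) (g i) (k j)).
- rewrite /gns_form exchange_big /= rmorph_sum /=; apply: eq_bigr => i _.
  rewrite rmorph_sum /=; apply: eq_bigr => j _; rewrite addnC.
  exact: psd_herm (ge0_psd (Aop_Xn_ge0 hT (i + j))) _ _.
- have := @kernel_ge0 R H T hT 1 f (supp f).
  have e i j : cpoly (1 * 'X^(i + j) : {poly R}) = 'X^(i + j) by rewrite mul1r cpolyXn.
  rewrite /gns_form; under eq_bigr => i _ do (under eq_bigr => j _ do rewrite e).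
  by apply => t _; rewrite hornerC.
Qed.

Lemma shift_supp (f : V) i : ((supp f).+1 <= i)%N -> shift f i = 0.
Proof. by case: i => // i h; exact: (@suppP _ _ f i). Qed.

Lemma gns_shiftl f g : gns_form (shift f) g =
  \sum_(i < supp f) \sum_(j < supp g) '[G (i + j).+1 (f i), g j].
Proof.
rewrite (gns_formE (@shift_supp f) (@suppP _ _ g)) big_ord_recl [X in X + _]big1 ?add0r//.
by move=> j _; rewrite bop0 inner0l.
Qed.

Lemma gns_shiftr f g : gns_form f (shift g) =
  \sum_(i < supp f) \sum_(j < supp g) '[G (i + j).+1 (f i), g j].
Proof.
rewrite (gns_formE (@suppP _ _ f) (@shift_supp g)); apply: eq_bigr => i _.
rewrite big_ord_recl inner0r add0r; apply: eq_bigr => j _.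
by rewrite /= /bump /= add1n addnS.
Qed.

Lemma gns_shift_sym f g : gns_form (shift f) g = gns_form f (shift g).
Proof. by rewrite gns_shiftl gns_shiftr. Qed.

Lemma gns_shift_pos f : 0 <= complex.Re (gns_form (shift f) f).
Proof.
have := @kernel_ge0 R H T hT 'X f (supp f).
have e i j : cpoly ('X * 'X^(i + j) : {poly R}) = 'X^((i + j).+1) by rewrite -exprS cpolyXn.
rewrite gns_shiftl; under eq_bigr => i _ do (under eq_bigr => j _ do rewrite e).
move=> h; suff : 0 <= \sum_(i < supp f) \sum_(j < supp f) '[G (i + j).+1 (f i), f j].
  by rewrite lecE => /andP[].
by apply: h => t /andP[]; rewrite hornerX.
Qed.

(** Shifting both arguments raises the exponent in the kernel by 2, so the bound is kernel
    positivity for the weight [rad T ^+ 2 - X^2], nonnegative on the interval. *)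
Lemma gns_shift_bound f : fsq gns_form (shift f) <= rad T ^+ 2 * fsq gns_form f.
Proof.
have := @kernel_ge0 R H T hT ((rad T ^+ 2) *: 1 - 'X^2) f (supp f).
have e i j : Aop T (cpoly (((rad T ^+ 2) *: 1 - 'X^2) * 'X^(i + j) : {poly R})) =
    (rad T ^+ 2)%:C *: G (i + j) + (- 1) *: G (i + j).+2.
  rewrite mulrBl -scalerAl mul1r -exprD add2n /G -!AopZ -AopD; congr Aop.
  by rewrite /cpoly rmorphB /= -!/(cpoly _) cpolyZ !cpolyXn scaleN1r.
under eq_bigr => i _ do (under eq_bigr => j _ do rewrite e bopDE !bopZE innerDl !innerZl).
have E : \sum_(i < supp f) \sum_(j < supp f) ((rad T ^+ 2)%:C * '[G (i + j) (f i), f j] +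
     -1 * '[G (i + j).+2 (f i), f j]) =
   (rad T ^+ 2)%:C * gns_form f f - gns_form (shift f) (shift f).
  rewrite gns_shift_sym.
  have b i : ((supp f).+2 <= i)%N -> shift (shift f) i = 0.
    by case: i => [|[|i]] // h; exact: (@suppP _ _ f i).
  rewrite (gns_formE (@suppP _ _ f) b) mulr_sumr -sumrB; apply: eq_bigr => i _.
  rewrite !big_ord_recl !inner0r !add0r mulr_sumr -sumrB; apply: eq_bigr => j _.
  by rewrite mulN1r /= /bump /= !add1n !addnS.
rewrite E => h.
have {h} : 0 <= (rad T ^+ 2)%:C * gns_form f f - gns_form (shift f) (shift f).
  apply: h => t /andP[t0 tr]; rewrite hornerD hornerZ hornerC hornerN hornerXn mulr1.
  by rewrite subr_ge0 lerXn2r ?nnegrE// (le_trans t0).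
rewrite (psdE gns_psd) (psdE gns_psd (shift f)) -rmorphM -rmorphB ler0c /=.
by rewrite subr_ge0.
Qed.

Definition gns_pre : preHilbert R := PreHilbert gns_psd.
Definition gns_space : hilbertType C := completion gns_pre.
Definition gns_S : 'B(gns_space) := @ext_bop R gns_pre (@shift C H) (rad T)
  gns_shift_sym (@shift_lin C H) gns_shift_bound.

Lemma gns_S_ge0 : bop_ge0 gns_S.
Proof. apply: ext_bop_ge0; exact: gns_shift_pos. Qed.

End GNS.

Lemma norm_le_n2 (R : realType) (H K : hilbertType R[i]) (x : H) (y : K) (c : R) :
  0 <= c -> n2 y <= c ^+ 2 * n2 x -> `|y| <= c%:C * `|x|.
Proof.
move=> c0 h; have c0' : 0 <= c%:C * `|x| by apply: mulr_ge0; [rewrite ler0c|].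
have p2 : (0 < 2)%N by [].
have := ler_pXn2r p2 (x := `|y|) (y := c%:C * `|x|); rewrite !nnegrE.
move=> /(_ (normr_ge0 y) c0') <-; rewrite exprMn !norm_n2 -rmorphXn -rmorphM lecR.
exact: h.
Qed.

Section GNSTriplet.
Variables (R : realType) (H : hilbertType R[i]) (T : 'B(H)).
Local Notation C := R[i].
Hypothesis hT : cpd_op T.
Local Notation K := (gns_space hT).
Local Notation S := (gns_S hT).
Local Notation P := (gns_pre hT).
Local Notation embV := (@emb R P : finsupp_seq H -> K).

Lemma gns_shift_single n h k :
  gns_form T (iter n (@shift C H) (single h)) (single k) = '[Aop T 'X^n h, k].
Proof.
have b1 i : (n.+1 <= i)%N -> iter n (@shift C H) (single h) i = 0.
  move=> ni; rewrite iter_shiftE (ltnW ni).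
  suff : (0 < i - n)%N by case: (i - n)%N.
  by rewrite subn_gt0.
have b2 i : (1 <= i)%N -> single k i = 0 by case: i.
rewrite (gns_formE T b1 b2) big_ord_recr /= [X in X + _]big1 ?add0r; last first.
  move=> i _; rewrite big1// => j _.
  by rewrite iter_shiftE leqNgt ltn_ord /= bop0 inner0l.
by rewrite big_ord_recl big_ord0 addr0 iter_shiftE leqnn subnn addn0.
Qed.

Lemma gns_Q_subproof : (fun h => embV (single h)) \in @bounded_linear_pred C H K.
Proof.
apply/asboolP; split=> [a x y|].
  have e : single (a *: x + y) = a *: single x + single y by exact: single_lin.
  by rewrite e; exact: (@emb_linear R P a (single x) (single y)).
(* The squared norm of the image of [h] is [L_h 1], which [Lop1_le] bounds. *)
exists (Num.sqrt (growthc T))%:C => h; apply: norm_le_n2; first exact: sqrtr_ge0.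
rewrite sqr_sqrtr ?growthc_ge0//; apply: le_trans (Lop1_le T h).
have -> : n2 (embV (single h)) = complex.Re (gns_form T (single h) (single h)).
  exact: (@fsq_emb R P (single h)).
have := gns_shift_single 0 h h; rewrite /= => ->.
rewrite -(cpolyXn R 0) inner_Aop expr0; exact: lexx.
Qed.

Definition gns_Q : 'B(H, K) := Bop gns_Q_subproof.

Lemma gns_S_pow n u : (S ^+ n) (embV u) = embV (iter n (@shift C H) u).
Proof.
elim: n => [|n IH]; first by rewrite expr0.
rewrite [S ^+ n.+1]exprS bopME IH; exact: ext_bop_emb.
Qed.

Lemma gns_moment n h k : '[(S ^+ n) (gns_Q h), gns_Q k] = '[Aop T 'X^n h, k].
Proof.
have -> : (S ^+ n) (gns_Q h) = embV (iter n (@shift C H) (single h)).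
  exact: (gns_S_pow n (single h)).
rewrite -gns_shift_single; exact: (@cinner_emb R P).
Qed.

Lemma gns_cond_ii' : cond_ii' T gns_Q S.
Proof.
move=> q; apply: bop_ext => h; apply: inner_ext => k.
rewrite -[poly_bracket _ _]/(Aop T q) -[X in _ = '[X, _]]/(gns_Q^adj (poly_op q S (gns_Q h))).
rewrite adjointPr -[X in Aop T X]coefK poly_def Aop_sum bop_sumE inner_suml.
rewrite /poly_op bop_sumE inner_suml; apply: eq_bigr => i _.
by rewrite AopZ !bopZE !innerZl gns_moment.
Qed.

(** Embedded sequences are dense, and by [finsupp_decomp] the sequence [v] is the sum of the vectors
    [S^i (Q (v i))]. *)
Lemma gns_minimal : minimal_triplet gns_Q S.
Proof.
apply/seteqP; split=> // f _ U nU; have [v hv] := compl_rep f.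
have cv : (fun n => embV (v n)) @ \oo --> (f : K).
  apply/cvg_n2P => e e0; exact: emb_cvg hv e e0.
have [N _ hN] := cv U nU; pose n := N; have Un : U (embV (v n)) by exact: hN n (leqnn N).
exists (embV (v n)); split=> //.
exists (supp (v n)), (fun=> 1), (fun i => (S ^+ i) (gns_Q (v n i))); split.
  by move=> i; exists i, (v n i).
rewrite {1}(finsupp_decomp (v n)).
have embS (J : Type) (r : seq J) (E : J -> finsupp_seq H) :
    embV (\sum_(j <- r) E j) = \sum_(j <- r) embV (E j).
  elim: r => [|x r IH]; last first.
    rewrite !big_cons -IH.
    by have := @emb_linear R P 1 (E x) (\sum_(j <- r) E j); rewrite !scale1r.
  rewrite !big_nil; have := @embB R P (0 : finsupp_seq H) 0.
  by rewrite !subrr.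
rewrite embS; apply: eq_bigr => i _; rewrite scale1r.
by rewrite -gns_S_pow.
Qed.

End GNSTriplet.

(** * From triplets back to CPD, and the equivalences *)

Section Triplet.
Variables (R : realType) (H K : hilbertType R[i]) (T : 'B(H)).
Variables (Q : 'B(H, K)) (S : 'B(K)).

Lemma cond_ii'_iii' : cond_ii' T Q S -> cond_iii' T Q S.
Proof.
move=> h n; rewrite -Aop_Xn /Aop h; congr (bcomp _ (bcomp _ _)).
exact: (@polysumXn _ _ (fun n => S ^+ n)).
Qed.

Lemma pfun_sqr (L : {poly R} -> R) u : pfun L -> L (u ^+ 2) =
  \sum_(i < size u) \sum_(j < size u) u`_i * (u`_j * L 'X^(i + j)).
Proof.
move=> hL; rewrite -[u in LHS]coefK poly_def expr2 mulr_suml (pfun_sum hL).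
apply: eq_bigr => i _; rewrite mulr_sumr (pfun_sum hL); apply: eq_bigr => j _.
have -> : u`_i *: 'X^i * (u`_j *: 'X^j) = (u`_i * u`_j) *: 'X^(i + j).
  by rewrite -scalerAl -scalerAr scalerA exprD.
by rewrite (pfunZ hL) mulrA.
Qed.

Lemma ge0_pow_sym n x y : bop_ge0 S -> '[(S ^+ n) x, y] = '[x, (S ^+ n) y].
Proof.
move=> S0; have sym x' y' : '[S x', y'] = '[x', S y'].
  by rewrite (psd_herm (ge0_psd S0) y' x') -innerC.
elim: n x y => [|n IH] x y; first by rewrite expr0.
by rewrite {1}exprS exprSr !bopME sym IH.
Qed.

(** Since [S] is symmetric, [L_x (u^2)] is the squared norm of [u(S) Q x]. *)
Lemma cond_iii'_cpd : bop_ge0 S -> cond_iii' T Q S -> cpd_op T.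
Proof.
move=> S0 h; apply/cpd_opP => x u.
pose y := \sum_(i < size u) (u`_i)%:C *: (S ^+ i) (Q x).
suff e : (Lop T x (u ^+ 2))%:C = '[y, y] by rewrite -ler0c e innerE ler0c n2_ge0.
rewrite (pfun_sqr u (Lop_pfun T x)) rmorph_sum /= /y inner_suml; apply: eq_bigr => i _.
rewrite rmorph_sum /= innerZl inner_sumr mulr_sumr; apply: eq_bigr => j _.
rewrite innerZr conjR -ge0_pow_sym// -bopME -exprD addnC.
rewrite !rmorphM /=; congr (_ * (_ * _)).
rewrite -inner_Aop cpolyXn Aop_Xn h.
by rewrite -[LHS]/('[Q^adj ((S ^+ (j + i)) (Q x)), x]) adjointPr.
Qed.

End Triplet.

Theorem theorem3p3p1 (R : realType) (H : hilbertType R[i]) (T : 'B(H)) :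
  (* equivalence of (i), (ii), (ii'), (iii), (iii') *)
  [<-> cpd_op T;
       exists M : semispectral H, compactly_supported M /\ cond_ii T M;
       exists (K : hilbertType R[i]) (Q : 'B(H, K)) (S : 'B(K)),
         bop_ge0 S /\ cond_ii' T Q S;
       exists M : semispectral H, compactly_supported M /\ cond_iii T M;
       exists (K : hilbertType R[i]) (Q : 'B(H, K)) (S : 'B(K)),
         bop_ge0 S /\ cond_iii' T Q S] /\
  (* uniqueness and coincidence of the measures *)
  (cpd_op T -> exists M : semispectral H,
    [/\ compactly_supported M, cond_ii T M, cond_iii T M, cond_repr T M &
      forall N : semispectral H, compactly_supported N ->
        cond_ii T N \/ cond_iii T N \/ cond_repr T N -> semispectral_eq N M]) /\
  (* the triplets can be chosen to be minimal *)
  (cpd_op T ->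
    (exists (K : hilbertType R[i]) (Q : 'B(H, K)) (S : 'B(K)),
      [/\ bop_ge0 S, cond_ii' T Q S & minimal_triplet Q S]) /\
    (exists (K : hilbertType R[i]) (Q : 'B(H, K)) (S : 'B(K)),
      [/\ bop_ge0 S, cond_iii' T Q S & minimal_triplet Q S])).
Proof.
have meas : cpd_op T -> exists M : semispectral H,
    [/\ compactly_supported M, cond_ii T M, cond_iii T M, cond_repr T M &
      forall N : semispectral H, compactly_supported N ->
        cond_ii T N \/ cond_iii T N \/ cond_repr T N -> semispectral_eq N M].
  move=> hT; have rM := spec_measure_represents hT; have iiM := represents_ii rM.
  exists (spec_measure hT); split=> //.
  - exact: represents_support rM.
  - exact: cond_ii_iii.
  - exact: cond_ii_repr.
  - move=> N _ hN; apply: represents_unique rM _; apply: cond_iii_represents.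
    by case: hN => [/cond_ii_iii|[|/cond_repr_iii]].
have trip : cpd_op T -> exists (K : hilbertType R[i]) (Q : 'B(H, K)) (S : 'B(K)),
    [/\ bop_ge0 S, cond_ii' T Q S & minimal_triplet Q S].
  move=> hT; exists (gns_space hT), (gns_Q hT), (gns_S hT).
  by split; [exact: gns_S_ge0|exact: gns_cond_ii'|exact: gns_minimal].
(* Measures and triplets are both constructed from (i), so the intermediate implications pass
   through (i). *)
split; [tfae|split=> // hT].
- by move=> /meas[M [cM iiM _ _ _]]; exists M.
- move=> [M [_ /cond_ii_iii/cond_iii_represents/represents_cpd/trip]].
  by move=> [K [Q [S [S0 hS _]]]]; exists K, Q, S.
- move=> [K [Q [S [S0 /cond_ii'_iii' hS]]]].
  by have [M [cM _ iiiM _ _]] := meas (cond_iii'_cpd S0 hS); exists M.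
- move=> [M [_ /cond_iii_represents/represents_cpd/trip]].
  by move=> [K [Q [S [S0 /cond_ii'_iii' hS _]]]]; exists K, Q, S.
- by move=> [K [Q [S [S0 hS]]]]; exact: cond_iii'_cpd S0 hS.
split; first exact: trip.
have [K [Q [S [S0 hS mS]]]] := trip hT; exists K, Q, S.
by split=> //; exact: cond_ii'_iii'.
Qed.
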